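(* Let $U$ and $V$ be vertex operator algebras, let $\mathcal{U}$ and $\mathcal{V}$ be locally finite abelian categories of grading-restricted generalized $U$- and $V$-modules which are closed under subquotients, and suppose $p_M:P_M\twoheadrightarrow M$ and $p_W:P_W\twoheadrightarrow W$ are projective covers of simple objects in $\mathcal{U}$ and $\mathcal{V}$, respectively. Then $p_M\otimes p_W:P_M\otimes P_W\twoheadrightarrow M\otimes W$ is a projective cover of $M\otimes W$ in $\mathcal{D}(\mathcal{U},\mathcal{V})$. In particular, if $\mathcal{U}$ and $\mathcal{V}$ have enough projectives, then so does $\mathcal{D}(\mathcal{U},\mathcal{V})$, and every projective object in $\mathcal{D}(\mathcal{U},\mathcal{V})$ is a finite direct sum of tensor products of projective objects in $\mathcal{U}$ and $\mathcal{V}$.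
   Context: Everything is over $\mathbb{C}$. A vertex operator algebra (VOA) is $V=\bigoplus_{n\in\mathbb{Z}}V_{(n)}$ with $\dim V_{(n)}<\infty$ and $V_{(n)}=0$ for $n\ll 0$, vertex operators $Y_V(v,x)=\sum_{n\in\mathbb{Z}}v_n\,x^{-n-1}$, vacuum $\mathbf{1}$ and conformal vector $\omega$ with $Y_V(\omega,x)=\sum_n L(n)x^{-n-2}$, where $V_{(n)}$ is the $L(0)$-eigenspace of eigenvalue $n$, satisfying the usual axioms. A weak $V$-module is a module $(W,Y_W)$ for $V$ viewed as a vertex algebra, with no grading assumed. A generalized $V$-module is a weak $V$-module that is the direct sum of its generalized $L(0)$-eigenspaces $W_{[h]}$, $h\in\mathbb{C}$; it is grading-restricted if for every $h\in\mathbb{C}$, $\dim W_{[h]}<\infty$ and $W_{[h+n]}=0$ for all sufficiently negative $n\in\mathbb{Z}$. Categories of modules are full subcategories closed under isomorphisms. $U\otimes V$ is a VOA with $Y_{U\otimes V}(u\otimes v,x)=Y_U(u,x)\otimes Y_V(v,x)$, vacuum $\mathbf{1}_U\otimes\mathbf{1}_V$ and conformal vector $\omega_U\otimes\mathbf{1}_V+\mathbf{1}_U\otimes\omega_V$; $M\otimes W$ is a $U\otimes V$-module with $Y(u\otimes v,x)=Y_M(u,x)\otimes Y_W(v,x)$. A $U\otimes V$-module restricts to a weak $U$-module and a weak $V$-module via $u\mapsto u\otimes\mathbf{1}_V$ and $v\mapsto\mathbf{1}_U\otimes v$. $\mathcal{D}(\mathcal{U},\mathcal{V})$ is the category of finite-length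 grading-restricted generalized $U\otimes V$-modules $X$ such that the $U$-submodule generated by any vector in $X$ is an object of $\mathcal{U}$, and the $V$-submodule generated by any vector in $X$ is an object of $\mathcal{V}$. Under the stated hypotheses it is a locally finite abelian category. A $\mathbb{C}$-linear abelian category is locally finite if all morphism spaces are finite dimensional and all objects have finite length. A projective cover of $W$ is a surjection $p_W:P_W\twoheadrightarrow W$ with $P_W$ projective such that for any surjection $p:P\twoheadrightarrow W$ with $P$ projective there is a surjection $f:P\twoheadrightarrow P_W$ with $p_W\circ f=p$. A category has enough projectives if every object is a quotient of a projective object. *)

(* Defs.v *)
From HB Require Import structures.
From mathcomp Require Import all_boot all_order all_algebra.
From mathcomp Require Import boolp classical_sets functions cardinality fsbigop.
From mathcomp Require Import reals.
From mathcomp Require Export complex.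

Set Implicit Arguments.
Unset Strict Implicit.
Unset Printing Implicit Defensive.

Import GRing.Theory.
Local Open Scope classical_set_scope.
Local Open Scope ring_scope.
Local Open Scope quotient_scope.

Section TensorProduct.
Variable K : fieldType.

Definition is_bilinear (A B Z : lmodType K) (f : A -> B -> Z) : Prop :=
  bilinear_for *:%R *:%R f.

Variables A B : lmodType K.

Definition feval (Z : lmodType K) (f : A -> B -> Z) (s : seq (A * B)) : Z :=
  \sum_(p <- s) f p.1 p.2.

(* A list of pairs stands for the formal sum of the corresponding pure
   tensors; two formal sums are identified when no bilinear map separates
   them, so that the quotient is the universal target of bilinear maps
   (see [tpure_bilinear], [tlift_tpure], [tlift_linear] and [tlift_unique]). *)
Definition tens_rel (s t : seq (A * B)) : bool :=
  `[< forall (Z : lmodType K) (f : A -> B -> Z),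
        is_bilinear f -> feval f s = feval f t >].

Lemma tens_rel_refl : reflexive tens_rel.
Proof. by move=> s; apply/asboolP. Qed.

Lemma tens_rel_sym : symmetric tens_rel.
Proof.
move=> s t; apply/asboolP/asboolP => h Z f bf; exact/esym/h.
Qed.

Lemma tens_rel_trans : transitive tens_rel.
Proof.
move=> s t u /asboolP h1 /asboolP h2; apply/asboolP => Z f bf.
by rewrite h1 // h2.
Qed.

Canonical tens_equiv := EquivRel tens_rel tens_rel_refl tens_rel_sym tens_rel_trans.

Definition tens : Type := {eq_quot tens_equiv}.

HB.instance Definition _ := Choice.on tens.

Definition tpi (s : seq (A * B)) : tens := \pi_({eq_quot tens_equiv}) s.
Definition trepr (x : tens) : seq (A * B) := repr (x : {eq_quot tens_equiv}).

Definition tpure (a : A) (b : B) : tens := tpi [:: (a, b)].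

(* Only meaningful for a bilinear [f], in which case the value does not depend
   on the representative. *)
Definition tlift (Z : lmodType K) (f : A -> B -> Z) (x : tens) : Z :=
  feval f (trepr x).

Lemma tlift_pi (Z : lmodType K) (f : A -> B -> Z) (s : seq (A * B)) :
  is_bilinear f -> tlift f (tpi s) = feval f s.
Proof.
move=> bf; have : tens_rel (trepr (tpi s)) s.
  have := reprK (tpi s : {eq_quot tens_equiv}).
  by move/eqP; rewrite eqmodE.
by move/asboolP; apply.
Qed.

Lemma tens_ext (x y : tens) :
  (forall (Z : lmodType K) (f : A -> B -> Z),
     is_bilinear f -> tlift f x = tlift f y) -> x = y.
Proof.
move=> h; rewrite -[x](@reprK _ {eq_quot tens_equiv}).
rewrite -[y](@reprK _ {eq_quot tens_equiv}).
by apply/eqP; rewrite eqmodE; apply/asboolP => Z f bf; exact: h.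
Qed.

Definition tadd (x y : tens) : tens := tpi (trepr x ++ trepr y).
Definition tscale (c : K) (x : tens) : tens :=
  tpi [seq (c *: p.1, p.2) | p <- trepr x].
Definition topp (x : tens) : tens := tscale (-1) x.
Definition tzero : tens := tpi [::].

Section Lift.
Variables (Z : lmodType K) (f : A -> B -> Z) (bf : is_bilinear f).

Lemma tlift0 : tlift f tzero = 0.
Proof. by rewrite tlift_pi // /feval big_nil. Qed.

Lemma tliftD x y : tlift f (tadd x y) = tlift f x + tlift f y.
Proof. by rewrite tlift_pi // /feval big_cat. Qed.

Lemma tliftZ c x : tlift f (tscale c x) = c *: tlift f x.
Proof.
rewrite tlift_pi // /feval big_map scaler_sumr; apply: eq_bigr => p _ /=.
have h (a : K) u v : f (a *: u + v) p.2 = a *: f u p.2 + f v p.2 by exact: bf.1.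
have f0 : f 0 p.2 = 0 by have := h (-1) 0 0; rewrite addr0 scaler0 scaleN1r addNr.
by rewrite -[c *: p.1]addr0 h f0 addr0.
Qed.

Lemma tliftN x : tlift f (topp x) = - tlift f x.
Proof. by rewrite /topp tliftZ scaleN1r. Qed.
End Lift.

Lemma taddA : associative tadd.
Proof. by move=> x y z; apply: tens_ext => Z f bf; rewrite !tliftD // addrA. Qed.
Lemma taddC : commutative tadd.
Proof. by move=> x y; apply: tens_ext => Z f bf; rewrite !tliftD // addrC. Qed.
Lemma tadd0 : left_id tzero tadd.
Proof. by move=> x; apply: tens_ext => Z f bf; rewrite tliftD // tlift0 // add0r. Qed.
Lemma taddN : left_inverse tzero topp tadd.
Proof.
by move=> x; apply: tens_ext => Z f bf; rewrite tliftD // tliftN // tlift0 // addNr.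
Qed.

HB.instance Definition _ := GRing.isZmodule.Build tens taddA taddC tadd0 taddN.

Lemma tscaleA a b v : tscale a (tscale b v) = tscale (a * b) v.
Proof. by apply: tens_ext => Z f bf; rewrite !tliftZ // scalerA. Qed.
Lemma tscale1 : left_id 1 tscale.
Proof. by move=> v; apply: tens_ext => Z f bf; rewrite !tliftZ // scale1r. Qed.
Lemma tscaleDr : right_distributive tscale +%R.
Proof.
by move=> c x y; apply: tens_ext => Z f bf; rewrite !(tliftD, tliftZ) // scalerDr.
Qed.
Lemma tscaleDl v : {morph tscale^~ v : a b / a + b}.
Proof.
by move=> a b; apply: tens_ext => Z f bf; rewrite !(tliftD, tliftZ) // scalerDl.
Qed.

HB.instance Definition _ :=
  GRing.Zmodule_isLmodule.Build K tens tscaleA tscale1 tscaleDr tscaleDl.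

Lemma tlift_tpure (Z : lmodType K) (f : A -> B -> Z) a b :
  is_bilinear f -> tlift f (tpure a b) = f a b.
Proof. by move=> bf; rewrite tlift_pi // /feval big_seq1. Qed.

Lemma tlift_linear (Z : lmodType K) (f : A -> B -> Z) :
  is_bilinear f -> linear (tlift f).
Proof. by move=> bf c x y; rewrite tliftD // tliftZ. Qed.

Lemma tpure_bilinear : is_bilinear tpure.
Proof.
split=> [b c a a'|a c b b']; apply: tens_ext => Z f bf.
- by rewrite tlift_linear // !tlift_tpure //; exact: bf.1.
- by rewrite tlift_linear // !tlift_tpure //; exact: bf.2.
Qed.

Lemma tlift_unique (Z : lmodType K) (g h : tens -> Z) :
  linear g -> linear h ->
  (forall a b, g (tpure a b) = h (tpure a b)) -> g = h.
Proof.
move=> lg lh gh.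
have l0 (k : tens -> Z) : linear k -> k 0 = 0.
  by move=> lk; have := lk (-1) 0 0; rewrite addr0 scaler0 scaleN1r addNr.
have lD (k : tens -> Z) : linear k -> {morph k : x y / x + y}.
  by move=> lk x y; have := lk 1 x y; rewrite !scale1r.
have sumE s : tpi s = \sum_(p <- s) tpure p.1 p.2.
  elim: s => [|[a b] s IH]; first by rewrite big_nil.
  rewrite big_cons -IH; apply: tens_ext => Z' f bf.
  by rewrite tliftD // tlift_tpure // !tlift_pi // /feval big_cons.
apply/funext => x; rewrite -[x](@reprK _ {eq_quot tens_equiv}).
rewrite -/(tpi _) sumE.
rewrite (big_morph g (lD g lg) (l0 g lg)) (big_morph h (lD h lh) (l0 h lh)).
by apply: eq_bigr => p _; exact: gh.
Qed.

End TensorProduct.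

Arguments tpure {K A B}.
Arguments tlift {K A B Z}.

Section LinearNotions.
Variable K : fieldType.

Definition fin_dim (W : lmodType K) (S : set W) : Prop :=
  exists (n : nat) (e : 'I_n -> W),
    forall x, S x -> exists c : 'I_n -> K, x = \sum_(i < n) c i *: e i.

Definition direct_sum_of (I : choiceType) (W : lmodType K) (S : I -> set W) :
    Prop :=
  forall w, exists! f : I -> W,
    [/\ forall i, S i (f i), finite_set [set i | f i != 0]
      & w = \sum_(i \in [set: I]) f i].

(* Only needed in characteristic 0. *)
Definition binz (m : int) (i : nat) : K :=
  (\prod_(k < i) (m%:~R - k%:R)) / (i`!)%:R.

End LinearNotions.

Section VertexAlgebras.
Variable K : fieldType.

(* [voa_Y v n] is the mode v_n, the coefficient of x^(-n-1) in Y(v,x). *)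
Record voa_data := VOAData {
  voa_car :> lmodType K;
  voa_Y : voa_car -> int -> voa_car -> voa_car;
  voa_vac : voa_car;
  voa_conf : voa_car }.

Record mod_data (V : voa_data) := ModData {
  mod_car :> lmodType K;
  mod_Y : V -> int -> mod_car -> mod_car }.

Definition adjoint (V : voa_data) : mod_data V := ModData (@voa_Y V).

(* The coefficient of x0^(-l-1) x1^(-m-1) x2^(-n-1) in the Jacobi identity.
   The sums have finite support as soon as the lower truncation property
   holds (a sum of infinite support would be 0 by convention). *)
Definition jacobi_identity (V : voa_data) (W : mod_data V) : Prop :=
  forall (u v : V) (w : W) (l m n : int),
    \sum_(i \in [set: nat])
       binz K m i *: mod_Y (voa_Y u (l + i%:Z) v) (m + n - i%:Z) w =
    \sum_(i \in [set: nat])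
       ((-1) ^+ i * binz K l i) *:
         (mod_Y u (m + l - i%:Z) (mod_Y v (n + i%:Z) w)
          - (-1) ^ l *: mod_Y v (n + l - i%:Z) (mod_Y u (m + i%:Z) w)).

Definition weak_module (V : voa_data) (W : mod_data V) : Prop :=
  [/\ forall n, is_bilinear (fun (v : V) (w : W) => mod_Y v n w),
      forall (v : V) (w : W), exists N : int, forall n, N <= n -> mod_Y v n w = 0,
      forall n (w : W), mod_Y (voa_vac V) n w = if n == -1 then w else 0
    & jacobi_identity W].

Definition Lop (V : voa_data) (W : mod_data V) (n : int) (w : W) : W :=
  mod_Y (voa_conf V) (n + 1) w.

Definition voa_wt (V : voa_data) (n : int) : set V :=
  [set v | Lop (W := adjoint V) 0 v = n%:~R *: v].

Definition is_vertex_algebra (V : voa_data) : Prop :=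
  weak_module (adjoint V) /\
  (forall v : V, voa_Y v (-1) (voa_vac V) = v /\
     forall n : int, 0 <= n -> voa_Y v n (voa_vac V) = 0).

Definition virasoro (V : voa_data) : Prop :=
  exists c : K, forall (m n : int) (v : V),
    let L := @Lop V (adjoint V) in
    L m (L n v) - L n (L m v) =
      (m - n)%:~R *: L (m + n) v
      + (if m + n == 0 then ((m ^+ 3 - m)%:~R / 12%:R * c) *: v else 0).

Definition is_voa (V : voa_data) : Prop :=
  [/\ is_vertex_algebra V,
      virasoro V,
      forall (v w : V) (n : int),
        voa_Y (Lop (W := adjoint V) (-1) v) n w = - (n%:~R *: voa_Y v (n - 1) w),
      direct_sum_of (@voa_wt V)
    & (forall n, fin_dim (@voa_wt V n)) /\
      exists N : int, forall n, n < N -> @voa_wt V n = [set 0]].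

Section Modules.
Variable V : voa_data.
Implicit Types L M N P S W Z : mod_data V.

Definition gen_wt W (h : K) : set W :=
  [set w | exists k : nat, iter k (fun x => Lop 0 x - h *: x) w = 0].

Definition generalized_module W : Prop :=
  weak_module W /\ direct_sum_of (@gen_wt W).

Definition grading_restricted W : Prop :=
  forall h : K, fin_dim (@gen_wt W h) /\
    exists N : int, forall n : int, n < N -> @gen_wt W (h + n%:~R) = [set 0].

Definition is_hom M N (f : M -> N) : Prop :=
  linear f /\ forall v n x, f (mod_Y v n x) = mod_Y v n (f x).

Definition surj M N (f : M -> N) : Prop := forall y, exists x, f x = y.

Definition is_surj_hom M N (f : M -> N) : Prop := is_hom f /\ surj f.

Definition is_inj_hom M N (f : M -> N) : Prop := is_hom f /\ injective f.

Definition is_iso M N (f : M -> N) : Prop := is_hom f /\ bijective f.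

Definition is_submodule W (S : set W) : Prop :=
  [/\ S 0, forall (a : K) x y, S x -> S y -> S (a *: x + y)
    & forall v n x, S x -> S (mod_Y v n x)].

Definition gen_submodule W (x : W) : set W :=
  [set y | forall S : set W, is_submodule S -> S x -> S y].

Definition simple_module W : Prop :=
  (exists x : W, x != 0) /\
  forall S : set W, is_submodule S -> S = [set 0] \/ S = [set: W].

Definition finite_length W : Prop :=
  exists (n : nat) (S : nat -> set W),
    [/\ S 0 = [set 0], S n = [set: W],
        forall i, (i <= n)%N -> is_submodule (S i)
      & forall i, (i < n)%N -> S i `<` S i.+1 /\
          forall T : set W, is_submodule T -> S i `<=` T -> T `<=` S i.+1 ->
            T = S i \/ T = S i.+1].

(* A full subcategory of the category of modules is given by its objects. *)
Definition mod_cat := mod_data V -> Prop.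

Implicit Type C : mod_cat.

Definition iso_closed C : Prop :=
  forall M N (f : M -> N), C M -> is_iso f -> C N.

Definition subquotient_closed C : Prop :=
  forall M S N (i : S -> M) (q : S -> N),
    C M -> is_inj_hom i -> is_surj_hom q -> C N.

Definition is_mono C M N (f : M -> N) : Prop :=
  is_hom f /\ forall L (g h : L -> M), C L -> is_hom g -> is_hom h ->
    f \o g = f \o h -> g = h.

Definition is_epi C M N (f : M -> N) : Prop :=
  is_hom f /\ forall L (g h : N -> L), C L -> is_hom g -> is_hom h ->
    g \o f = h \o f -> g = h.

Definition is_kernel C M N (f : M -> N) L (k : L -> M) : Prop :=
  [/\ C L, is_hom k, forall x, f (k x) = 0
    & forall L' (g : L' -> M), C L' -> is_hom g -> (forall x, f (g x) = 0) ->
        exists! h : L' -> L, is_hom h /\ k \o h = g].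

Definition is_cokernel C M N (f : M -> N) L (q : N -> L) : Prop :=
  [/\ C L, is_hom q, forall x, q (f x) = 0
    & forall L' (g : N -> L'), C L' -> is_hom g -> (forall x, g (f x) = 0) ->
        exists! h : L -> L', is_hom h /\ h \o q = g].

Definition has_zero_object C : Prop :=
  exists Z, C Z /\ forall M, C M ->
    (exists! f : Z -> M, is_hom f) /\ (exists! f : M -> Z, is_hom f).

Definition has_biproducts C : Prop :=
  forall M N, C M -> C N ->
    exists S (i1 : M -> S) (i2 : N -> S) (p1 : S -> M) (p2 : S -> N),
      [/\ C S, [/\ is_hom i1, is_hom i2, is_hom p1 & is_hom p2],
          (forall x, p1 (i1 x) = x) /\ (forall y, p2 (i2 y) = y),
          (forall y, p1 (i2 y) = 0) /\ (forall x, p2 (i1 x) = 0)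
        & forall z, i1 (p1 z) + i2 (p2 z) = z].

(* Preadditivity is inherited from the category of all modules. *)
Definition abelian_cat C : Prop :=
  [/\ has_zero_object C, has_biproducts C,
      forall M N (f : M -> N), C M -> C N -> is_hom f ->
        (exists L (k : L -> M), is_kernel C f k) /\
        (exists L (q : N -> L), is_cokernel C f q),
      forall M N (f : M -> N), C M -> C N -> is_mono C f ->
        exists L (g : N -> L), [/\ C L, is_hom g & is_kernel C g f]
    & forall M N (f : M -> N), C M -> C N -> is_epi C f ->
        exists L (g : L -> M), [/\ C L, is_hom g & is_cokernel C g f]].

(* In a subcategory closed under subquotients the subobjects of an object are
   its submodules, so that its length is its length as a module. *)
Definition locally_finite C : Prop :=
  (forall M N, C M -> C N ->
     fin_dim (W := M -> N) [set f | is_hom f]) /\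
  (forall M, C M -> finite_length M).

Definition projective_in C P : Prop :=
  C P /\ forall M N (g : M -> N) (f : P -> N),
    C M -> C N -> is_surj_hom g -> is_hom f ->
    exists2 f' : P -> M, is_hom f' & g \o f' = f.

Definition projective_cover C P W (p : P -> W) : Prop :=
  [/\ C W, projective_in C P, is_surj_hom p
    & forall P' (p' : P' -> W), projective_in C P' -> is_surj_hom p' ->
        exists2 f : P' -> P, is_surj_hom f & p \o f = p'].

Definition enough_projectives C : Prop :=
  forall W, C W -> exists P (p : P -> W), projective_in C P /\ is_surj_hom p.

Definition admissible_cat C : Prop :=
  [/\ forall W, C W -> generalized_module W /\ grading_restricted W,
      iso_closed C, subquotient_closed C, abelian_cat C & locally_finite C].

(* The submodule of [W] generated by [x] belongs to [C], up to isomorphism. *)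
Definition generated_in C W (x : W) : Prop :=
  exists N (i : N -> W), [/\ C N, is_inj_hom i & range i = gen_submodule x].

Definition finite_direct_sum (n : nat) (M : 'I_n -> mod_data V) W : Prop :=
  exists j : forall i, M i -> W,
    (forall i, is_hom (j i)) /\
    forall w, exists! x : (forall i, M i), w = \sum_(i < n) j i (x i).

End Modules.
End VertexAlgebras.

Section TensorVOA.
Variable K : fieldType.
Implicit Types U V : voa_data K.

(* (u (x) v)_n = \sum_(i + j = n - 1) u_i (x) v_j *)
Definition tens_mode U V (M : mod_data U) (W : mod_data V)
    (t : tens U V) (n : int) (x : tens M W) : tens M W :=
  tlift (fun (u : U) (v : V) =>
    tlift (fun (m : M) (w : W) =>
      \sum_(i \in [set: int]) tpure (mod_Y u i m) (mod_Y v (n - 1 - i) w)) x) t.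

Definition tens_voa U V : voa_data K :=
  VOAData (@tens_mode U V (adjoint U) (adjoint V))
    (tpure (voa_vac U) (voa_vac V))
    (tpure (voa_conf U) (voa_vac V) + tpure (voa_vac U) (voa_conf V)).

Definition tens_mod U V (M : mod_data U) (W : mod_data V) :
    mod_data (tens_voa U V) :=
  @ModData K (tens_voa U V) (tens M W) (@tens_mode U V M W).

Definition tens_map U V (M M' : mod_data U) (W W' : mod_data V)
    (f : M -> M') (g : W -> W') : tens_mod M W -> tens_mod M' W' :=
  tlift (fun m w => tpure (f m) (g w)).

Definition res_left U V (X : mod_data (tens_voa U V)) : mod_data U :=
  ModData (fun (u : U) n (x : X) => mod_Y (tpure u (voa_vac V) : tens_voa U V) n x).

Definition res_right U V (X : mod_data (tens_voa U V)) : mod_data V :=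
  ModData (fun (v : V) n (x : X) => mod_Y (tpure (voa_vac U) v : tens_voa U V) n x).

Definition Dcat U V (CU : mod_cat U) (CV : mod_cat V) : mod_cat (tens_voa U V) :=
  fun X =>
    [/\ generalized_module X, grading_restricted X, finite_length X,
        forall x : X, generated_in CU (W := res_left X) x
      & forall x : X, generated_in CV (W := res_right X) x].

End TensorVOA.

(* Main.v *)
(* The Jacobi identity is equivalent to locality together with associativity,
   both of which are multiplicative, so [M ⊗ W] is a weak module over [U ⊗ V].
   A homomorphism from [P ⊗ Q] to [X] is a [V]-homomorphism from [Q] to
   [Hom_U (P, X)].  Since [P] is finitely generated, evaluation at generators
   shows that [Hom_U (P, X)] is locally in the category of [V]-modules, and
   lifting first along [P] and then along [Q] makes [P ⊗ Q] projective.

   A projective cover of a simple module is local, by Fitting's lemma: all its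
   proper submodules lie in the kernel of the cover.  Schur's lemma shows that
   [M ⊗ W] is simple for simple [M] and [W], and then that [P_M ⊗ P_W] is local
   over [M ⊗ W]; so a lift to [P_M ⊗ P_W] of a surjection onto [M ⊗ W] is onto.

   If there are enough projectives, every object of [D] is covered by a finite
   sum of products [P ⊗ Q] with [P] and [Q] local and projective.  For a
   projective object a cover with the fewest terms is an isomorphism. *)

From HB Require Import structures.
From mathcomp Require Import all_boot all_order all_algebra.
From mathcomp Require Import boolp classical_sets functions cardinality fsbigop.
From mathcomp Require Import reals complex ring zify.
Require Import Defs.

Set Implicit Arguments.
Unset Strict Implicit.
Unset Printing Implicit Defensive.

Import Order.TTheory GRing.Theory Num.Theory.
Local Open Scope classical_set_scope.
Local Open Scope ring_scope.

(** * Finitely supported sums over the integers *)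

(** The Jacobi identity relates three series, so two such identities cannot simply be multiplied.
    Locality and associativity are equalities of two series after multiplication by a power of x1 -
    x2 or of x0 + x2: these multiply and the exponents add. The real work is to recover the identity
    for all exponents from these two. An object of D(U,V) is usually not in [CU] or [CV] after
    restriction: [M ⊗ W] is a sum of dim W copies of M over U. Only its cyclic submodules are.
    Lifting and covering are therefore done for modules that lie locally in the category, and finite
    generation of the projective, a consequence of finite length, brings each argument back into it.
    That [P ⊗ Q] lies in D(U,V) is a substantial claim. Its length is finite by dévissage to simple
    factors, where Schur's lemma needs an algebraically closed field. Its weight spaces are finite
    dimensional because the weights of each factor lie in finitely many sets c + ℕ, which again
    rests on finite generation. Sums of submodules are mostly handled by testing against every
    submodule that contains the given images. *)

Section FiniteSums.

(** The support is bounded by a list, not computed, so that bounds can be built with [map], [cat]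
    and [allpairs]. This hypothesis rules out the default value 0 that [fs] takes on an infinite
    support. *)
Definition fsupp (I : eqType) (W : zmodType) (f : I -> W) : Prop :=
  exists s : seq I, forall i, f i != 0 -> i \in s.

Definition fs (I : choiceType) (W : zmodType) (f : I -> W) : W :=
  \sum_(i \in [set: I]) f i.

Lemma fsE (I : choiceType) (W : zmodType) (f : I -> W) (s : seq I) :
  uniq s -> (forall i, f i != 0 -> i \in s) -> fs f = \sum_(i <- s) f i.
Proof.
move=> us fs0; rewrite /fs (fsbigE s) //.
  by under eq_bigl do rewrite in_setT.
by move=> i _ nis; apply: contraNeq nis; exact: fs0.
Qed.

Lemma eq_fs (I : choiceType) (W : zmodType) (f g : I -> W) :
  f =1 g -> fs f = fs g.
Proof. by move=> fg; congr fs; apply/funext. Qed.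

Lemma fs0 (I : choiceType) (W : zmodType) (f : I -> W) :
  (forall i, f i = 0) -> fs f = 0.
Proof.
move=> f0; rewrite (@fsE _ _ _ [::]) ?big_nil // => i.
by rewrite f0 eqxx.
Qed.

Lemma fs_single (I : choiceType) (W : zmodType) (f : I -> W) (a : I) :
  (forall i, i != a -> f i = 0) -> fs f = f a.
Proof.
move=> fa; rewrite (@fsE _ _ _ [:: a]) ?big_seq1 // => i; rewrite inE.
by apply: contraR => /fa ->.
Qed.

Lemma fsupp_uniq (I : eqType) (W : zmodType) (f : I -> W) : fsupp f ->
  exists2 s : seq I, uniq s & forall i, f i != 0 -> i \in s.
Proof.
move=> [s hs]; exists (undup s); first exact: undup_uniq.
by move=> i /hs; rewrite mem_undup.
Qed.

Lemma fs_additive (I : choiceType) (W Z : zmodType) (phi : W -> Z) (f : I -> W) :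
  phi 0 = 0 -> {morph phi : x y / x + y} -> fsupp f ->
  phi (fs f) = fs (fun i => phi (f i)).
Proof.
move=> p0 pD /fsupp_uniq[s us hs]; rewrite (fsE us hs) (fsE us).
  by rewrite (big_morph phi pD p0).
by move=> i hi; apply: hs; apply: contraNneq hi => ->; rewrite p0.
Qed.

Lemma fsuppS (I : eqType) (W Z : zmodType) (f : I -> W) (g : I -> Z) :
  fsupp f -> (forall i, f i = 0 -> g i = 0) -> fsupp g.
Proof.
move=> [s hs] fg; exists s => i gi; apply: hs; apply: contraNneq gi => /fg ->.
by rewrite eqxx.
Qed.

Lemma fsD (I : choiceType) (W : zmodType) (f g : I -> W) :
  fsupp f -> fsupp g -> fs (fun i => f i + g i) = fs f + fs g.
Proof.
move=> [s hs] [t ht].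
have u : uniq (undup (s ++ t)) by exact: undup_uniq.
rewrite !(fsE u) ?big_split // => i; rewrite mem_undup mem_cat.
- by move/ht->; rewrite orbT.
- by move/hs->.
apply: contraR; rewrite negb_or => /andP[hi hj].
by rewrite (contraNeq (hs i) hi) (contraNeq (ht i) hj) addr0.
Qed.

Lemma fsN (I : choiceType) (W : zmodType) (f : I -> W) :
  fsupp f -> fs (fun i => - f i) = - fs f.
Proof.
by move=> hf; rewrite (fs_additive (phi := -%R)) ?oppr0 //; exact: opprD.
Qed.

Lemma fsuppN (I : eqType) (W : zmodType) (f : I -> W) :
  fsupp f -> fsupp (fun i => - f i).
Proof. by move/fsuppS; apply => i ->; rewrite oppr0. Qed.

Lemma fsB (I : choiceType) (W : zmodType) (f g : I -> W) :
  fsupp f -> fsupp g -> fs (fun i => f i - g i) = fs f - fs g.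
Proof. by move=> hf hg; rewrite fsD ?fsN //; exact: fsuppN. Qed.

Lemma fsZ (K : fieldType) (I : choiceType) (W : lmodType K) (c : K) (f : I -> W) :
  fsupp f -> fs (fun i => c *: f i) = c *: fs f.
Proof.
move=> hf; rewrite (fs_additive (phi := fun x => c *: x)) ?scaler0 //.
by move=> x y; rewrite scalerDr.
Qed.

Lemma fs_reindex (I J : choiceType) (W : zmodType) (h : I -> J) (f : J -> W) :
  bijective h -> fs f = fs (fun i => f (h i)).
Proof. exact: (reindex_fsbigT h f). Qed.

Lemma fsupp_inj (I J : eqType) (W : zmodType) (g : J -> I) (h : I -> J)
  (f : J -> W) : cancel h g -> fsupp f -> fsupp (fun i => f (h i)).
Proof.
move=> hg [s hs]; exists [seq g j | j <- s] => i /hs.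
by move/(map_f g); rewrite hg.
Qed.

Lemma fs_pair (I J : choiceType) (W : zmodType) (f : I -> J -> W) :
  fsupp (fun x : I * J => f x.1 x.2) ->
  fs (fun x : I * J => f x.1 x.2) = fs (fun i => fs (f i)).
Proof.
move=> [s hs].
pose s1 := undup [seq x.1 | x <- s]; pose s2 := undup [seq x.2 | x <- s].
have u1 : uniq s1 by exact: undup_uniq.
have u2 : uniq s2 by exact: undup_uniq.
have h1 i j : f i j != 0 -> i \in s1 /\ j \in s2.
  move=> hij; have hx := hs (i, j) hij.
  by rewrite !mem_undup; split; [exact: (map_f fst hx)|exact: (map_f snd hx)].
have E i : fs (f i) = \sum_(j <- s2) f i j by apply: fsE => // j /h1[].
rewrite (@fsE _ _ (fun i => fs (f i)) s1) //; last first.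
  move=> i; rewrite E; apply: contraR => ni; rewrite big1 // => j _.
  by apply/eqP; apply: contraR ni => /h1[].
rewrite (@fsE _ _ _ [seq (i, j) | i <- s1, j <- s2]).
- by rewrite big_allpairs; apply: eq_bigr => i _; rewrite E.
- by apply: allpairs_uniq => // -[a b] [c d].
- by move=> [i j] /= /h1[hi hj]; apply: allpairs_f.
Qed.

Lemma fsupp_snd (I J : choiceType) (W : zmodType) (f : I -> J -> W) i :
  fsupp (fun x : I * J => f x.1 x.2) -> fsupp (f i).
Proof.
move=> [s hs]; exists [seq x.2 | x <- s] => j hij.
exact: (map_f snd (hs (i, j) hij)).
Qed.

Lemma fsupp_swap (I J : eqType) (W : zmodType) (f : I -> J -> W) :
  fsupp (fun x : I * J => f x.1 x.2) -> fsupp (fun x : J * I => f x.2 x.1).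
Proof.
move=> [s hs]; exists [seq (x.2, x.1) | x <- s] => -[j i] /= hij.
exact: (map_f (fun x => (x.2, x.1)) (hs (i, j) hij)).
Qed.

Lemma fs_exchange (I J : choiceType) (W : zmodType) (f : I -> J -> W) :
  fsupp (fun x : I * J => f x.1 x.2) ->
  fs (fun i => fs (f i)) = fs (fun j => fs (fun i => f i j)).
Proof.
move=> hf; rewrite -fs_pair // -(@fs_pair J I W (fun j i => f i j)); last first.
  exact: fsupp_swap.
by rewrite (@fs_reindex (J * I)%type _ _ (fun x => (x.2, x.1))) //;
   exists (fun x => (x.2, x.1)) => -[].
Qed.

Definition irange (a b : int) : seq int := [seq a + k%:Z | k <- iota 0 `|b - a|].

Lemma mem_irange a b i : a <= i -> i < b -> i \in irange a b.
Proof.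
move=> ai ib; apply/mapP; exists `|i - a|%N; last by lia.
by rewrite mem_iota; lia.
Qed.

Lemma fsupp_int (W : zmodType) (f : int -> W) a b :
  (forall i, i < a -> f i = 0) -> (forall i, b <= i -> f i = 0) -> fsupp f.
Proof.
move=> fa fb; exists (irange a b) => i fi; apply: mem_irange.
  by rewrite leNgt; apply: contraNN fi => /fa ->.
by rewrite ltNge; apply: contraNN fi => /fb ->.
Qed.

Lemma fsupp_nat (W : zmodType) (f : nat -> W) b :
  (forall i, (b <= i)%N -> f i = 0) -> fsupp f.
Proof.
move=> fb; exists (iota 0 b) => i fi; rewrite mem_iota /= add0n.
by rewrite ltnNge; apply: contraNN fi => /fb ->.
Qed.

(** Truncation bounds in one index depend on the value of the other, so the supports met below are
    not contained in a product of two ranges known in advance. *)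
Lemma fsupp_dep (I J : eqType) (W : zmodType) (f : I -> J -> W) (s : seq I) :
  (forall i j, f i j != 0 -> i \in s) -> (forall i, fsupp (f i)) ->
  fsupp (fun x : I * J => f x.1 x.2).
Proof.
move=> hs ht; have /choice[t {}ht] := ht.
exists [seq (i, j) | i <- s, j <- t i] => -[i j] /= hij.
by apply: allpairs_f_dep; [exact: hs hij|exact: ht].
Qed.

Lemma fs_nat (W : zmodType) (f : nat -> W) b :
  (forall i, (b <= i)%N -> f i = 0) -> fs f = \sum_(i < b) f i.
Proof.
move=> fb; rewrite (@fsE _ _ _ (iota 0 b)) ?iota_uniq //.
  by rewrite -(big_mkord xpredT f) /index_iota subn0.
move=> i fi; rewrite mem_iota /= add0n.
by rewrite ltnNge; apply: contraNN fi => /fb ->.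
Qed.

Lemma fs_natS (W : zmodType) (f : nat -> W) :
  fsupp f -> fs f = f 0%N + fs (fun i => f i.+1).
Proof.
move=> [s hs]; pose b := (\max_(i <- s) i).+1.
have fb i : (b <= i)%N -> f i = 0.
  move=> bi; apply/eqP; apply: contraTT bi => /hs si; rewrite -ltnNge ltnS.
  by rewrite (big_rem i) //= leq_maxl.
rewrite (@fs_nat _ _ b.+1); last by move=> i /ltnW /fb.
rewrite big_ord_recl (@fs_nat _ (fun i => f i.+1) b) // => i /leqW bi; exact: fb.
Qed.

(** Regrouping by total degree, which brings products of two binomial expansions into the form of
    Vandermonde's identity. *)
Lemma fs_diag (W : zmodType) (f : nat -> nat -> W) :
  fsupp (fun x : nat * nat => f x.1 x.2) ->
  fs (fun x : nat * nat => f x.1 x.2) =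
  fs (fun k => \sum_(i < k.+1) f i (k - i)%N).
Proof.
move=> hf.
pose g (k i : nat) := if (i <= k)%N then f i (k - i)%N else 0.
have gE k : \sum_(i < k.+1) f i (k - i)%N = fs (g k).
  rewrite (@fs_nat _ (g k) k.+1).
    by apply: eq_bigr => i _; rewrite /g -ltnS ltn_ord.
  by move=> i ki; rewrite /g leqNgt ki.
under [RHS]eq_fs do rewrite gE.
have hg : fsupp (fun x : nat * nat => g x.1 x.2).
  have [s hs] := hf; exists [seq ((x.1 + x.2)%N, x.1) | x <- s] => -[k i] /=.
  rewrite /g; case: ifP => [ik fi|_]; last by rewrite eqxx.
  have := map_f (fun x : nat * nat => ((x.1 + x.2)%N, x.1)) (hs (i, (k - i)%N) fi).
  by rewrite /= subnKC.
rewrite -fs_pair //.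
have [s us hs] := fsupp_uniq hf.
rewrite (fsE us hs) (@fsE _ _ _ [seq ((x.1 + x.2)%N, x.1) | x <- s]).
- by rewrite big_map; apply: eq_bigr => -[i j] _; rewrite /g /= leq_addr addKn.
- by rewrite map_inj_uniq // => -[a b] [c d] /= [e ac]; congr (_, _) => //; lia.
- move=> [k i] /=.
  rewrite /g; case: ifP => [ik fi|_]; last by rewrite eqxx.
  have := map_f (fun x : nat * nat => ((x.1 + x.2)%N, x.1)) (hs (i, (k - i)%N) fi).
  by rewrite /= subnKC.
Qed.

End FiniteSums.

(** * Binomial coefficients with integer upper argument *)

Section Binomials.
Variable K : numFieldType.
Local Notation B := (binz K).

Lemma binz0 x : B x 0 = 1.
Proof. by rewrite /binz big_ord0 divr1. Qed.

Lemma binzS x k : k.+1%:R * B x k.+1 = (x%:~R - k%:R) * B x k.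
Proof.
have fn0 n : (n`!)%:R != 0 :> K by rewrite pnatr_eq0 -lt0n fact_gt0.
rewrite /binz big_ord_recr /= factS natrM invfM.
by field; rewrite fn0 nat1r pnatr_eq0.
Qed.

(** Induction on [k] after multiplication by [k.+1]: in each term this factor splits as i + (k + 1 -
    i), and [binzS] absorbs the two parts into the two binomials. *)
Lemma vandermonde x y k :
  B (x + y) k = \sum_(i < k.+1) B x i * B y (k - i)%N.
Proof.
elim: k => [|k IH]; first by rewrite big_ord1 !binz0 mulr1.
have k0 : k.+1%:R != 0 :> K by rewrite pnatr_eq0.
apply: (mulfI k0); rewrite binzS IH !mulr_sumr.
have -> : \sum_(i < k.+2) k.+1%:R * (B x i * B y (k.+1 - i)%N) =
  \sum_(i < k.+2) (i%:R * B x i) * B y (k.+1 - i)%N +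
  \sum_(i < k.+2) B x i * ((k.+1 - i)%:R * B y (k.+1 - i)%N).
  rewrite -big_split; apply: eq_bigr => i _ /=.
  have ik : (i <= k.+1)%N by rewrite -ltnS.
  by rewrite (natrB K ik); ring.
rewrite [X in _ = X + _]big_ord_recl /= mulr0n !mul0r add0r.
rewrite [X in _ = _ + X]big_ord_recr /= subnn mulr0n !mul0r mulr0 addr0 -big_split.
apply: eq_bigr => i _ /=; have ik : (i <= k)%N by rewrite -ltnS.
rewrite /bump add1n subSS binzS (subSn ik) binzS.
by rewrite (natrB K ik) intrD; ring.
Qed.

Lemma binz0S k : B 0 k.+1 = 0.
Proof. by rewrite /binz big_ord_recl /= subrr !mul0r. Qed.

Lemma binz1S k : B 1 k.+2 = 0.
Proof. by rewrite /binz big_ord_recl big_ord_recl /= subrr mul0r mulr0 mul0r. Qed.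

Lemma binz11 : B 1 1 = 1.
Proof. by have := binzS 1 0; rewrite binz0 mul1r subr0 mulr1. Qed.

Lemma pascal x k : B (x + 1) k.+1 = B x k.+1 + B x k.
Proof.
rewrite vandermonde 2!big_ord_recr /= subnn binz0 mulr1 subSnn binz11 mulr1.
rewrite big1; first by rewrite add0r addrC.
move=> i _; have -> : (k.+1 - i = (k - i.+1).+2)%N by have := ltn_ord i; lia.
by rewrite binz1S mulr0.
Qed.

Lemma binzN1 i : B (-1) i = (-1) ^+ i.
Proof.
elim: i => [|i IH]; first by rewrite binz0.
have := pascal (-1) i; rewrite addNr binz0S IH => /eqP.
by rewrite eq_sym addr_eq0 exprS mulN1r => /eqP.
Qed.

(** Both sides equal (p+1)(p+2)...(p+i+1) / i!. *)
Lemma binz_absorb p i :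
  (p + 1)%:~R * B (p + i.+1%:Z) i = (p + i.+1%:Z)%:~R * B (p + i%:Z) i.
Proof.
elim: i p => [|i IH] p; first by rewrite !binz0 !mulr1.
have k0 : i.+1%:R != 0 :> K by rewrite pnatr_eq0.
apply: (mulfI k0); rewrite (mulrCA _ _ (B _ _)) [RHS](mulrCA _ _ (B _ _)) !binzS -![i%:R]/(i%:Z%:~R) -!intrB.
have -> : p + i.+2%:Z - i%:Z = p + 1 + 1 by lia.
have -> : p + i.+1%:Z - i%:Z = p + 1 by lia.
have := IH (p + 1).
have -> : p + 1 + i.+1%:Z = p + i.+2%:Z by lia.
have -> : p + 1 + i%:Z = p + i.+1%:Z by lia.
by move=> e; rewrite [RHS](mulrCA _ _ (B _ _)) -e.
Qed.

(** Upper negation. It makes Vandermonde's identity available for the coefficients of a substitution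
    x1 = x0 + x2, where the upper argument varies with the summation index. *)
Lemma binz_neg p i : B (- p - 1) i = (-1) ^+ i * B (p + i%:Z) i.
Proof.
elim: i => [|i IH]; first by rewrite !binz0 expr0 mulr1.
have k0 : i.+1%:R != 0 :> K by rewrite pnatr_eq0.
apply: (mulfI k0); rewrite binzS IH.
rewrite [RHS](mulrCA _ _ (B _ _)) binzS exprS -[i%:R]/(i%:Z%:~R) -!intrB.
have -> : p + i.+1%:Z - i%:Z = p + 1 by lia.
rewrite binz_absorb.
have -> : - p - 1 - i%:Z = - (p + i.+1%:Z) by lia.
by rewrite intrN; ring.
Qed.

End Binomials.

(** * Doubly indexed arrays and the Jacobi identity *)

Section Bilinear.
Variables (K : fieldType) (A B Z : lmodType K) (f : A -> B -> Z).
Hypothesis bf : is_bilinear f.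

Lemma bilinearP c a a' b b' :
  f (c *: a + a') b = c *: f a b + f a' b /\
  f a (c *: b + b') = c *: f a b + f a b'.
Proof. by case: bf => h1 h2; split; [exact: h1|exact: h2]. Qed.

Lemma bilDl a a' b : f (a + a') b = f a b + f a' b.
Proof. by have [h _] := bilinearP 1 a a' b b; rewrite !scale1r in h. Qed.
Lemma bilDr a b b' : f a (b + b') = f a b + f a b'.
Proof. by have [_ h] := bilinearP 1 a a b b'; rewrite !scale1r in h. Qed.
Lemma bil0l b : f 0 b = 0.
Proof. by apply: (addrI (f 0 b)); rewrite -bilDl !addr0. Qed.
Lemma bil0r a : f a 0 = 0.
Proof. by apply: (addrI (f a 0)); rewrite -bilDr !addr0. Qed.
Lemma bilZl c a b : f (c *: a) b = c *: f a b.
Proof. by have [h _] := bilinearP c a 0 b b; rewrite bil0l !addr0 in h. Qed.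
Lemma bilZr c a b : f a (c *: b) = c *: f a b.
Proof. by have [_ h] := bilinearP c a a b 0; rewrite bil0r !addr0 in h. Qed.
Lemma bil_fs (I J : choiceType) (g : I -> A) (h : J -> B) :
  fsupp g -> fsupp h ->
  f (fs g) (fs h) = fs (fun x : I * J => f (g x.1) (h x.2)).
Proof.
move=> hg hh; rewrite (fs_additive (phi := fun x => f x (fs h))) ?bil0l //; last first.
  by move=> x y; rewrite bilDl.
rewrite (@fs_pair _ _ _ (fun i j => f (g i) (h j))).
  apply: eq_fs => i; rewrite (fs_additive (phi := f (g i))) ?bil0r //.
  by move=> x y; rewrite bilDr.
have [s hs] := hg; apply: (@fsupp_dep I J Z (fun i j => f (g i) (h j)) s) => i.
  by move=> j fij; apply: hs; apply: contraNneq fij => ->; rewrite bil0l.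
by apply: fsuppS hh _ => j ->; rewrite bil0r.
Qed.

Lemma bil_sumr (I : Type) (s : seq I) a (h : I -> B) :
  f a (\sum_(i <- s) h i) = \sum_(i <- s) f a (h i).
Proof. by rewrite (big_morph (f a) (bilDr a) (bil0r a)). Qed.

Lemma bil_suml (I : Type) (s : seq I) (h : I -> A) b :
  f (\sum_(i <- s) h i) b = \sum_(i <- s) f (h i) b.
Proof.
by rewrite (big_morph (f^~ b) (fun x y => bilDl x y b) (bil0l b)).
Qed.

End Bilinear.

Section Arrays.
Variable K : numFieldType.
Local Notation C := (binz K).

(* An array [a p q] stands for the series
   [\sum a p q x1^(-p-1) x2^(-q-1)]. *)
Definition good (W : lmodType K) (a : int -> int -> W) : Prop :=
  (exists q0, forall p q, q0 <= q -> a p q = 0) /\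
  forall q, exists p0, forall p, p0 <= p -> a p q = 0.

(** One operator for two operations: with [phi] independent of its first argument it multiplies by a
    fixed power of a binomial, and with [phi] depending on it it substitutes x0 + x2 for x1. *)
Definition shift_op (W : lmodType K) (phi : int -> nat -> K) (a : int -> int -> W)
  (p q : int) : W := fs (fun i : nat => phi p i *: a (p - i%:Z) (q + i%:Z)).

Lemma seq_bound (T : eqType) (s : seq T) (g : T -> int) :
  exists b, forall x, x \in s -> g x <= b.
Proof.
elim: s => [|x s [b IH]]; first by exists 0.
exists (Num.max b (g x)) => y; rewrite inE => /orP[/eqP->|/IH h].
  by rewrite le_max lexx orbT.
by rewrite le_max h.
Qed.

Lemma good_shift_op (W : lmodType K) phi (a : int -> int -> W) :
  good a -> good (shift_op phi a).
Proof.
move=> [[q0 hq] /choice[pa hpa]]; split.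
  by exists q0 => p q h; apply: fs0 => i; rewrite hq ?scaler0 //; lia.
move=> q; have [p0 h] := seq_bound (iota 0 `|q0 - q|) (fun i => pa (q + i%:Z) + i%:Z).
exists p0 => p hp; apply: fs0 => i; have [hi|hi] := leP q0 (q + i%:Z).
  by rewrite hq ?scaler0.
by rewrite hpa ?scaler0 //; have := h i; rewrite mem_iota => /(_ ltac:(lia)); lia.
Qed.

Lemma good_fsupp (W : lmodType K) (a : int -> int -> W) p q (c : nat -> K) :
  good a -> fsupp (fun i : nat => c i *: a (p - i%:Z) (q + i%:Z)).
Proof.
move=> [[q0 hq] _]; apply: (@fsupp_nat _ _ `|q0 - q|) => i hi.
by rewrite hq ?scaler0 //; lia.
Qed.

(** The coefficients of the product of the two series under [f]. The shift by 1 comes from the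
    exponents: the indices i and j multiply to x^(-(i+j+1)-1). *)
Definition conv (A B Z : lmodType K) (f : A -> B -> Z) (a : int -> int -> A)
  (b : int -> int -> B) (p q : int) : Z :=
  fs (fun x : int * int => f (a x.1 x.2) (b (p - 1 - x.1) (q - 1 - x.2))).

Section Conv.
Variables (A B Z : lmodType K) (f : A -> B -> Z).
Hypothesis bf : is_bilinear f.
Variables (a : int -> int -> A) (b : int -> int -> B).
Hypotheses (ga : good a) (gb : good b).

(** Only the truncation in the second index is uniform; it confines [x2], [i] and [j] to finite
    ranges. The range of [x1] depends on these three, so the indices are reordered with [x1] last
    and [fsupp_dep] is applied. *)
Lemma conv_fsupp3 p q (c : int * int -> nat * nat -> K) :
  fsupp (fun x : (int * int) * (nat * nat) =>
    c x.1 x.2 *: f (a x.1.1 x.1.2)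
      (b (p - 1 - x.1.1 - x.2.1%:Z - x.2.2%:Z) (q - 1 - x.1.2 + x.2.1%:Z + x.2.2%:Z))).
Proof.
have [[qa hqa] /choice[pa hpa]] := ga; have [[qb hqb] /choice[pb hpb]] := gb.
pose N := `|(qb - q + 1 + qa)%R|%N.
pose F (y : int * (nat * nat)) (x1 : int) : Z :=
  c (x1, y.1) y.2 *: f (a x1 y.1)
   (b (p - 1 - x1 - y.2.1%:Z - y.2.2%:Z) (q - 1 - y.1 + y.2.1%:Z + y.2.2%:Z)).
have hF : fsupp (fun x : (int * (nat * nat)) * int => F x.1 x.2).
  apply: (fsupp_dep (s := [seq (x2, ij) | x2 <- irange (q - qb) qa,
                     ij <- [seq (i, j) | i <- iota 0 N, j <- iota 0 N]])).
    move=> [x2 [i j]] x1; rewrite /F /= => nz.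
    have h1 : x2 < qa.
      rewrite ltNge; apply: contraNN nz => h.
      by rewrite hqa // bil0l // scaler0.
    have h2 : q - 1 - x2 + i%:Z + j%:Z < qb.
      rewrite ltNge; apply: contraNN nz => h.
      by rewrite hqb // bil0r // scaler0.
    apply: allpairs_f; first by apply: mem_irange; lia.
    by apply: allpairs_f; rewrite mem_iota /N; lia.
  move=> [x2 [i j]]; rewrite /F /=.
  apply: (@fsupp_int _ _ (p - i%:Z - j%:Z - pb (q - 1 - x2 + i%:Z + j%:Z)) (pa x2)).
    by move=> x1 h; rewrite (hpb (q - 1 - x2 + i%:Z + j%:Z)) ?bil0r ?scaler0 //; lia.
  by move=> x1 h; rewrite (hpa x2) ?bil0l ?scaler0.
pose h (x : (int * int) * (nat * nat)) := ((x.1.2, x.2), x.1.1).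
pose h' (y : (int * (nat * nat)) * int) := ((y.2, y.1.1), y.1.2).
have hK : cancel h h' by move=> [[x1 x2] ij].
by apply: fsuppS (fsupp_inj hK hF) _ => -[[x1 x2] ij].
Qed.

Lemma conv_fsupp p q :
  fsupp (fun x : int * int => f (a x.1 x.2) (b (p - 1 - x.1) (q - 1 - x.2))).
Proof.
have h0 := conv_fsupp3 p q (fun _ _ => 1).
pose h (x : int * int) : (int * int) * (nat * nat) := (x, (0%N, 0%N)).
have hK : cancel h fst by [].
by apply: fsuppS (fsupp_inj hK h0) _ => -[x1 x2] /=;
  rewrite scale1r => <-; congr (f _ (b _ _)); lia.
Qed.

(* Multiplicativity of the substitutions and expansions encoded by [shift_op]; the
   hypothesis on the coefficients is an instance of Vandermonde's identity. *)
Lemma conv_shift_op (phi1 phi2 phi : int -> nat -> K) p q :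
  (forall x y k, \sum_(i < k.+1) phi1 (x + i%:Z) i * phi2 (y + (k - i)%N%:Z) (k - i)%N
     = phi (x + y + k%:Z + 1) k) ->
  conv f (shift_op phi1 a) (shift_op phi2 b) p q = shift_op phi (conv f a b) p q.
Proof.
move=> hphi.
pose F (x : int * int) (ij : nat * nat) : Z :=
  (phi1 (x.1 + ij.1%:Z) ij.1 * phi2 (p - 1 - x.1 - ij.1%:Z) ij.2) *:
  f (a x.1 x.2) (b (p - 1 - x.1 - ij.1%:Z - ij.2%:Z) (q - 1 - x.2 + ij.1%:Z + ij.2%:Z)).
have sF : fsupp (fun x => F x.1 x.2).
  exact: (conv_fsupp3 p q (fun x ij =>
   (phi1 (x.1 + ij.1%:Z) ij.1 * phi2 (p - 1 - x.1 - ij.1%:Z) ij.2))).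
(* This change of variables removes the shift from the argument of [a], so that the two shifts of
   the factors become one shift by i + j in the argument of [b]. *)
pose h (x : (int * int) * (nat * nat)) : (int * int) * (nat * nat) :=
  ((x.1.1 - x.2.1%:Z, x.1.2 + x.2.1%:Z), x.2).
pose h' (x : (int * int) * (nat * nat)) : (int * int) * (nat * nat) :=
  ((x.1.1 + x.2.1%:Z, x.1.2 - x.2.1%:Z), x.2).
have hK : cancel h h' by move=> [[x1 x2] [i j]]; rewrite /h /h' /= subrK addrK.
have h'K : cancel h' h by move=> [[x1 x2] [i j]]; rewrite /h /h' /= subrK addrK.
have -> : conv f (shift_op phi1 a) (shift_op phi2 b) p q = fs (fun x => F (h x).1 (h x).2).
  rewrite (@fs_pair _ _ _ (fun x ij => F (h (x, ij)).1 (h (x, ij)).2)); last first.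
    by apply: fsuppS (fsupp_inj hK sF) _ => -[x ij].
  apply: eq_fs => -[x1 x2]; rewrite /shift_op bil_fs //=;
    [|exact: (good_fsupp _ _ (phi1 x1) ga)|exact: (good_fsupp _ _ (phi2 _) gb)].
  apply: eq_fs => -[i j] /=; rewrite bilZl // bilZr // scalerA /F /h /=.
  by rewrite subrK; congr (_ * phi2 _ _ *: f _ (b _ _)); lia.
have bh : bijective h by exists h'.
apply: (etrans (esym (fs_reindex (fun x => F x.1 x.2) bh))).
rewrite (fs_pair sF).
have e x : fs (F x) = fs (fun k => \sum_(i < k.+1) F x (i : nat, (k - i)%N)).
  have h2 := @fs_diag _ (fun i j => F x (i, j)); apply: etrans (h2 _).
    by apply: eq_fs => -[].
  by apply: fsuppS (fsupp_snd x sF) _ => -[].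
under eq_fs do rewrite e.
rewrite fs_exchange; last first.
  have [s hs] := sF; exists [seq (x.1, (x.2.1 + x.2.2)%N) | x <- s] => -[x k] /= nz.
  have [i _ fi] : exists2 i : 'I_k.+1, true & F x (i : nat, (k - i)%N) != 0.
    apply: contrapT => no; move/negP: nz; apply; apply/eqP.
    rewrite big1 // => i _; apply/eqP/negPn/negP => fi; apply: no; exists i => //.
  have := map_f (fun x => (x.1, (x.2.1 + x.2.2)%N)) (hs (x, (i : nat, (k - i)%N)) fi).
  by rewrite /= subnKC // -ltnS.
apply: eq_fs => k; rewrite /conv -fsZ; last exact: conv_fsupp.
apply: eq_fs => -[x1 x2] /=.
rewrite (_ : phi p k = \sum_(i < k.+1) phi1 (x1 + i%:Z) i *
     phi2 (p - 1 - x1 - k%:Z + (k - i)%N%:Z) (k - i)%N); last first.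
  by rewrite hphi; congr phi; lia.
rewrite scaler_suml; apply: eq_bigr => i _; rewrite /F /=.
have ik : (i <= k)%N by rewrite -ltnS.
by congr (phi1 _ _ * phi2 _ _ *: f _ (b _ _)); lia.
Qed.

Lemma conv_shift m n p q :
  conv f (fun p => a (p + m)) (fun p => b (p + n)) p q = conv f a b (p + (m + n)) q.
Proof.
rewrite /conv (@fs_reindex _ _ _ (fun x : int * int => (x.1 - m, x.2))); last first.
  by exists (fun x : int * int => (x.1 + m, x.2)) => -[x1 x2] /=; rewrite ?subrK ?addrK.
by apply: eq_fs => -[x1 x2] /=; rewrite subrK; congr (f _ (b _ _)); lia.
Qed.

Lemma conv_swap p q :
  conv f a b p q = conv f (fun x y => a y x) (fun x y => b y x) q p.
Proof.
by rewrite /conv (@fs_reindex _ _ _ (fun x : int * int => (x.2, x.1))) //;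
  exists (fun x => (x.2, x.1)) => -[].
Qed.

Lemma conv_eq0 qa qb p q : (forall p q, qa <= q -> a p q = 0) ->
  (forall p q, qb <= q -> b p q = 0) -> qa + qb <= q -> conv f a b p q = 0.
Proof.
move=> ha hb hq; apply: fs0 => -[x1 x2] /=.
have [h|h] := leP qa x2; first by rewrite ha // bil0l.
by rewrite hb ?bil0r //; lia.
Qed.

Lemma good_conv : good (conv f a b).
Proof.
have [[qa hqa] /choice[pa hpa]] := ga; have [[qb hqb] /choice[pb hpb]] := gb.
split; first by exists (qa + qb) => p q; exact: conv_eq0.
move=> q; pose r := irange (q - qb) qa.
have [p0 hp0] := seq_bound r (fun x2 => pa x2 + pb (q - 1 - x2)).
exists p0 => p hp; apply: fs0 => -[x1 x2] /=.
have [h|h] := leP qa x2; first by rewrite hqa // bil0l.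
have [h'|h'] := leP qb (q - 1 - x2); first by rewrite hqb // bil0r.
have := hp0 x2 (mem_irange _ _) => /(_ ltac:(lia) ltac:(lia)) h2.
have [h3|h3] := leP (pa x2) x1; first by rewrite (hpa x2) // bil0l.
by rewrite (hpb (q - 1 - x2)) ?bil0r //; lia.
Qed.

End Conv.

(* [expand s k p q a] is the coefficient of [x1^(-p-1) x2^(-q-1)] in
   [(x1 + s x2)^k a(x1, x2)]. *)
Definition expand (W : lmodType K) (s : K) (k p q : int) (a : int -> int -> W) : W :=
  shift_op (fun _ i => s ^+ i * C k i) a (p + k) q.

(** Pascal's rule, that is, one factor x1 + s x2 split off: multiplication by x1 raises the index
    [p] by 1 and multiplication by x2 raises [q]. *)
Lemma expand_rec (W : lmodType K) s k p q (a : int -> int -> W) : good a ->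
  expand s (k + 1) p q a = expand s k (p + 1) q a + s *: expand s k p (q + 1) a.
Proof.
move=> ga; rewrite /expand /shift_op fs_natS; last exact: good_fsupp.
rewrite [X in _ = X + _]fs_natS; last exact: good_fsupp.
rewrite -[RHS]addrA -fsZ; last exact: good_fsupp.
rewrite -fsD.
- congr (_ + _).
    by rewrite !binz0; congr (_ *: a _ _); lia.
  apply: eq_fs => i; rewrite pascal mulrDr scalerDl scalerA.
  congr (_ *: a _ _ + _ *: a _ _); [lia| |lia|lia].
  by rewrite exprS -mulrA.
- have := @good_fsupp _ a (p + k) (q + 1) (fun i => s ^+ i.+1 * C k i.+1) ga.
  move/fsuppS; apply => i; move=> <-.
  by congr (_ *: a _ _); lia.
- have := @good_fsupp _ a (p + k) (q + 1) (fun i => s * (s ^+ i * C k i)) ga.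
  by move/fsuppS; apply => i <-; rewrite scalerA.
Qed.

Lemma expand_eq0 (W : lmodType K) s k p q (a : int -> int -> W) :
  (forall p q', q <= q' -> a p q' = 0) -> expand s k p q a = 0.
Proof. by move=> h; apply: fs0 => i; rewrite h ?scaler0 //; lia. Qed.

Lemma good_expand (W : lmodType K) s k (a : int -> int -> W) :
  good a -> good (fun p q => expand s k p q a).
Proof.
move=> /(good_shift_op (fun _ i => s ^+ i * C k i))[[q0 hq] hp].
split; first by exists q0 => p q; exact: hq.
by move=> q; have [p0 h] := hp q; exists (p0 - k) => p h'; apply: h; lia.
Qed.

Lemma conv_expand (A B Z : lmodType K) (f : A -> B -> Z) (bf : is_bilinear f) a b
  (ga : good a) (gb : good b) s k l p q :
  conv f (fun p q => expand s k p q a) (fun p q => expand s l p q b) p q =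
  expand s (k + l) p q (conv f a b).
Proof.
rewrite /expand (conv_shift f (shift_op (fun _ i => s ^+ i * C k i) a)
  (shift_op (fun _ i => s ^+ i * C l i) b)).
apply: conv_shift_op => // x y n; rewrite vandermonde mulr_sumr; apply: eq_bigr => i _.
have e : s ^+ n = s ^+ i * s ^+ (n - i) by rewrite -exprD subnKC // -ltnS.
by rewrite e; ring.
Qed.

(** With [m] fixed and [l], [n] as indices, [expand (-1) l m n a] is the coefficient of x0^(-l-1)
    x2^(-n-1) in (x0 + x2)^m a(x0 + x2, x2), because (-1)^i C(l, i) = C(i - l - 1, i). Substitution
    is multiplicative and the exponents [m] add. *)
Lemma conv_expand_subst (A B Z : lmodType K) (f : A -> B -> Z) (bf : is_bilinear f)
  a b (ga : good a) (gb : good b) m m' l n :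
  conv f (fun l n => expand (-1) l m n a) (fun l n => expand (-1) l m' n b) l n =
  expand (-1) l (m + m') n (conv f a b).
Proof.
pose phi l i : K := (-1) ^+ i * C l i.
have gs (W : lmodType K) (c : int -> int -> W) k : good c -> good (fun p => c (p + k)).
  move=> [[q0 h1] h2]; split; first by exists q0 => *; exact: h1.
  move=> q; have [p0 h] := h2 q; exists (p0 - k) => p hp; apply: h; lia.
have E (W : lmodType K) (c : int -> int -> W) k l' n' :
    expand (-1) l' k n' c = shift_op phi (fun p => c (p + k)) l' n'.
  by apply: eq_fs => i; congr (_ *: c _ _); lia.
transitivity (conv f (shift_op phi (fun p => a (p + m))) (shift_op phi (fun p => b (p + m'))) l n).
  by apply: eq_fs => x; rewrite !E.
rewrite (@conv_shift_op _ _ _ _ bf _ _ (gs _ _ _ ga) (gs _ _ _ gb) phi phi phi).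
  by rewrite E; apply: eq_fs => i; rewrite conv_shift.
move=> x y k; rewrite /phi.
have -> : C (x + y + k%:Z + 1) k = (-1) ^+ k * C (- (x + y + 1) - 1) k.
  by rewrite binz_neg signrMK; congr (C _ _); lia.
rewrite signrMK.
have -> : - (x + y + 1) - 1 = (- x - 1) + (- y - 1) by lia.
by rewrite vandermonde; apply: eq_bigr => i _; rewrite !binz_neg.
Qed.

(** The Jacobi identity for abstract arrays: [a] holds the products u v in the variables x1, x2, [b]
    the products v u with the variables exchanged, and [c] the iterates, with first index for x2 and
    second for x0. *)
Definition Jac (W : lmodType K) (a b c : int -> int -> W) : Prop :=
  forall l m n, expand 1 m n l c = expand (-1) l m n a - (-1) ^ l *: expand (-1) l n m b.

Lemma defect_rec (V : zmodType) (a1 a2 b1 b2 g1 g2 : V) :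
  a1 - b1 - (g1 + g2) = (a1 - a2 + (b2 - b1) - g2) + (a2 - b2 - g1).
Proof.
rewrite [RHS]addrACA [X in _ = X + _]addrACA subrK [b2 - b1 - b2]addrAC subrr add0r.
by rewrite -opprD [g2 + g1]addrC.
Qed.

Section JacConv.
Variables (A B Z : lmodType K) (f : A -> B -> Z).
Hypothesis bf : is_bilinear f.
Variables (a b c : int -> int -> A) (a' b' c' : int -> int -> B).
Hypotheses (ga : good a) (gb : good b) (gc : good c).
Hypotheses (ga' : good a') (gb' : good b') (gc' : good c').
Hypotheses (J : Jac a b c) (J' : Jac a' b' c').

(* The defect of the identity satisfies the recursion [x1 = x0 + x2], so it
   vanishes as soon as it vanishes for large [l] (locality) and for large [m]
   (associativity), where one of the three terms of the identity drops out. *)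
Lemma Jac_conv : Jac (conv f a a') (conv f b b') (conv f c c').
Proof.
have [[N hN] _] := gc; have [[N' hN'] _] := gc'.
have [[M hM] _] := gb; have [[M' hM'] _] := gb'.
have gA := good_conv bf ga ga'; have gB := good_conv bf gb gb'.
have gC := good_conv bf gc gc'.
pose D l m n := expand (-1) l m n (conv f a a') - (-1) ^ l *: expand (-1) l n m (conv f b b')
   - expand 1 m n l (conv f c c').
(* The relation x1 = x0 + x2 read in the three expansions; it holds for arbitrary arrays with the
   truncation property. *)
have Drec l m n : D l (m + 1) n = D (l + 1) m n + D l m (n + 1).
  rewrite /D [expand 1 (m + 1) n l _]expand_rec // ![expand (-1) (l + 1) _ _ _]expand_rec //.
  rewrite exprzDr ?unitrN1 // expr1z mulrN1 scale1r !scaleN1r scaleNr opprK.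
  rewrite scalerBr.
  exact: defect_rec.
have Dloc m n : D (N + N') m n = 0.
  rewrite /D [X in _ - X]expand_eq0; last first.
    by move=> p q; apply: conv_eq0.
  rewrite subr0; apply/eqP; rewrite subr_eq0; apply/eqP.
  rewrite -!conv_expand // (conv_swap f _ _ m n) exprzDr ?unitrN1 // -fsZ; last first.
    exact: conv_fsupp bf _ _ (good_expand _ _ gb) (good_expand _ _ gb') n m.
  apply: eq_fs => -[x1 x2] /=.
  have := J N x2 x1; rewrite expand_eq0; last by move=> p q; exact: hN.
  move=> /esym/eqP; rewrite subr_eq0 => /eqP ->.
  have := J' N' (m - 1 - x2) (n - 1 - x1); rewrite expand_eq0; last by move=> p q; exact: hN'.
  move=> /esym/eqP; rewrite subr_eq0 => /eqP ->.
  by rewrite bilZl // bilZr // scalerA.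
have Dass l n : D l (M + M') n = 0.
  rewrite /D [X in _ *: X]expand_eq0; last by move=> p q; apply: conv_eq0.
  rewrite scaler0 subr0; apply/eqP; rewrite subr_eq0; apply/eqP.
  rewrite -conv_expand // -conv_expand_subst // conv_swap.
  apply: eq_fs => -[x1 x2] /=.
  have := J x2 M x1; rewrite [X in _ *: X]expand_eq0; last by move=> p q; exact: hM.
  rewrite scaler0 subr0 => ->.
  have := J' (l - 1 - x2) M' (n - 1 - x1).
  rewrite [X in _ *: X]expand_eq0; last by move=> p q; exact: hM'.
  by rewrite scaler0 subr0 => ->.
(* Once the level [l + 1] vanishes, the recursion says that [D l m n] depends only on m + n, so [m]
   can be moved to the value M + M' at which associativity gives 0. Passing to larger [l] needs the
   recursion alone. *)
have step l : (forall m n, D (l + 1) m n = 0) -> forall m n, D l m n = 0.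
  move=> h.
  have s m n : D l (m + 1) n = D l m (n + 1) by rewrite Drec h add0r.
  have s' k m n : D l (m + k%:Z) n = D l m (n + k%:Z).
    elim: k n => [|k IH] n; first by rewrite !addr0.
    by rewrite (_ : m + k.+1%:Z = m + k%:Z + 1) ?s ?IH; [congr D|]; lia.
  move=> m n; have [h1|h1] := leP m (M + M').
    have := s' `|(M + M' - m)%R|%N m (n - (M + M' - m)).
    rewrite (_ : m + _ = M + M') ?Dass; last by lia.
    by move=> ->; congr D; lia.
  rewrite (_ : m = M + M' + `|(m - (M + M'))%R|%N%:Z); last by lia.
  by rewrite s' Dass.
have up k m n : D (N + N' + k%:Z) m n = 0.
  elim: k m n => [|k IH] m n; first by rewrite addr0.
  have := Drec (N + N' + k%:Z) m n; rewrite !IH addr0 => e.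
  by rewrite (_ : N + N' + k.+1%:Z = N + N' + k%:Z + 1); [exact/esym|lia].
have down k m n : D (N + N' - k%:Z) m n = 0.
  elim: k m n => [|k IH] m n; first by rewrite subr0.
  by apply: step => m' n'; rewrite (_ : _ + 1 = N + N' - k%:Z) ?IH //; lia.
move=> l m n; apply/esym/eqP; rewrite -subr_eq0; apply/eqP; rewrite -/(D l m n).
have [h|h] := leP (N + N') l.
  by rewrite (_ : l = N + N' + `|(l - (N + N'))%R|%N%:Z) ?up //; lia.
by rewrite (_ : l = N + N' - `|(l - (N + N'))%R|%N%:Z) ?down //; lia.
Qed.

End JacConv.
End Arrays.

(** * Tensor products of weak modules *)

Section TensorFacts.
Variable K : fieldType.
Variables A B : lmodType K.

Lemma linear0P (X Z : lmodType K) (f : X -> Z) : linear f -> f 0 = 0.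
Proof. by move=> h; have := h (-1) 0 0; rewrite addr0 scaler0 scaleN1r addNr. Qed.
Lemma linearDP (X Z : lmodType K) (f : X -> Z) : linear f -> {morph f : x y / x + y}.
Proof. by move=> h x y; have := h 1 x y; rewrite !scale1r. Qed.
Lemma linearZP (X Z : lmodType K) (f : X -> Z) : linear f -> forall c x, f (c *: x) = c *: f x.
Proof. by move=> h c x; have := h c x 0; rewrite !addr0 (linear0P h) addr0. Qed.
Lemma linearNP (X Z : lmodType K) (f : X -> Z) : linear f -> {morph f : x / - x}.
Proof. by move=> h x; rewrite -scaleN1r (linearZP h) scaleN1r. Qed.
Lemma linearBP (X Z : lmodType K) (f : X -> Z) : linear f -> {morph f : x y / x - y}.
Proof. by move=> h x y; rewrite (linearDP h) (linearNP h). Qed.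
Lemma linear_sumP (X Z : lmodType K) (f : X -> Z) (I : Type) (s : seq I) (P : pred I) g :
  linear f -> f (\sum_(i <- s | P i) g i) = \sum_(i <- s | P i) f (g i).
Proof. by move=> h; rewrite (big_morph f (linearDP h) (linear0P h)). Qed.
Lemma linear_fsP (X Z : lmodType K) (f : X -> Z) (I : choiceType) (g : I -> X) :
  linear f -> fsupp g -> f (fs g) = fs (fun i => f (g i)).
Proof. by move=> h; exact: fs_additive (linear0P h) (linearDP h). Qed.

Lemma linear_comp (X Y Z : lmodType K) (g : Y -> Z) (f : X -> Y) :
  linear g -> linear f -> linear (g \o f).
Proof. by move=> hg hf c x y /=; rewrite hf hg. Qed.

Lemma tens_sum (x : tens A B) : exists s : seq (A * B),
  x = \sum_(p <- s) tpure p.1 p.2.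
Proof.
exists (trepr x); apply: tens_ext => Z f bf.
rewrite [in RHS](linear_sumP _ _ _ (tlift_linear bf)).
by apply: eq_bigr => p _; rewrite tlift_tpure.
Qed.

Lemma tens_ind (P : tens A B -> Prop) :
  P 0 -> (forall x y, P x -> P y -> P (x + y)) -> (forall a b, P (tpure a b)) ->
  forall x, P x.
Proof.
move=> P0 PD Pp x; have [s ->] := tens_sum x.
elim: s => [|p s IH]; first by rewrite big_nil.
by rewrite big_cons; apply: PD.
Qed.

Lemma tpureDl (a a' : A) (b : B) : tpure (a + a') b = tpure a b + tpure a' b.
Proof. exact: (bilDl (@tpure_bilinear K A B)). Qed.
Lemma tpureDr (a : A) (b b' : B) : tpure a (b + b') = tpure a b + tpure a b'.
Proof. exact: (bilDr (@tpure_bilinear K A B)). Qed.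
Lemma tpureZl c (a : A) (b : B) : tpure (c *: a) b = c *: tpure a b.
Proof. exact: (bilZl (@tpure_bilinear K A B)). Qed.
Lemma tpureZr c (a : A) (b : B) : tpure a (c *: b) = c *: tpure a b.
Proof. exact: (bilZr (@tpure_bilinear K A B)). Qed.
Lemma tpure0l (b : B) : tpure (0 : A) b = 0.
Proof. exact: (bil0l (@tpure_bilinear K A B)). Qed.
Lemma tpure0r (a : A) : tpure a (0 : B) = 0.
Proof. exact: (bil0r (@tpure_bilinear K A B)). Qed.

End TensorFacts.

Section WeakModules.
Variable K : numFieldType.
Implicit Types U V : voa_data K.

(** The part of [weak_module] that makes sums over modes finite. It is isolated because it must be
    known for [U ⊗ V] and [M ⊗ W] before their Jacobi identity can be discussed. *)
Definition truncated V (W : mod_data V) : Prop :=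
  (forall n, is_bilinear (fun (v : V) (w : W) => mod_Y v n w)) /\
  (forall (v : V) (w : W), exists N : int, forall n, N <= n -> mod_Y v n w = 0).

Lemma weak_truncated V (W : mod_data V) : weak_module W -> truncated W.
Proof. by case. Qed.

Definition comp_modes V (W : mod_data V) (u v : V) (w : W) (p q : int) : W :=
  mod_Y u p (mod_Y v q w).
(** The inner mode is the second index because truncation there is uniform in the outer one, as
    [good] requires. *)
Definition iter_modes V (W : mod_data V) (u v : V) (w : W) (n l : int) : W :=
  mod_Y (voa_Y u l v) n w.

Lemma good_comp_modes V (W : mod_data V) (u v : V) (w : W) :
  truncated W -> good (comp_modes u v w).
Proof.
move=> [b t]; split.
  have [q0 h] := t v w; exists q0 => p q hq; rewrite /comp_modes h //.
  exact: (bil0r (b p)).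
by move=> q; exact: t.
Qed.

Lemma good_iter_modes V (W : mod_data V) (u v : V) (w : W) :
  truncated (adjoint V) -> truncated W -> good (iter_modes u v w).
Proof.
move=> [_ t'] [b t]; split.
  have [q0 h] := t' u v; exists q0 => p q hq; rewrite /iter_modes.
  by have /= -> := h q hq; exact: (bil0l (b p)).
by move=> q; exact: t.
Qed.

Lemma jacobiP V (W : mod_data V) : truncated W ->
  jacobi_identity W <->
  forall (u v : V) (w : W), Jac (comp_modes u v w) (comp_modes v u w) (iter_modes u v w).
Proof.
move=> tW.
have E (u v : V) (w : W) (l m n : int) :
   expand (-1) l m n (comp_modes u v w) - (-1) ^ l *: expand (-1) l n m (comp_modes v u w) =
   fs (fun i : nat => ((-1) ^+ i * binz K l i) *:
         (mod_Y u (m + l - i%:Z) (mod_Y v (n + i%:Z) w)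
          - (-1) ^ l *: mod_Y v (n + l - i%:Z) (mod_Y u (m + i%:Z) w))).
  rewrite /expand /shift_op -fsZ; last exact: (good_fsupp _ _ (fun i => (-1) ^+ i * binz K l i) (good_comp_modes v u w tW)).
  rewrite -fsB.
  - by apply: eq_fs => i; rewrite /comp_modes scalerBr !scalerA [X in _ = _ - X *: _]mulrC.
  - exact: (good_fsupp _ _ (fun i => (-1) ^+ i * binz K l i) (good_comp_modes u v w tW)).
  have := good_fsupp (n + l) m (fun i => (-1) ^ l * ((-1) ^+ i * binz K l i)) (good_comp_modes v u w tW).
  by move/fsuppS; apply => i <-; rewrite scalerA.
have E' (u v : V) (w : W) (l m n : int) : expand 1 m n l (iter_modes u v w) =
   fs (fun i : nat => binz K m i *: mod_Y (voa_Y u (l + i%:Z) v) (m + n - i%:Z) w).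
  by apply: eq_fs => i; rewrite expr1n mul1r /iter_modes [n + m]addrC.
split=> J u v w l m n; first by rewrite E E'; exact: J.
by have := J u v w l m n; rewrite E E'.
Qed.

Section TensorModule.
Variables (U V : voa_data K).

Definition tmode (M : mod_data U) (W : mod_data V) (u : U) (v : V) n (m : M) (w : W) :
  tens M W := fs (fun i : int => tpure (mod_Y u i m) (mod_Y v (n - 1 - i) w)).

Section TM.
Variables (M : mod_data U) (W : mod_data V).
Hypotheses (tM : truncated M) (tW : truncated W).

Lemma tmode_fsupp (u : U) (v : V) n (m : M) (w : W) :
  fsupp (fun i : int => tpure (mod_Y u i m) (mod_Y v (n - 1 - i) w)).
Proof.
have [_ /(_ u m)[a ha]] := tM; have [_ /(_ v w)[b hb]] := tW.
apply: (@fsupp_int _ _ (n - b) a) => i hi.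
  by rewrite [X in tpure _ X]hb ?tpure0r //; lia.
by rewrite ha ?tpure0l.
Qed.

Lemma tmode_bil n (u : U) (v : V) : is_bilinear (@tmode M W u v n).
Proof.
have [bM _] := tM; have [bW _] := tW.
split=> [w c m m'|m c w w'] /=; rewrite /tmode -fsZ -?fsD; try exact: tmode_fsupp.
- by apply: eq_fs => i; rewrite (bilDr (bM _)) (bilZr (bM _)) tpureDl tpureZl.
- by apply: fsuppS (tmode_fsupp u v n m w) _ => i ->; rewrite scaler0.
- by apply: eq_fs => i; rewrite (bilDr (bW _)) (bilZr (bW _)) tpureDr tpureZr.
- by apply: fsuppS (tmode_fsupp u v n m w) _ => i ->; rewrite scaler0.
Qed.

Lemma tmode_bil2 n x : is_bilinear (fun u v => tlift (@tmode M W u v n) x).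
Proof.
have [bM _] := tM; have [bW _] := tW.
split=> [v c u u'|u c v v'] /=.
(* The identity is stated between functions of [x], so that uniqueness of linear lifts reduces it to
   pure tensors. *)
- apply: (congr1 (fun g => g x) (_ : _ = fun x => c *: tlift (@tmode M W u v n) x + tlift (@tmode M W u' v n) x)).
  apply: tlift_unique; first exact: tlift_linear (tmode_bil _ _ _).
    move=> d y z; rewrite !(tlift_linear (tmode_bil _ _ _)) !scalerDr !scalerA mulrC.
    by rewrite addrACA.
  move=> m w; rewrite !tlift_tpure; try exact: tmode_bil.
  rewrite /tmode -fsZ -?fsD; try exact: tmode_fsupp.
    by apply: eq_fs => i; rewrite (bilDl (bM _)) (bilZl (bM _)) tpureDl tpureZl.
  by apply: fsuppS (tmode_fsupp u v n m w) _ => i ->; rewrite scaler0.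
- apply: (congr1 (fun g => g x) (_ : _ = fun x => c *: tlift (@tmode M W u v n) x + tlift (@tmode M W u v' n) x)).
  apply: tlift_unique; first exact: tlift_linear (tmode_bil _ _ _).
    move=> d y z; rewrite !(tlift_linear (tmode_bil _ _ _)) !scalerDr !scalerA mulrC.
    by rewrite addrACA.
  move=> m w; rewrite !tlift_tpure; try exact: tmode_bil.
  rewrite /tmode -fsZ -?fsD; try exact: tmode_fsupp.
    by apply: eq_fs => i; rewrite (bilDl (bW _)) (bilZl (bW _)) tpureDr tpureZr.
  by apply: fsuppS (tmode_fsupp u v n m w) _ => i ->; rewrite scaler0.
Qed.

Lemma tens_modeE (u : U) (v : V) n (m : M) (w : W) :
  tens_mode (tpure u v) n (tpure m w) =
  fs (fun i : int => tpure (mod_Y u i m) (mod_Y v (n - 1 - i) w)).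
Proof.
rewrite /tens_mode tlift_tpure; last exact: tmode_bil2.
by rewrite tlift_tpure //; exact: tmode_bil.
Qed.

Lemma tens_mode_bil n :
  is_bilinear (fun (t : tens_voa U V) (x : tens_mod M W) => mod_Y t n x).
Proof.
have lt x : linear (fun t => tens_mode t n x : tens M W).
  by rewrite /tens_mode; exact: tlift_linear (tmode_bil2 _ _).
split=> [x c t t'|t c x x'] /=; first exact: lt.
elim/tens_ind: t => [|t t' IH IH'|u v].
- by rewrite !(linear0P (lt _)) scaler0 addr0.
- by rewrite !(linearDP (lt _)) IH IH' scalerDr addrACA.
rewrite /tens_mode !tlift_tpure; try exact: tmode_bil2.
exact: tlift_linear (tmode_bil _ _ _) _ _ _.
Qed.

Lemma tens_truncated : truncated (tens_mod M W).
Proof.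
have b := tens_mode_bil; split; first exact: b.
move=> t x; elim/tens_ind: t => [|t t' [N h] [N' h']|u v].
- by exists 0 => n _; exact: (bil0l (b n)).
- exists (Num.max N N') => n; rewrite ge_max => /andP[h1 h2].
  by rewrite (bilDl (b n)) h // h' // addr0.
elim/tens_ind: x => [|x x' [N h] [N' h']|m w].
- by exists 0 => n _; exact: (bil0r (b n)).
- exists (Num.max N N') => n; rewrite ge_max => /andP[h1 h2].
  by rewrite (bilDr (b n)) h // h' // addr0.
have [_ /(_ u m)[p hp]] := tM; have [_ /(_ v w)[q hq]] := tW.
exists (p + q) => n hn /=; rewrite tens_modeE; apply: fs0 => i.
have [h|h] := leP p i; first by rewrite hp // tpure0l.
by rewrite [X in tpure _ X]hq ?tpure0r //; lia.
Qed.

Lemma tens_mode_fs (I : choiceType) (u : U) (v : V) n (g : I -> M) (h : I -> W) :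
  fsupp (fun i => tpure (g i) (h i)) ->
  tens_mode (tpure u v) n (fs (fun i => tpure (g i) (h i))) =
  fs (fun i => tens_mode (tpure u v) n (tpure (g i) (h i))).
Proof.
move=> hf; have b := tens_mode_bil n.
have lx : linear (fun x : tens M W => tens_mode (tpure u v) n x).
  by move=> c x y; have /= := (bilinearP b c (tpure u v) (tpure u v) x y).2.
exact: (linear_fsP lx hf).
Qed.

End TM.

(** Additivity lets the Jacobi identity on a tensor product be checked on pure tensors in each of
    its three arguments. *)
Lemma JacD (A : lmodType K) (a b c a' b' c' : int -> int -> A) :
  good a -> good b -> good c -> good a' -> good b' -> good c' ->
  Jac a b c -> Jac a' b' c' ->
  Jac (fun p q => a p q + a' p q) (fun p q => b p q + b' p q)
      (fun p q => c p q + c' p q).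
Proof.
move=> ga gb gc ga' gb' gc' J J' l m n.
have E s k p q (x y : int -> int -> A) : good x -> good y ->
    expand s k p q (fun p q => x p q + y p q) = expand s k p q x + expand s k p q y.
  move=> gx gy; rewrite /expand /shift_op -fsD.
  - by apply: eq_fs => i; rewrite scalerDr.
  - exact: (good_fsupp _ _ (fun i => s ^+ i * binz K k i) gx).
  - exact: (good_fsupp _ _ (fun i => s ^+ i * binz K k i) gy).
by rewrite !E // J J' scalerDr opprD addrACA.
Qed.

Lemma Jac0 (A : lmodType K) (a b c : int -> int -> A) :
  (forall p q, a p q = 0) -> (forall p q, b p q = 0) -> (forall p q, c p q = 0) ->
  Jac a b c.
Proof.
by move=> ha hb hc l m n; rewrite !expand_eq0 ?scaler0 ?subr0.
Qed.

Lemma eq_Jac (A : lmodType K) (a b c a' b' c' : int -> int -> A) :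
  (forall p q, a p q = a' p q) -> (forall p q, b p q = b' p q) ->
  (forall p q, c p q = c' p q) -> Jac a b c -> Jac a' b' c'.
Proof.
move=> ha hb hc J l m n; have := J l m n; congr (expand _ _ _ _ _ = expand _ _ _ _ _ - _ *: expand _ _ _ _ _);
 by apply/funext => p; apply/funext => q.
Qed.

Hypotheses (hU : is_vertex_algebra U) (hV : is_vertex_algebra V).

Let wU : weak_module (adjoint U). Proof. by case: hU. Qed.
Let wV : weak_module (adjoint V). Proof. by case: hV. Qed.

Lemma tens_voa_truncated : truncated (adjoint (tens_voa U V)).
Proof.
exact: (@tens_truncated (adjoint U) (adjoint V) (weak_truncated wU) (weak_truncated wV)).
Qed.

Theorem tens_weak (M : mod_data U) (W : mod_data V) :
  weak_module M -> weak_module W -> weak_module (tens_mod M W).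
Proof.
move=> wM wW; have tM := weak_truncated wM; have tW := weak_truncated wW.
have tX := tens_truncated tM tW; have [bX trX] := tX.
have tA := tens_voa_truncated; have [bA trA] := tA.
split => //.
  move=> n x; elim/tens_ind: x => [|x y IH IH'|m w].
  - by rewrite (bil0r (bX n)) if_same.
  - by rewrite (bilDr (bX n)) IH IH'; case: ifP; rewrite ?addr0.
  rewrite /= tens_modeE //.
  have [_ _ vM _] := wM; have [_ _ vW _] := wW.
  (* The vacuum of [U] acts only through its mode -1, which leaves the mode n - 1 - (-1) = n of the
     vacuum of [V]. *)
  rewrite (@fs_single _ _ _ (-1)).
    by rewrite vM eqxx vW (_ : (n - 1 - -1 == -1) = (n == -1)); [case: ifP; rewrite ?tpure0r|lia].
  by move=> i /negbTE hi; rewrite vM hi tpure0l.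
apply/jacobiP => // t1 t2 x.
have gA t t' y := @good_comp_modes _ (tens_mod M W) t t' y tX.
have gI t t' y := @good_iter_modes _ (tens_mod M W) t t' y tA tX.
have e0l n (y : tens_mod M W) : mod_Y (0 : tens_voa U V) n y = 0.
  exact: (bil0l (bX n)).
have e0r n (t : tens_voa U V) : mod_Y t n (0 : tens_mod M W) = 0.
  exact: (bil0r (bX n)).
have f0l n (t : tens_voa U V) : voa_Y (0 : tens_voa U V) n t = 0.
  exact: (bil0l (bA n)).
have f0r n (t : tens_voa U V) : voa_Y t n (0 : tens_voa U V) = 0.
  exact: (bil0r (bA n)).
have eDl n (t t' : tens_voa U V) (y : tens_mod M W) : mod_Y (t + t') n y = mod_Y t n y + mod_Y t' n y.
  exact: (bilDl (bX n)).
have eDr n (t : tens_voa U V) (y y' : tens_mod M W) : mod_Y t n (y + y') = mod_Y t n y + mod_Y t n y'.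
  exact: (bilDr (bX n)).
have fDl n (t t' s : tens_voa U V) : voa_Y (t + t') n s = voa_Y t n s + voa_Y t' n s.
  exact: (bilDl (bA n)).
have fDr n (t s s' : tens_voa U V) : voa_Y t n (s + s') = voa_Y t n s + voa_Y t n s'.
  exact: (bilDr (bA n)).
elim/tens_ind: t1 => [|t1 t1' IH IH'|u1 v1].
- by apply: Jac0 => p q; rewrite /comp_modes /iter_modes ?f0l ?e0l ?e0r.
- apply: eq_Jac (JacD _ _ _ _ _ _ IH IH') => // p q; rewrite /comp_modes /iter_modes.
  + by rewrite eDl.
  + by rewrite eDl eDr.
  + by rewrite fDl eDl.
elim/tens_ind: t2 => [|t2 t2' IH IH'|u2 v2].
- by apply: Jac0 => p q; rewrite /comp_modes /iter_modes ?f0r ?e0l ?e0r.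
- apply: eq_Jac (JacD _ _ _ _ _ _ IH IH') => // p q; rewrite /comp_modes /iter_modes.
  + by rewrite eDl eDr.
  + by rewrite eDl.
  + by rewrite fDr eDl.
elim/tens_ind: x => [|x x' IH IH'|m w].
- by apply: Jac0 => p q; rewrite /comp_modes /iter_modes ?e0r.
- apply: eq_Jac (JacD _ _ _ _ _ _ IH IH') => // p q; rewrite /comp_modes /iter_modes.
  + by rewrite !eDr.
  + by rewrite !eDr.
  + by rewrite eDr.
have bt := @tpure_bilinear K M W.
have JM : forall u v w, Jac _ _ _ := (jacobiP tM).1 (let: And4 _ _ _ j := wM in j).
have JW : forall u v w, Jac _ _ _ := (jacobiP tW).1 (let: And4 _ _ _ j := wW in j).
have gMi u v y := @good_iter_modes _ M u v y (weak_truncated wU) tM.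
have gWi u v y := @good_iter_modes _ W u v y (weak_truncated wV) tW.
have gMa u v y := @good_comp_modes _ M u v y tM.
have gWa u v y := @good_comp_modes _ W u v y tW.
(* On pure tensors the array of composites is the convolution of the two arrays of composites; only
   the order of summation differs. The iterates are treated in the same way below, and [Jac_conv]
   applies. *)
have E ua va ub vb p q : conv tpure (comp_modes ua ub m) (comp_modes va vb w) p q =
   comp_modes (tpure ua va : tens_voa U V) (tpure ub vb) (tpure m w : tens_mod M W) p q.
  rewrite /comp_modes /= [in RHS]tens_modeE // tens_mode_fs //; last exact: tmode_fsupp.
  under [RHS]eq_fs do rewrite tens_modeE //.
  have s := conv_fsupp bt (gMa ua ub m) (gWa va vb w) p q.
  rewrite /conv (fs_pair (f := fun i j => tpure (comp_modes ua ub m i j) (comp_modes va vb w (p - 1 - i) (q - 1 - j)))) //.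
  by rewrite fs_exchange.
apply: eq_Jac (Jac_conv bt (gMa u1 u2 m) (gMa u2 u1 m) (gMi u1 u2 m)
   (gWa v1 v2 w) (gWa v2 v1 w) (gWi v1 v2 w) (JM u1 u2 m) (JW v1 v2 w)).
- exact: E.
- by move=> p q; exact: E.
- move=> n l; rewrite /iter_modes /=.
  have sf := @tmode_fsupp (adjoint U) (adjoint V) (weak_truncated wU) (weak_truncated wV) u1 v1 l u2 v2.
  rewrite (@tens_modeE (adjoint U) (adjoint V)) //; try exact: weak_truncated.
  have lt : linear (fun t => tens_mode t n (tpure m w) : tens M W).
    by move=> c t t'; exact: (bilinearP (bX n) c t t' (tpure m w) (tpure m w)).1.
  rewrite [RHS](linear_fsP lt sf).
  under [RHS]eq_fs do rewrite tens_modeE //.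
  have s := conv_fsupp bt (gMi u1 u2 m) (gWi v1 v2 w) n l.
  rewrite /conv (fs_pair (f := fun i j => tpure (iter_modes u1 u2 m i j) (iter_modes v1 v2 w (n - 1 - i) (l - 1 - j)))) //.
  by rewrite fs_exchange.
Qed.

End TensorModule.
End WeakModules.

Lemma fs_inj (I J : choiceType) (W : zmodType) (h : I -> J) (f : J -> W) :
  injective h -> fsupp (fun i => f (h i)) ->
  (forall j, f j != 0 -> exists i, j = h i) -> fs f = fs (fun i => f (h i)).
Proof.
move=> hi /fsupp_uniq[s us hs] hf; rewrite (fsE us hs) (@fsE _ _ _ (map h s)).
- by rewrite big_map.
- by rewrite map_inj_uniq.
by move=> j fj; have [i e] := hf j fj; rewrite e map_f // hs // -e.
Qed.

(** The two halves match the two sums over i >= 0 in a normally ordered product. *)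
Lemma fs_int (W : zmodType) (f : int -> W) : fsupp f ->
  fs f = fs (fun i : nat => f (- 1 - i%:Z)) + fs (fun i : nat => f i%:Z).
Proof.
move=> hf.
have h1 : injective (fun i : nat => - 1 - i%:Z) by move=> i j; lia.
have h2 : injective (fun i : nat => i%:Z) by move=> i j; lia.
have s1 : fsupp (fun i : nat => f (- 1 - i%:Z)).
  by apply: (@fsupp_inj _ _ _ (fun z : int => `|(- 1 - z)%R|%N)) hf => i; lia.
have s2 : fsupp (fun i : nat => f i%:Z).
  by apply: (@fsupp_inj _ _ _ (fun z : int => `|z|%N)) hf => i; lia.
pose g1 z := if z < 0 then f z else 0; pose g2 z := if z < 0 then 0 else f z.
have -> : fs f = fs (fun z => g1 z + g2 z).
  by apply: eq_fs => z; rewrite /g1 /g2; case: ifP; rewrite ?addr0 ?add0r.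
have e1 i : g1 (- 1 - i%:Z) = f (- 1 - i%:Z).
  by rewrite /g1 ifT //; lia.
have e2 i : g2 i%:Z = f i%:Z by [].
rewrite fsD; last 2 first.
- by apply: fsuppS hf _ => z; rewrite /g1 => ->; rewrite if_same.
- by apply: fsuppS hf _ => z; rewrite /g2 => ->; rewrite if_same.
congr (_ + _).
  rewrite (fs_inj h1); first exact: eq_fs.
    by apply: fsuppS s1 _ => i; rewrite e1.
  move=> z; rewrite /g1; case: ifP; rewrite ?eqxx // => hz _.
  by exists `|(- 1 - z)%R|%N; lia.
rewrite (fs_inj h2); first exact: eq_fs.
  by apply: fsuppS s2 _ => i; rewrite e2.
move=> z; rewrite /g2; case: ifP; rewrite ?eqxx // => hz _.
by exists `|z|%N; lia.
Qed.

(** * The action of the tensor product through two commuting actions *)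

Section TensorAction.
Variable K : numFieldType.
Variables U V : voa_data K.
Hypotheses (hU : is_vertex_algebra U) (hV : is_vertex_algebra V).


Lemma tens_mode_left (M : mod_data U) (W : mod_data V) (u : U) n (m : M) (w : W) :
  weak_module M -> weak_module W ->
  tens_mode (tpure u (voa_vac V)) n (tpure m w) = tpure (mod_Y u n m) w.
Proof.
move=> wM wW; rewrite tens_modeE; try exact: weak_truncated.
have [_ _ vW _] := wW; rewrite (@fs_single _ _ _ n).
  by rewrite vW ifT //; lia.
by move=> i /negbTE hi; rewrite vW ifF ?tpure0r //; lia.
Qed.

Lemma tens_mode_right (M : mod_data U) (W : mod_data V) (v : V) n (m : M) (w : W) :
  weak_module M -> weak_module W ->
  tens_mode (tpure (voa_vac U) v) n (tpure m w) = tpure m (mod_Y v n w).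
Proof.
move=> wM wW; rewrite tens_modeE; try exact: weak_truncated.
have [_ _ vM _] := wM; rewrite (@fs_single _ _ _ (- 1)).
  by rewrite vM eqxx; congr (tpure _ (mod_Y _ _ _)); lia.
by move=> i /negbTE hi; rewrite vM hi tpure0l.
Qed.

Section OnModule.
Variables (X : mod_data (tens_voa U V)).
Hypothesis wX : weak_module X.

Local Notation lmode u n x := (mod_Y (m := X) (tpure u (voa_vac V) : tens_voa U V) n x).
Local Notation rmode v n x := (mod_Y (m := X) (tpure (voa_vac U) v : tens_voa U V) n x).

Let bX n := (weak_truncated wX).1 n.

Lemma modeX0 (t : tens_voa U V) n : mod_Y t n (0 : X) = 0.
Proof. exact: (bil0r (bX n)). Qed.
Lemma mode0X n (x : X) : mod_Y (0 : tens_voa U V) n x = 0.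
Proof. exact: (bil0l (bX n)). Qed.

Lemma left_right_prod (u : U) (v : V) l :
  voa_Y (tpure u (voa_vac V) : tens_voa U V) l (tpure (voa_vac U) v) =
  tpure (voa_Y u l (voa_vac U)) v.
Proof. by rewrite /= (@tens_mode_left (adjoint U) (adjoint V)) //; [case: hU|case: hV]. Qed.

(** Commutator formula, the Jacobi identity at l = 0: its left side contains only products (u ⊗ 1)_i
    (1 ⊗ v) = u_i 1 ⊗ v with i >= 0, and these vanish. *)
Lemma lr_comm (u : U) (v : V) m n (x : X) : lmode u m (rmode v n x) = rmode v n (lmode u m x).
Proof.
have [_ _ _ J] := wX.
have := J (tpure u (voa_vac V)) (tpure (voa_vac U) v) x 0 m n.
rewrite -/(fs _) -/(fs _) fs0; last first.
  move=> i; rewrite left_right_prod add0r.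
  by have [_ /(_ u)[_ ->]] := hU; rewrite ?tpure0l ?mode0X ?scaler0.
rewrite (@fs_single _ _ _ 0%N); last first.
  by move=> [//|i] _; rewrite binz0S mulr0 scale0r.
rewrite -[0%N%:Z]/(0 : int) binz0 expr0 mulr1 scale1r expr0z scale1r.
by rewrite !(addr0, subr0) => /esym/eqP; rewrite subr_eq0 => /eqP.
Qed.

Lemma lr_fsupp (u : U) (v : V) n (x : X) :
  fsupp (fun i => lmode u i (rmode v (n - 1 - i) x)).
Proof.
have [_ tX _ _] := wX.
have [a ha] := tX (tpure u (voa_vac V)) x; have [b hb] := tX (tpure (voa_vac U) v) x.
apply: (@fsupp_int _ _ (n - b) a) => i hi.
  by rewrite hb ?modeX0 //; lia.
by rewrite lr_comm ha ?modeX0.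
Qed.

(** The Jacobi identity at (l, m) = (-1, 0), since (u ⊗ 1)_{-1} (1 ⊗ v) = u ⊗ v. The right side is a
    normally ordered product, and commutation merges its two halves into a single sum over all
    integers. *)
Lemma lr_mode (u : U) (v : V) n (x : X) :
  mod_Y (tpure u v : tens_voa U V) n x =
  fs (fun i => lmode u i (rmode v (n - 1 - i) x)).
Proof.
have [_ _ _ J] := wX.
have := J (tpure u (voa_vac V)) (tpure (voa_vac U) v) x (-1) 0 n.
rewrite -/(fs _) -/(fs _) (@fs_single _ _ _ 0%N); last first.
  by move=> [//|i] _; rewrite binz0S scale0r.
rewrite -[0%N%:Z]/(0 : int) binz0 scale1r left_right_prod addr0.
have [_ /(_ u)[-> _]] := hU; rewrite !(add0r, addr0, subr0) => ->.
rewrite fs_int; last exact: lr_fsupp.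
rewrite -fsD.
- apply: eq_fs => i; rewrite binzN1 -expr2 sqrr_sign scale1r -scaleNr exprN1 invrN1 opprK scale1r.
  rewrite [in X in _ = _ + X]lr_comm.
  by congr (mod_Y _ _ (mod_Y _ _ _) + mod_Y _ _ (mod_Y _ _ _)); lia.
- by apply: (@fsupp_inj _ _ _ (fun z : int => `|(- 1 - z)%R|%N) (fun i : nat => - 1 - i%:Z)) (lr_fsupp u v n x) => i; lia.
- by apply: (@fsupp_inj _ _ _ (fun z : int => `|z|%N) (fun i : nat => i%:Z)) (lr_fsupp u v n x) => i; lia.
Qed.

End OnModule.

(** By [lr_mode] the two restricted actions determine the whole action, so compatibility can be
    checked on each factor separately. *)
Lemma lr_hom (X Y : mod_data (tens_voa U V)) (f : X -> Y) :
  weak_module X -> weak_module Y -> linear f ->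
  (forall u n (x : X), f (mod_Y (tpure u (voa_vac V) : tens_voa U V) n x) =
     mod_Y (tpure u (voa_vac V) : tens_voa U V) n (f x)) ->
  (forall v n (x : X), f (mod_Y (tpure (voa_vac U) v : tens_voa U V) n x) =
     mod_Y (tpure (voa_vac U) v : tens_voa U V) n (f x)) -> is_hom f.
Proof.
move=> wX wY lf fl fr; split=> // t n x.
have bX := (weak_truncated wX).1 n; have bY := (weak_truncated wY).1 n.
elim/tens_ind: t => [|t t' IH IH'|u v].
- by rewrite (bil0l bX) (bil0l bY) (linear0P lf).
- by rewrite (bilDl bX) (bilDl bY) (linearDP lf) IH IH'.
rewrite !lr_mode // (linear_fsP lf); last exact: lr_fsupp.
by apply: eq_fs => i; rewrite fl fr.
Qed.

End TensorAction.

(** * Submodules and quotients *)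

Section Subspaces.
Variables (K : fieldType) (W : lmodType K).

Definition subspace (A : set W) : Prop :=
  A 0 /\ forall c x y, A x -> A y -> A (c *: x + y).

Lemma subspaceD A x y : subspace A -> A x -> A y -> A (x + y).
Proof. by move=> [_ h] hx hy; rewrite -[x]scale1r; exact: h. Qed.
Lemma subspaceZ A c x : subspace A -> A x -> A (c *: x).
Proof. by move=> [h0 h] hx; rewrite -[_ *: _]addr0; exact: h. Qed.
Lemma subspace_sum A (I : Type) (s : seq I) (P : pred I) (f : I -> W) :
  subspace A -> (forall i, P i -> A (f i)) -> A (\sum_(i <- s | P i) f i).
Proof.
move=> hA h; elim/big_rec: _ => [|i x Pi hx]; first by case: hA.
exact: subspaceD (h i Pi) hx.
Qed.

End Subspaces.

Section Submodules.
Variables (K : fieldType) (V : voa_data K).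
Implicit Types M N W X Y : mod_data V.

(** The condition under which submodules, quotients and lengths are treated. It also holds for the
    pointwise action on functions in [fun_mod], where a truncation bound may depend on the point. *)
Definition linear_modes W : Prop := forall (v : V) n, linear (@mod_Y K V W v n).

Lemma mode0r W (v : V) n : linear_modes W -> mod_Y v n (0 : W) = 0.
Proof. by move=> h; exact: linear0P (h v n). Qed.

Section SubFacts.
Variables (W : mod_data V) (S : set W).
Hypothesis hS : is_submodule S.

Lemma sub0 : S 0. Proof. by case: hS. Qed.
Lemma subZD c x y : S x -> S y -> S (c *: x + y).
Proof. by case: hS => _ h _; exact: h. Qed.
Lemma subY (v : V) n x : S x -> S (mod_Y v n x).
Proof. by case: hS => _ _; apply. Qed.
Lemma subD x y : S x -> S y -> S (x + y).
Proof. by move=> hx hy; rewrite -[x]scale1r; exact: subZD. Qed.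
Lemma subZ c x : S x -> S (c *: x).
Proof. by move=> hx; rewrite -[_ *: _]addr0; apply: subZD => //; exact: sub0. Qed.
Lemma subN x : S x -> S (- x).
Proof. by rewrite -scaleN1r; exact: subZ. Qed.
Lemma subB x y : S x -> S y -> S (x - y).
Proof. by move=> hx hy; apply: subD => //; exact: subN. Qed.
Lemma sub_sum (I : Type) (s : seq I) (P : pred I) (f : I -> W) :
  (forall i, S (f i)) -> S (\sum_(i <- s | P i) f i).
Proof. by move=> h; elim/big_rec: _ => [|i x _]; [exact: sub0|exact: subD]. Qed.
End SubFacts.

Lemma hom_lin M N (f : M -> N) : is_hom f -> linear f. Proof. by case. Qed.
Lemma hom0 M N (f : M -> N) : is_hom f -> f 0 = 0.
Proof. by case=> /linear0P. Qed.
Lemma homD M N (f : M -> N) : is_hom f -> {morph f : x y / x + y}.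
Proof. by case=> /linearDP. Qed.
Lemma homB M N (f : M -> N) : is_hom f -> {morph f : x y / x - y}.
Proof. by case=> /linearBP. Qed.
Lemma homZ M N (f : M -> N) c : is_hom f -> {morph f : x / c *: x}.
Proof. by move=> [l _] x; exact: linearZP. Qed.
Lemma hom_sum M N (f : M -> N) (I : Type) (s : seq I) (P : pred I) g : is_hom f ->
  f (\sum_(i <- s | P i) g i) = \sum_(i <- s | P i) f (g i).
Proof. by case=> h _; exact: linear_sumP. Qed.
Lemma hom_comp M N X (f : M -> N) (g : N -> X) :
  is_hom f -> is_hom g -> is_hom (g \o f).
Proof.
move=> [lf hf] [lg hg]; split; first exact: linear_comp.
by move=> v n x /=; rewrite hf hg.
Qed.
Lemma hom_id M : is_hom (fun x : M => x). Proof. by []. Qed.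
Lemma surj_hom_id M : is_surj_hom (fun x : M => x).
Proof. by split=> // x; exists x. Qed.
Lemma hom_add M N (f g : M -> N) : linear_modes N -> is_hom f -> is_hom g ->
  is_hom (fun x => f x + g x).
Proof.
move=> lN [lf hf] [lg hg]; split.
  by move=> c x y; rewrite lf lg scalerDr addrACA.
by move=> v n x; rewrite hf hg (linearDP (lN v n)).
Qed.
Lemma hom_scale M N (f : M -> N) (a : K) : linear_modes N -> is_hom f ->
  is_hom (fun x => a *: f x).
Proof.
move=> lN [lf hf]; split.
  by move=> c x y; rewrite lf scalerDr !scalerA mulrC.
by move=> v n x; rewrite hf (linearZP (lN v n)).
Qed.
Lemma hom_zero M N : linear_modes N -> is_hom (fun _ : M => 0 : N).
Proof.
move=> lN; split; first by move=> c x y; rewrite scaler0 addr0.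
by move=> v n x; rewrite mode0r.
Qed.
Lemma hom_bigsum M N (I : Type) (s : seq I) (P : pred I) (f : I -> M -> N) : linear_modes N ->
  (forall i, is_hom (f i)) -> is_hom (fun x => \sum_(i <- s | P i) f i x).
Proof.
move=> lN h; elim: s => [|i s IH].
  rewrite (_ : (fun _ => _) = fun _ => 0); first exact: hom_zero.
  by apply/funext => x; rewrite big_nil.
rewrite (_ : (fun _ => _) = fun x => (if P i then f i x else 0) + \sum_(j <- s | P j) f j x).
  apply: hom_add => //; case: (P i); [exact: h|exact: hom_zero].
by apply/funext => x; rewrite big_cons; case: ifP; rewrite ?add0r.
Qed.
Lemma hom_iter M (g : M -> M) k : is_hom g -> is_hom (iter k g).
Proof. by move=> h; elim: k => [|k IH]; [exact: hom_id|exact: hom_comp IH h]. Qed.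

Lemma sub_setT W : is_submodule [set: W]. Proof. by []. Qed.
Lemma sub_set0 W : linear_modes W -> is_submodule [set (0 : W)].
Proof.
move=> h; split=> // [a x y -> ->|v n x ->]; first by rewrite /= scaler0 addr0.
by rewrite /= mode0r.
Qed.
Lemma sub_preimage M N (f : M -> N) (S : set N) : is_hom f -> is_submodule S ->
  is_submodule [set x | S (f x)].
Proof.
move=> [lf hf] hS; split=> /=.
- by rewrite (linear0P lf); exact: sub0.
- by move=> a x y hx hy; rewrite lf; exact: subZD.
- by move=> v n x hx; rewrite hf; exact: subY.
Qed.
Lemma sub_image M N (f : M -> N) (S : set M) : is_hom f -> is_submodule S ->
  is_submodule (f @` S).
Proof.
move=> [lf hf] hS; split.
- by exists 0; [exact: sub0|exact: linear0P].
- by move=> a _ _ [x hx <-] [y hy <-]; exists (a *: x + y); [exact: subZD|rewrite lf].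
- by move=> v n _ [x hx <-]; exists (mod_Y v n x); [exact: subY|rewrite hf].
Qed.
Lemma sub_range M N (f : M -> N) : is_hom f -> is_submodule (range f).
Proof. by move=> hf; exact: sub_image. Qed.
Lemma sub_ker M N (f : M -> N) : linear_modes N -> is_hom f ->
  is_submodule [set x | f x = 0].
Proof. by move=> lN hf; exact: (sub_preimage hf (sub_set0 lN)). Qed.
Lemma sub_setI W (S T : set W) : is_submodule S -> is_submodule T ->
  is_submodule (S `&` T).
Proof.
move=> hS hT; split.
- by split; exact: sub0.
- by move=> a x y [? ?] [? ?]; split; exact: subZD.
- by move=> v n x [? ?]; split; exact: subY.
Qed.

Definition sadd W (S T : set W) : set W := [set z | exists x y, [/\ S x, T y & z = x + y]].

Lemma sub_sadd W (S T : set W) : linear_modes W -> is_submodule S -> is_submodule T ->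
  is_submodule (sadd S T).
Proof.
move=> lW hS hT; split.
- by exists 0, 0; rewrite addr0; split=> //; exact: sub0.
- move=> a _ _ [x [y [hx hy ->]]] [x' [y' [hx' hy' ->]]].
  exists (a *: x + x'), (a *: y + y'); split; try exact: subZD.
  by rewrite scalerDr addrACA.
- move=> v n _ [x [y [hx hy ->]]]; exists (mod_Y v n x), (mod_Y v n y).
  by split; try exact: subY; rewrite (linearDP (lW v n)).
Qed.
Lemma sadd_l W (S T : set W) : is_submodule T -> S `<=` sadd S T.
Proof. by move=> hT x hx; exists x, 0; rewrite addr0; split=> //; exact: sub0. Qed.
Lemma sadd_r W (S T : set W) : is_submodule S -> T `<=` sadd S T.
Proof. by move=> hS x hx; exists 0, x; rewrite add0r; split=> //; exact: sub0. Qed.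

Lemma gen_sub W (x : W) : is_submodule (gen_submodule x).
Proof.
split.
- by move=> S hS _; exact: sub0.
- by move=> a y z hy hz S hS Sx; apply: subZD => //; [exact: hy|exact: hz].
- by move=> v n y hy S hS Sx; apply: subY => //; exact: hy.
Qed.
Lemma gen_in W (x : W) : gen_submodule x x. Proof. by move=> S _. Qed.
Definition gens W (s : seq W) : set W :=
  [set y | forall S : set W, is_submodule S -> {in s, forall x, S x} -> S y].
Lemma gens_sub W (s : seq W) : is_submodule (gens s).
Proof.
split.
- by move=> S hS _; exact: sub0.
- by move=> a y z hy hz S hS Sx; apply: subZD => //; [exact: hy|exact: hz].
- by move=> v n y hy S hS Sx; apply: subY => //; exact: hy.
Qed.

Section SubMod.
Variables (W : mod_data V) (S : set W) (hS : is_submodule S).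

(** The proof of [is_submodule S] is a parameter of the type because the algebraic structures
    attached to it are built from that proof. The boolean form of membership makes the inclusion
    injective. *)
Definition sub_car of is_submodule S : Type := {x : W | `[< S x >]}.
Local Notation T := (sub_car hS).
HB.instance Definition _ := Choice.on T.
Definition sub_mk x (h : S x) : T := exist _ x (asboolT h).
Definition sub_val (x : T) : W := sval x.
Lemma sub_valP (x : T) : S (sub_val x). Proof. by case: x => x /= /asboolP. Qed.
Lemma sub_val_inj : injective sub_val. Proof. by move=> x y; exact: val_inj. Qed.

Let szero : T := sub_mk (sub0 hS).
Let sadd' (x y : T) : T := sub_mk (subD hS (sub_valP x) (sub_valP y)).
Let sopp (x : T) : T := sub_mk (subN hS (sub_valP x)).
Let sscale (c : K) (x : T) : T := sub_mk (subZ hS c (sub_valP x)).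
Let saA : associative sadd'. Proof. by move=> x y z; apply: sub_val_inj; exact: addrA. Qed.
Let saC : commutative sadd'. Proof. by move=> x y; apply: sub_val_inj; exact: addrC. Qed.
Let sa0 : left_id szero sadd'. Proof. by move=> x; apply: sub_val_inj; exact: add0r. Qed.
Let saN : left_inverse szero sopp sadd'.
Proof. by move=> x; apply: sub_val_inj; exact: addNr. Qed.
HB.instance Definition _ := GRing.isZmodule.Build T saA saC sa0 saN.
Let ssA a b v : sscale a (sscale b v) = sscale (a * b) v.
Proof. by apply: sub_val_inj; exact: scalerA. Qed.
Let ss1 : left_id 1 sscale. Proof. by move=> v; apply: sub_val_inj; exact: scale1r. Qed.
Let ssDr : right_distributive sscale +%R.
Proof. by move=> c x y; apply: sub_val_inj; exact: scalerDr. Qed.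
Let ssDl v : {morph sscale^~ v : a b / a + b}.
Proof. by move=> a b; apply: sub_val_inj; exact: scalerDl. Qed.
HB.instance Definition _ := GRing.Zmodule_isLmodule.Build K T ssA ss1 ssDr ssDl.

Definition sub_mod : mod_data V :=
  @ModData K V T (fun v n x => sub_mk (subY hS v n (sub_valP x))).

Definition sub_in (x : sub_mod) : W := sub_val x.
Lemma sub_inP (x : sub_mod) : S (sub_in x). Proof. exact: sub_valP. Qed.
Lemma sub_in_inj : injective sub_in. Proof. exact: sub_val_inj. Qed.
Lemma sub_in_hom : is_hom sub_in. Proof. by []. Qed.
Lemma sub_in_inj_hom : is_inj_hom sub_in.
Proof. by split=> //; exact: sub_in_inj. Qed.
Lemma sub_surj x : S x -> exists y : sub_mod, sub_in y = x.
Proof. by move=> h; exists (sub_mk h). Qed.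
Lemma sub_mlin : linear_modes W -> linear_modes sub_mod.
Proof. by move=> lW v n c x y; apply: sub_in_inj; exact: lW. Qed.

Section Corestrict.
Variables (X : mod_data V) (f : X -> W) (hf : is_hom f) (fS : forall x, S (f x)).
Definition corestrict (x : X) : sub_mod := sub_mk (fS x).
Lemma corestrict_hom : is_hom corestrict.
Proof.
case: hf => lf yf; split=> [c x y|v n x]; apply: sub_in_inj; [exact: lf|exact: yf].
Qed.
Lemma corestrictK x : sub_in (corestrict x) = f x. Proof. by []. Qed.
End Corestrict.
End SubMod.

Section QuotMod.
Variables (W : mod_data V) (S : set W) (hS : is_submodule S).

(* The quotient is realised by chosen representatives of the cosets. *)
Let rep (x : W) : W := xget 0 [set y | S (y - x)].
Let repP x : S (rep x - x).
Proof.
rewrite /rep; case: xgetP => [y -> //|/(_ x)]; rewrite /= subrr => h.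
by case: h; exact: sub0.
Qed.
Let rep_eq x y : S (x - y) -> rep x = rep y.
Proof.
move=> h; rewrite /rep; congr xget; apply/seteqP; split=> z /= hz.
  by rewrite -[z](subrK x) -addrA; exact: subD.
rewrite -[z](subrK y) -addrA; apply: subD => //.
by rewrite -opprB; exact: subN.
Qed.
Let repK x : rep (rep x) = rep x. Proof. exact: rep_eq. Qed.

Definition quo_car of is_submodule S : Type := {x : W | rep x == x}.
Local Notation T := (quo_car hS).
HB.instance Definition _ := Choice.on T.
Definition qmk (x : W) : T := exist _ (rep x) (introT eqP (repK x)).
Let qval (x : T) : W := sval x.
Let qvalK x : qmk (qval x) = x.
Proof. by apply: val_inj => /=; case: x => x /= /eqP. Qed.
Let quo_eq x y : S (x - y) -> qmk x = qmk y.
Proof. by move=> h; apply: val_inj => /=; exact: rep_eq. Qed.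
Let qvalP x : S (qval (qmk x) - x). Proof. exact: repP. Qed.

Let qzero : T := qmk 0.
Let qadd (x y : T) : T := qmk (qval x + qval y).
Let qopp (x : T) : T := qmk (- qval x).
Let qscale (c : K) (x : T) : T := qmk (c *: qval x).
Let quo_add x y : qadd (qmk x) (qmk y) = qmk (x + y).
Proof. by apply: quo_eq; rewrite opprD addrACA; exact: subD. Qed.
Let quo_opp x : qopp (qmk x) = qmk (- x).
Proof. by apply: quo_eq; rewrite -opprD; exact: subN. Qed.
Let quo_scale c x : qscale c (qmk x) = qmk (c *: x).
Proof. by apply: quo_eq; rewrite -scalerBr; exact: subZ. Qed.

Let qaA : associative qadd.
Proof.
by move=> x y z; rewrite -[x]qvalK -[y]qvalK -[z]qvalK !quo_add addrA.
Qed.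
Let qaC : commutative qadd.
Proof. by move=> x y; rewrite -[x]qvalK -[y]qvalK !quo_add addrC. Qed.
Let qa0 : left_id qzero qadd.
Proof. by move=> x; rewrite -[x]qvalK quo_add add0r. Qed.
Let qaN : left_inverse qzero qopp qadd.
Proof. by move=> x; rewrite -[x]qvalK quo_opp quo_add addNr. Qed.
HB.instance Definition _ := GRing.isZmodule.Build T qaA qaC qa0 qaN.
Let qsA a b v : qscale a (qscale b v) = qscale (a * b) v.
Proof. by rewrite -[v]qvalK !quo_scale scalerA. Qed.
Let qs1 : left_id 1 qscale.
Proof. by move=> v; rewrite -[v]qvalK quo_scale scale1r. Qed.
Let qsDr : right_distributive qscale +%R.
Proof.
move=> c x y; rewrite -[x]qvalK -[y]qvalK -![_ + _]/(qadd _ _) quo_add.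
by rewrite !quo_scale quo_add scalerDr.
Qed.
Let qsDl v : {morph qscale^~ v : a b / a + b}.
Proof.
by move=> a b; rewrite -[v]qvalK !quo_scale -[RHS]/(qadd _ _) quo_add scalerDl.
Qed.
HB.instance Definition _ := GRing.Zmodule_isLmodule.Build K T qsA qs1 qsDr qsDl.

Definition quo_mod : mod_data V :=
  @ModData K V T (fun v n x => qmk (mod_Y v n (qval x))).

Definition quo (x : W) : quo_mod := qmk x.

Lemma quo_eq0 x : (quo x = 0) <-> S x.
Proof.
split=> [e|h]; last by apply: quo_eq; rewrite subr0.
have h : rep x = rep 0 := congr1 sval e.
have h0 := repP 0; rewrite subr0 in h0.
rewrite -[x](subKr (rep 0)); apply: subB => //.
by rewrite -h.
Qed.
Lemma quo_linear : linear quo.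
Proof.
move=> c x y; apply: etrans (esym (quo_add (c *: x) y)) _.
by rewrite /quo -quo_scale.
Qed.
Lemma quo_surj : surj quo.
Proof. by move=> x; exists (qval x); exact: qvalK. Qed.
Hypothesis lW : linear_modes W.
Lemma quo_hom : is_hom quo.
Proof.
split=> [|v n x]; first exact: quo_linear.
apply: quo_eq; rewrite -(linearBP (lW v n)); apply: subY => //.
by rewrite -opprB; exact: subN.
Qed.
Lemma quo_mlin : linear_modes quo_mod.
Proof.
move=> v n c x y.
have [x' <-] := quo_surj x; have [y' <-] := quo_surj y.
have [_ h] := quo_hom; rewrite -quo_linear -!h -quo_linear.
by rewrite lW.
Qed.
End QuotMod.

Section Factor.
Variables (M N X : mod_data V) (q : M -> N) (f : M -> X).
Hypotheses (hq : is_surj_hom q) (hf : is_hom f) (hker : forall x, q x = 0 -> f x = 0).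
Lemma hom_factor : exists2 g : N -> X, is_hom g & forall x, g (q x) = f x.
Proof.
have [[lq yq] /choice[s hs]] := hq; have [lf yf] := hf.
have e x y : q x = q y -> f x = f y.
  move=> h; apply/eqP; rewrite -subr_eq0 -(linearBP lf) hker //.
  by rewrite (linearBP lq) h subrr.
exists (fun y => f (s y)); last by move=> x; apply: e.
split=> [c x y|v n x].
  by rewrite -lf; apply: e; rewrite lq !hs.
by rewrite -yf; apply: e; rewrite yq !hs.
Qed.
End Factor.

Section Zorn.
Variables (W : mod_data V) (A : set W) (x : W).
Hypotheses (hA : is_submodule A) (nAx : ~ A x).
(** Modulo such a [C] the class of [x] lies in every nonzero submodule. This is what replaces a
    choice of maximal submodules in modules that need not be finitely generated. *)
Lemma zorn_avoid : exists C : set W, [/\ is_submodule C, A `<=` C, ~ C x &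
  forall D : set W, is_submodule D -> C `<=` D -> ~ D x -> D `<=` C].
Proof.
pose P : set (set W) := fun C => C = set0 \/ [/\ is_submodule C, A `<=` C & ~ C x].
have [F FP Ftot|C [PC Cmax]] := @Zorn_bigcup W P.
  have [[D FD [d Dd]]|no] := pselect (exists2 D, F D & D !=set0); last first.
    left; apply/seteqP; split=> // y [D FD Dy]; apply: no; exists D => //.
    by exists y.
  have good D' : F D' -> D' !=set0 -> [/\ is_submodule D', A `<=` D' & ~ D' x].
    by move=> /FP[->|//] [].
  have [sD AD Dx] := good D FD (ex_intro _ d Dd).
  right; split.
  - split.
    + by exists D => //; exact: sub0.
    + move=> a y z [D1 F1 h1] [D2 F2 h2].
      have [s1 _ _] := good D1 F1 (ex_intro _ y h1).
      have [s2 _ _] := good D2 F2 (ex_intro _ z h2).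
      have [h|h] := Ftot _ _ F1 F2.
        by exists D2 => //; apply: subZD => //; exact: h.
      by exists D1 => //; apply: subZD => //; exact: h.
    + move=> v n y [D1 F1 h1]; exists D1 => //.
      by have [s1 _ _] := good D1 F1 (ex_intro _ y h1); exact: subY.
  - by move=> y Ay; exists D => //; exact: AD.
  - move=> [D1 F1 h1].
    by have [_ _ []] := good D1 F1 (ex_intro _ x h1).
have {PC}[sC AC Cx] : [/\ is_submodule C, A `<=` C & ~ C x].
  case: PC => // C0; exfalso; apply: (Cmax A); last by right; split=> //; exact: subset_refl.
  by rewrite C0; split=> // /(_ 0 (sub0 hA)).
exists C; split=> // D sD CD Dx; apply: contrapT => nDC.
by apply: (Cmax D); [split|right; split=> //; exact: subset_trans CD].
Qed.
End Zorn.

End Submodules.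
Arguments sub_in {K V W S hS}.
Arguments quo {K V W S} hS.
Arguments quo_surj {K V W S} hS.
Arguments quo_eq0 {K V W S} hS.
Arguments quo_hom {K V W S} hS.
Arguments sub_surj {K V W S} hS.

(** * Separating linear functionals *)

Section Functionals.
Variables (K : fieldType) (V : voa_data K) (B : lmodType K).

(** With zero modes, submodules are subspaces, so [zorn_avoid] and [quo_mod] become available for
    plain vector spaces. *)
Definition triv_mod : mod_data V := @ModData K V B (fun _ _ _ => 0).

Lemma triv_sub (A : set B) : subspace A -> is_submodule (W := triv_mod) A.
Proof. by case=> h0 h1; split. Qed.

(** A subspace [C] maximal among those containing [A] and avoiding [d] is a complement of the line
    through [d]; the functional is the coordinate along [d]. *)
Lemma functional (A : set B) (d : B) : subspace A -> ~ A d ->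
  exists l : B -> K, [/\ forall c x y, l (c *: x + y) = c * l x + l y,
    forall x, A x -> l x = 0 & l d = 1].
Proof.
move=> /triv_sub hA nd; have [C [sC AC Cd Cmax]] := zorn_avoid hA nd.
have uniq c : C (c *: d) -> c = 0.
  move=> h; apply/eqP; apply: contrapT => /negP c0; apply: Cd.
  by rewrite -[d]scale1r -(mulVf c0) -scalerA; exact: (subZ sC).
have ex x : exists c, C (x - c *: d).
  apply: contrapT => no.
  pose D : set triv_mod := [set z | exists c y, C y /\ z = c *: (x : B) + y].
  have sD : is_submodule D.
    split.
    - by exists 0, 0; split; [exact: (sub0 sC)|rewrite scale0r addr0].
    - move=> a _ _ [c [y [hy ->]]] [c' [y' [hy' ->]]].
      exists (a * c + c'), (a *: y + y'); split; first exact: (subZD sC).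
      by rewrite scalerDr scalerDl -scalerA addrACA.
    - by move=> v n z _; exists 0, 0; split; [exact: (sub0 sC)|rewrite scale0r addr0].
  have CD : C `<=` D by move=> y hy; exists 0, y; rewrite scale0r add0r.
  have nD : ~ D d.
    move=> [c [y [hy e]]]; have [c0|c0] := eqVneq c 0.
      by apply: Cd; rewrite e c0 scale0r add0r.
    apply: no; exists c^-1.
    rewrite e scalerDr scalerA mulVf // scale1r opprD addrA subrr add0r.
    by apply: (subN sC); exact: (subZ sC).
  apply: no; exists 0; rewrite scale0r subr0; apply: (Cmax D sD CD nD).
  by exists 1, 0; split; [exact: (sub0 sC)|rewrite scale1r addr0].
have [l hl] := choice ex.
have lP x c : C (x - c *: d) -> l x = c.
  move=> h; apply/eqP; rewrite -subr_eq0; apply/eqP; apply: uniq.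
  rewrite scalerBl -[l x *: d](subKr x) -addrAC.
  by apply: (subB sC).
exists l; split.
- move=> c x y; apply: lP.
  have -> : c *: x + y - (c * l x + l y) *: d = c *: (x - l x *: d) + (y - l y *: d).
    by rewrite scalerDl scalerBr scalerA opprD addrACA.
  exact: (subZD sC).
- by move=> x Ax; apply: lP; rewrite scale0r subr0; exact: AC.
- by apply: lP; rewrite scale1r subrr; exact: (sub0 sC).
Qed.

End Functionals.

(** * Length, Fitting and Schur *)

Section Length.
Variables (K : fieldType) (V : voa_data K).
Implicit Types M N W X Y : mod_data V.

(** Finite length in the form of a strictly increasing rank function on submodules: it bounds
    chains, supports induction and is easily transported along embeddings, quotients and
    extensions. *)
Definition strict_length W (l : set W -> nat) : Prop :=
  forall A B : set W, is_submodule A -> is_submodule B -> A `<=` B -> A <> B ->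
    (l A < l B)%N.

Definition len_le W (n : nat) : Prop :=
  exists2 l : set W -> nat, strict_length l & (l [set: W] <= n)%N.

Lemma strict_length_le W (l : set W -> nat) A B : strict_length l ->
  is_submodule A -> is_submodule B -> A `<=` B -> (l A <= l B)%N.
Proof.
move=> h sA sB AB; have [->//|ne] := pselect (A = B).
exact: ltnW (h _ _ sA sB AB ne).
Qed.

(** The rank of [A] is the number of composition factors that [A] meets, i.e. of steps where A ∩
    S_{i+1} is not contained in S_i. *)
Lemma finite_length_len W : linear_modes W -> finite_length W -> exists n, len_le W n.
Proof.
move=> lW [n [S [S0 Sn sS stepS]]].
pose b (A : set W) i := `[< ~ (A `&` S i.+1 `<=` S i) >].
pose l (A : set W) : nat := (\sum_(i < n) (b A i : nat))%N.
exists (l setT); exists l => // A B sA sB AB ne.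
have bAB i : b A i -> b B i.
  move=> /asboolP h; apply/asboolP => h'; apply: h => x [Ax Sx].
  by apply: h'; split=> //; exact: AB.
have [i /andP[bB nbA]] : exists i : 'I_n, b B i && ~~ b A i.
  apply/existsP; apply: contraT => /existsPn h; exfalso; apply: ne.
  have bBA (i : 'I_n) : b B i -> b A i.
    by move=> hB; apply: contraT => hA; have := h i; rewrite hB hA.
  apply/seteqP; split=> // x.
  have H k : (k <= n)%N -> B `&` S k `<=` A.
    elim: k => [|k IH] kn y [By Sy].
      by move: Sy; rewrite S0 => ->; exact: sub0.
    have [_ simp] := stepS k kn.
    case: (boolP (b B k)) => [|/asboolPn hB]; last first.
      by apply: (IH (ltnW kn)); split=> //; apply: (contrapT hB).
    move=> /(bBA (Ordinal kn))/asboolP/= hA.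
    have sk := sS k (ltnW kn); have sk1 := sS k.+1 kn.
    (* If [A] meets the simple factor it covers it, so [y] = z + t with [t] in [A] and [z] in the
       lower term; then [z] is still in [B], and induction applies to it. *)
    have := simp (sadd (S k) (A `&` S k.+1)) (sub_sadd lW sk (sub_setI sA sk1)).
    case.
    - exact: (sadd_l (sub_setI sA sk1)).
    - move=> _ [z [t [hz [_ ht] ->]]]; apply: (subD sk1) => //.
      by have [[h1 _] _] := stepS k kn; apply: h1.
    - by move=> e; exfalso; apply: hA; rewrite -[X in _ `<=` X]e; exact: (sadd_r sk).
    move=> e; have : sadd (S k) (A `&` S k.+1) y by rewrite e.
    move=> [z [t [hz [At St] yE]]]; rewrite yE; apply: subD => //.
    apply: (IH (ltnW kn)); split=> //.
    rewrite (_ : z = y - t); last by rewrite yE addrK.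
    by apply: (subB sB) => //; exact: AB.
  by move=> Bx; apply: (H n (leqnn n)); rewrite Sn.
rewrite /l (bigD1 i) //= [X in (_ < X)%N](bigD1 i) //= bB (negbTE nbA) add0n add1n ltnS.
by apply: leq_sum => j _; case: (b A j) (bAB j) => // ->.
Qed.

(** A proper submodule with the greatest rank is maximal; descending through such submodules
    produces the series. *)
Lemma len_finite_length W n : linear_modes W -> len_le W n -> finite_length W.
Proof.
move=> lW [l hl _].
have H m (A : set W) : is_submodule A -> (l A <= m)%N ->
  exists (n : nat) (S : nat -> set W),
    [/\ S 0 = [set 0], S n = A,
        forall i, (i <= n)%N -> is_submodule (S i)
      & forall i, (i < n)%N -> S i `<` S i.+1 /\
          forall T : set W, is_submodule T -> S i `<=` T -> T `<=` S i.+1 ->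
            T = S i \/ T = S i.+1].
  elim: m A => [|m IH] A sA lA.
    have -> : A = [set 0].
      apply: contrapT => ne; have := hl [set 0] A (sub_set0 lW) sA.
      move=> /(_ _ _)/leq_trans /(_ lA); rewrite ltn0 => h; suff : false by [].
      by apply: h; [move=> x ->; exact: sub0|exact: nesym].
    exists 0%N, (fun _ => [set 0]); split=> // i _; exact: sub_set0.
  have [->|A0] := pselect (A = [set 0]).
    exists 0%N, (fun _ => [set 0]); split=> // i _; exact: sub_set0.
  pose Q k := `[< exists B : set W, [/\ is_submodule B, B `<=` A, B <> A & l B = k] >].
  have Qex : exists k, Q k.
    exists (l [set 0]); apply/asboolP; exists [set 0]; split=> //.
    - exact: sub_set0.
    - by move=> x ->; exact: sub0.
    - exact: nesym.
  have Qub k : Q k -> (k <= l A)%N.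
    by move=> /asboolP[B [sB BA _ <-]]; exact: strict_length_le.
  case: (ex_maxnP Qex Qub) => k /asboolP[B [sB BA nBA lB]] kmax.
  have [|n' [S [S0 Sn sS stepS]]] := IH B sB.
    by have := leq_trans (hl _ _ sB sA BA nBA) lA; rewrite ltnS.
  exists n'.+1, (fun i => if (i <= n')%N then S i else A); split=> //.
  - by rewrite /= ltnn.
  - by move=> i _ /=; case: ifP => // /sS.
  move=> i; rewrite ltnS => ilen; have := ilen; rewrite {1}leq_eqVlt => /orP[/eqP->|h].
    rewrite leqnn ltnn Sn; split; first by split=> // AB; apply: nBA; exact/seteqP.
    move=> T sT BT TA; have [->|nT] := pselect (T = A); first by right.
    left; apply: contrapT => nTB.
    have := kmax (l T); rewrite leqNgt -lB hl //; last exact: nesym.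
    move=> h; suff : false by [].
    by apply: h; apply/asboolP; exists T.
  by rewrite h ilen; exact: stepS.
have [n' [S h]] := H (l setT) setT (@sub_setT _ _ W) (leqnn _).
by exists n', S.
Qed.

(** The rank of [S] is the rank of its preimage under [i] plus that of its image under [q]. If
    neither grows from [A] to [B], the two submodules agree. *)
Lemma len_ext M X N (i : M -> X) (q : X -> N) a b : is_hom i -> is_hom q ->
  (forall x, q x = 0 -> exists y, x = i y) -> len_le M a -> len_le N b ->
  len_le X (a + b).
Proof.
move=> hi hq ker [l1 h1 b1] [l2 h2 b2].
exists (fun S => l1 [set y | S (i y)] + l2 (q @` S))%N; last first.
  rewrite leq_add //; apply: leq_trans b2.
  by apply: strict_length_le => //; exact: sub_range.
move=> A B sA sB AB ne.
have sA1 := sub_preimage hi sA; have sB1 := sub_preimage hi sB.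
have sA2 := sub_image hq sA; have sB2 := sub_image hq sB.
have AB1 : [set y | A (i y)] `<=` [set y | B (i y)] by move=> y; exact: AB.
have AB2 : q @` A `<=` q @` B by exact: image_subset.
have [e1|n1] := pselect ([set y | A (i y)] = [set y | B (i y)]); last first.
  by rewrite -addSn leq_add //; [exact: h1|exact: strict_length_le].
have [e2|n2] := pselect (q @` A = q @` B); last first.
  by rewrite -addnS leq_add //; [exact: strict_length_le|exact: h2].
exfalso; apply: ne; apply/seteqP; split=> // x Bx.
have : (q @` B) (q x) by exists x.
rewrite -e2 => -[y Ay qy].
have [|z zE] := ker (x - y); first by rewrite (homB hq) qy subrr.
have : [set y | B (i y)] z by rewrite /= -zE; apply: subB => //; exact: AB.
by rewrite -e1 /= -zE => h; rewrite -[x](subrK y); exact: subD.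
Qed.

Lemma len_inj M X (i : M -> X) (l : set X -> nat) n : is_inj_hom i -> strict_length l ->
  (l (range i) <= n)%N -> len_le M n.
Proof.
move=> [hi ii] hl ln; exists (fun S => l (i @` S)) => // A B sA sB AB ne.
apply: hl; [exact: sub_image|exact: sub_image|exact: image_subset|move=> e].
apply: ne; apply/seteqP; split=> // x Bx.
have : (i @` B) (i x) by exists x.
by rewrite -e => -[y Ay /ii <-].
Qed.

Lemma len_zero W : linear_modes W -> (forall x : W, x = 0) -> len_le W 0.
Proof.
move=> lW h0; exists (fun _ => 0%N) => // A B sA sB AB ne; exfalso; apply: ne.
by apply/seteqP; split=> // x _; rewrite (h0 x); exact: sub0.
Qed.

Lemma len_simple W : simple_module W -> len_le W 1.
Proof.
move=> [[x x0] sW].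
exists (fun S => if `[< S = [set 0] >] then 0%N else 1%N); last by case: ifP.
move=> A B sA sB AB ne.
have [eB|eB] := sW B sB.
  exfalso; apply: ne; rewrite eB; apply/seteqP; split=> y; first by rewrite -eB => /AB.
  by move=> ->; exact: sub0.
have [eA|eA] := sW A sA; last by exfalso; apply: ne; rewrite eA eB.
rewrite asboolT // asboolF // eB => e.
have /eqP : [set (0 : W)] x by rewrite -e.
by rewrite (negbTE x0).
Qed.

(** A list whose generated submodule has the greatest possible rank must generate everything, since
    one more vector would raise the rank. *)
Lemma len_fg W n : len_le W n ->
  exists s : seq W, forall A : set W, is_submodule A -> {in s, forall x, A x} -> A = setT.
Proof.
move=> [l hl ln].
pose Q k := `[< exists s : seq W, l (gens s) = k >].
have Qex : exists k, Q k by exists (l (gens [::])); apply/asboolP; exists [::].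
have Qub k : Q k -> (k <= l setT)%N.
  move=> /asboolP[s <-]; apply: strict_length_le => //; exact: gens_sub.
case: (ex_maxnP Qex Qub) => k /asboolP[s ls] kmax; exists s => A sA As.
suff e : gens s = setT.
  apply/seteqP; split=> // x _; have h : gens s x by rewrite e.
  exact: (h A sA As).
apply/seteqP; split=> // x _; apply: contrapT => nx.
have := kmax (l (gens (x :: s))); rewrite leqNgt -ls hl.
- by move=> h; suff : false by []; apply: h; apply/asboolP; exists (x :: s).
- exact: gens_sub.
- exact: gens_sub.
- by move=> y hy S sS hS; apply: hy => // z zs; apply: hS; rewrite inE zs orbT.
- move=> e; apply: nx; rewrite e => S sS; apply; exact: mem_head.
Qed.

Lemma maximal_sub W n : len_le W n -> (exists x : W, x != 0) -> linear_modes W ->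
  exists2 A : set W, is_submodule A & A <> setT /\
    forall B, is_submodule B -> A `<=` B -> B = A \/ B = setT.
Proof.
move=> [l hl ln] [x x0] lW.
pose Q k := `[< exists B : set W, [/\ is_submodule B, B <> setT & l B = k] >].
have Qex : exists k, Q k.
  exists (l [set 0]); apply/asboolP; exists [set 0]; split=> //; first exact: sub_set0.
  move=> e; have /eqP : [set (0 : W)] x by rewrite e.
  by rewrite (negbTE x0).
have Qub k : Q k -> (k <= l setT)%N.
  by move=> /asboolP[B [sB _ <-]]; exact: strict_length_le.
case: (ex_maxnP Qex Qub) => k /asboolP[A [sA nA lA]] kmax; exists A => //; split=> // B sB AB.
have [->|nB] := pselect (B = setT); [by right|left].
apply: contrapT => nAB; have := kmax (l B); rewrite leqNgt -lA hl //.
  by move=> h; suff : false by []; apply: h; apply/asboolP; exists B.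
by move=> e; apply: nAB.
Qed.

Lemma simple_quo W (A : set W) (hA : is_submodule A) : linear_modes W -> A <> setT ->
  (forall B, is_submodule B -> A `<=` B -> B = A \/ B = setT) ->
  simple_module (quo_mod hA).
Proof.
move=> lW nA maxA; split.
  apply: contrapT => no; apply: nA; apply/seteqP; split=> // x _.
  apply/(quo_eq0 hA); apply: contrapT => /eqP h; apply: no.
  by exists (quo hA x).
move=> S sS; have hq := quo_hom hA lW.
have [|e|e] := maxA _ (sub_preimage hq sS).
- by move=> x Ax /=; rewrite ((quo_eq0 hA x).2 Ax); exact: (sub0 sS).
- left; apply/seteqP; split=> [y Sy|y ->]; last exact: (sub0 sS).
  have [x xy] := quo_surj hA y; rewrite -xy; apply/(quo_eq0 hA).
  by rewrite -e /= xy.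
right; apply/seteqP; split=> // y _; have [x <-] := quo_surj hA y.
by have : [set: W] x by []; rewrite -e.
Qed.

Lemma simple_interval W (A B : set W) (sA : is_submodule A) (sB : is_submodule B) :
  linear_modes W -> A `<` B ->
  (forall T, is_submodule T -> A `<=` T -> T `<=` B -> T = A \/ T = B) ->
  simple_module (quo_mod (sub_preimage (sub_in_hom sB) sA)).
Proof.
move=> lW [AB nBA] simp; apply: simple_quo; first exact: sub_mlin.
  move=> e; apply: nBA => x Bx; have [y <-] := sub_surj sB _ Bx.
  by have : [set: sub_mod sB] y by []; rewrite -e.
move=> T sT AT.
have [x Ax|_ [y Ty <-]|e|e] := simp (sub_in @` T) (sub_image (sub_in_hom sB) sT).
- by have [y yx] := sub_surj sB _ (AB x Ax); exists y => //; apply: AT; rewrite /= yx.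
- exact: sub_inP.
- left; apply/seteqP; split=> // y Ty /=; rewrite -e; by exists y.
right; apply/seteqP; split=> // y _.
have h x : B x -> (sub_in @` T) x by rewrite e.
by have [z Tz /sub_in_inj <-] := h _ (sub_inP y).
Qed.

End Length.

Section Endomorphisms.
Variables (K : fieldType) (V : voa_data K) (W : mod_data V).
Hypotheses (lW : linear_modes W) (fW : fin_dim (W := W -> W) [set f | is_hom f]).
Variables (g : W -> W) (hg : is_hom g).

(** The n + 1 powers g^0, ..., g^n lie in the span of n functions; a nonzero row vector in the left
    kernel of their coefficient matrix gives the relation. *)
Lemma annihilator : exists n (c : 'I_n -> K), (exists i, c i != 0) /\
  forall x, \sum_(i < n) c i *: iter i g x = 0.
Proof.
have [n [e he]] := fW.
have /choice[a ha] : forall i : 'I_n.+1, exists a : 'I_n -> K,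
    iter i g = \sum_(j < n) a j *: e j by move=> i; apply: he; exact: hom_iter.
pose A := \matrix_(i < n.+1, j < n) a i j.
have nf : ~~ row_free A by rewrite -row_leq_rank -ltnNge ltnS rank_leq_col.
have [i ki] : exists i, row i (kermx A) != 0.
  apply: contrapT => no; move/negP: nf; apply; rewrite -kermx_eq0; apply/eqP.
  apply/row_matrixP => i; rewrite row0; apply/eqP; apply: contrapT => h.
  by apply: no; exists i; apply/negP.
have [u u0 uA] : exists2 u : 'rV_n.+1, u != 0 & u *m A = 0.
  by exists (row i (kermx A)) => //; apply: sub_kermxP; exact: row_sub.
exists n.+1, (fun i => u 0 i); split.
  apply: contrapT => no; move/negP: u0; apply; apply/eqP/rowP => j.
  rewrite mxE; apply/eqP; apply: contrapT => h; apply: no; exists j.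
  exact/negP.
move=> x; have E (j : 'I_n) : \sum_(k < n.+1) u 0 k * a k j = 0.
  have := congr1 (fun m : 'rV_n => m 0 j) uA; rewrite mxE [RHS]mxE => h.
  by rewrite -[RHS]h; apply: eq_bigr => k _; rewrite mxE.
transitivity (\sum_(k < n.+1) \sum_(j < n) (u 0 k * a k j) *: e j x).
  apply: eq_bigr => k _; rewrite ha.
  rewrite (_ : (\sum_(j < n) a k j *: e j) x = \sum_(j < n) a k j *: e j x).
    by rewrite scaler_sumr; apply: eq_bigr => j _; rewrite scalerA.
  elim/big_rec2: _ => // j y z _ <-; by [].
rewrite exchange_big big1 // => j _ /=.
by rewrite -scaler_suml E scale0r.
Qed.

Lemma iterE k j x : iter k g (iter j g x) = iter (k + j) g x.
Proof. by rewrite iterD. Qed.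

(* Fitting's lemma: the idempotent [e] projects onto the stable image of [g]. *)
Lemma fitting : exists (e r : W -> W) (k : nat),
  [/\ is_hom e /\ is_hom r, forall x, e (e x) = e x, forall x, e x = g (r x),
      forall x, e x = r (g x) & forall x, e (iter k g x) = iter k g x].
Proof.
have [n [c [[i0 ci0] hc]]] := annihilator.
pose c' (i : nat) := if insub i is Some j then c j else 0.
have c'E (i : 'I_n) : c' i = c i by rewrite /c' valK.
have hc' x : \sum_(i < n) c' i *: iter i g x = 0.
  by rewrite -[RHS](hc x); apply: eq_bigr => i _; rewrite c'E.
have ex : exists i, (i < n)%N && (c' i != 0).
  by exists i0; rewrite ltn_ord c'E.
(* With [k] the lowest degree in the relation, division by its coefficient gives g^k = g^(k+1) h for
   a polynomial h in g. *)
case: (ex_minnP ex) => k /andP[kn ck] kmin.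
have c0 i : (i < k)%N -> c' i = 0.
  move=> ik; apply/eqP; apply: contraT => h; have := kmin i.
  by rewrite h (ltn_trans ik kn) => /(_ isT); rewrite leqNgt ik.
pose h x := \sum_(j < n - k.+1) (- (c' (k + j.+1)%N / c' k)) *: iter j g x.
have hh : is_hom h.
  by apply: hom_bigsum => // j; apply: hom_scale => //; exact: hom_iter.
have gh x : g (h x) = h (g x).
  rewrite (hom_sum _ _ _ hg); apply: eq_bigr => j _.
  by rewrite (homZ _ hg) -iterS iterSr.
have gkh k' x : iter k' g (h x) = h (iter k' g x).
  by elim: k' => //= k' ->; rewrite gh.
have key x : iter k g x = iter k.+1 g (h x).
  have := hc' x; rewrite -(subnKC kn).
  rewrite big_split_ord /= big_ord_recr /= big1 ?add0r; last first.
    by move=> i _; rewrite c0 ?scale0r.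
  move=> /eqP; rewrite addr_eq0 => /eqP e.
  apply: (scalerI ck); rewrite e -/(iter k.+1 g _) gkh scaler_sumr -sumrN.
  apply: eq_bigr => j _; rewrite iterE scalerA mulrN mulrCA mulfV // mulr1.
  by rewrite scaleNr -iterS addSnnS; congr (- (_ *: iter _ g x)); lia.
have hgk k' x : iter k' h (g x) = g (iter k' h x).
  by elim: k' => //= k' ->; rewrite gh.
have comm a b x : iter a h (iter b g x) = iter b g (iter a h x).
  by elim: b => //= b <-; rewrite hgk.
have keyS j x : iter k.+1 g x = iter (k.+1 + j) g (iter j h x).
  elim: j => [|j IH]; first by rewrite addn0.
  rewrite IH (_ : (k.+1 + j)%N = (j.+1 + k)%N); last by lia.
  rewrite iterD key -iterD (_ : (k.+1 + j.+1)%N = (j.+1 + k.+1)%N) //; lia.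
have hit a : is_hom (iter a h) by exact: hom_iter.
have git a : is_hom (iter a g) by exact: hom_iter.
(* The exponent is k + 1, not k, so that the idempotent factors through [g] on both sides even when
   k = 0. *)
exists (fun x => iter k.+1 g (iter k.+1 h x)), (fun x => iter k g (iter k.+1 h x)), k.+1.
split.
- by split; [exact: hom_comp (hit _) (git _)|exact: hom_comp (hit _) (git _)].
- by move=> x; rewrite comm iterE -keyS.
- by move=> x.
- by move=> x; rewrite hgk -iterSr.
- by move=> x; rewrite comm iterE -keyS.
Qed.

(** If [g] is onto, so are its iterates, hence the idempotent is the identity; it also equals [r]
    after [g], so [g] has a left inverse. *)
Lemma surj_endo_inj : surj g -> injective g.
Proof.
move=> sg; have [e [r [k [_ _ _ er ek]]]] := fitting.
have sk j : forall y, exists x, iter j g x = y.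
  elim: j => [|j IH] y; first by exists y.
  by have [z <-] := sg y; have [x <-] := IH z; exists x.
have e1 x : e x = x by have [y <-] := sk k x; exact: ek.
by move=> x y h; rewrite -[x]e1 -[y]e1 !er h.
Qed.

End Endomorphisms.

Section Schur.
Variables (K : closedFieldType) (V : voa_data K) (W : mod_data V).
Hypotheses (lW : linear_modes W) (fW : fin_dim (W := W -> W) [set f | is_hom f]).
Hypothesis sW : simple_module W.
Variables (g : W -> W) (hg : is_hom g).

(** A polynomial that annihilates [g] splits into linear factors. If [g] were not a scalar, each g -
    r would be injective, its kernel being a proper submodule of a simple module, and removing the
    factors one by one would make every vector 0. *)
Lemma schur : exists a : K, forall x, g x = a *: x.
Proof.
have [n [c [[i0 ci0] hc]]] := annihilator fW hg.
(* Evaluation of a polynomial at [g] with an explicit number [N] of terms, so that removing a linear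
   factor lowers [N] by exactly one. *)
pose act (N : nat) (p : {poly K}) x := \sum_(i < N) p`_i *: iter i g x.
pose p := \poly_(i < n) (if insub i is Some j then c j else 0).
have p0 : p != 0.
  apply/eqP => /(congr1 (fun q : {poly K} => q`_i0)); rewrite coef_poly ltn_ord valK coef0.
  by move/eqP; rewrite (negbTE ci0).
have actp x : act n p x = 0.
  rewrite -[RHS](hc x); apply: eq_bigr => i _.
  by rewrite coef_poly ltn_ord valK.
have actR (N : nat) (q : {poly K}) r x : (size q <= N)%N ->
    act N.+1 (q * ('X - r%:P)) x = act N q (g x - r *: x).
  move=> sq; rewrite /act mulrBr.
  under eq_bigr do rewrite coefB coefMX coefMC scalerBl.
  rewrite sumrB big_ord_recl /= scale0r add0r [X in _ - X]big_ord_recr /=.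
  rewrite (nth_default _ sq) mul0r scale0r addr0 -sumrB; apply: eq_bigr => i _.
  have hi : is_hom (iter i g) by exact: hom_iter.
  by rewrite add0n -iterS iterSr (homB hi) (homZ _ hi) scalerBr scalerA.
apply: contrapT => no.
have inj r x : g x - r *: x = 0 -> x = 0.
  move=> h; have hh : is_hom (fun x => g x + (- r) *: x).
    by apply: hom_add => //; exact: (hom_scale _ lW (@hom_id _ _ W)).
  have [e|e] := sW.2 _ (sub_ker lW hh).
    have : [set x | g x + - r *: x = 0] x by rewrite /= scaleNr.
    by rewrite e.
  exfalso; apply: no; exists r => y.
  have : [set: W] y by []; rewrite -e /= scaleNr => /eqP.
  by rewrite subr_eq0 => /eqP.
have [rs pE] := closed_field_poly_normal p.
have sz (s : seq K) : size (\prod_(z <- s) ('X - z%:P)) = (size s).+1.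
  by rewrite size_prod_XsubC.
have H (s : seq K) N x a : a != 0 -> (size s < N)%N ->
    act N (a *: \prod_(z <- s) ('X - z%:P)) x = 0 -> x = 0.
  move=> a0; elim: s N x => [|r s IH] [|N] x //= sN.
    rewrite big_nil /act big_ord_recl big1 ?addr0 /=.
      rewrite coefZ coef1 mulr1 => /eqP; rewrite scaler_eq0 (negbTE a0) /=.
      by move/eqP.
    by move=> i _; rewrite coefZ coef1 mulr0 scale0r.
  rewrite big_cons mulrC scalerAl actR; last first.
    by rewrite (leq_trans (size_scale_leq _ _)) // sz.
  by move=> /(IH N _ sN)/inj.
have [[x x0] _] := sW; move/negP: x0; apply; apply/eqP.
have a0 : lead_coef p != 0 by rewrite lead_coef_eq0.
apply: (H rs (maxn n (size rs).+1) x _ a0); first by rewrite leq_maxr.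
rewrite -pE -[RHS](actp x) /act.
rewrite -(big_mkord xpredT (fun i => p`_i *: iter i g x)).
rewrite (@big_cat_nat _ _ _ n) ?leq_maxl //= big_mkord [X in _ + X]big1_seq ?addr0 //.
move=> i /andP[_]; rewrite mem_index_iota => /andP[ni _].
by rewrite coef_poly ltnNge ni scale0r.
Qed.

End Schur.

(** * Projective objects and local modules *)

Section LocalModules.
Variables (K : fieldType) (V : voa_data K).
Implicit Types M N P W X Y : mod_data V.

(** [P] is local with simple top [M]: every proper submodule is contained in the kernel of [p]. *)
Definition local_onto P M (p : P -> M) : Prop :=
  [/\ is_surj_hom p, simple_module M &
    forall I : set P, is_submodule I -> (exists2 x, I x & p x != 0) -> I = setT].

Lemma simple_onto M X (f : X -> M) x : is_hom f -> simple_module M -> f x != 0 -> surj f.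
Proof.
move=> hf [_ sM] fx y; have [e|e] := sM _ (sub_range hf).
  have : range f (f x) by exists x.
  by rewrite e => /= /eqP; rewrite (negbTE fx).
have : [set: M] y by [].
by rewrite -e => -[z _ <-]; exists z.
Qed.

(* A quotient of [X] by a submodule that contains the images of a term of the
   composition series of [P] is a sum of copies of a simple module, and every
   homomorphism from the local module [P] to such a module kills [ker p]. *)
Lemma superfluous (T : Type) P M (p : P -> M) X (phi : T -> P -> X) (I : set X) :
  linear_modes M -> linear_modes P -> linear_modes X -> finite_length P -> local_onto p -> (forall t, is_hom (phi t)) ->
  (forall A, is_submodule A -> (forall t y, A (phi t y)) -> A = setT) ->
  is_submodule I ->
  (forall A, is_submodule A -> I `<=` A -> (forall t y, p y = 0 -> A (phi t y)) -> A = setT) ->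
  I = setT.
Proof.
move=> lM lP lX [n [S [S0 Sn sS stepS]]] [[hp surp] [[m0 m00] _] locp] hphi span sI hI.
have [y0 py0] := surp m0.
(* Induction down the composition series of [P]. At k = n the bottom term is 0, so the only
   condition left on [A] is that it contains [I]. *)
suff H k : (k <= n)%N -> forall A, is_submodule A -> I `<=` A ->
    (forall t y, S (n - k)%N y -> A (phi t y)) -> A = setT.
  apply: (H n (leqnn n)) => // t y; rewrite subnn S0 => ->.
  by rewrite (hom0 (hphi t)); exact: sub0.
elim: k => [|k IH] kn A sA IA AS.
  by apply: span => // t y; apply: AS; rewrite subn0 Sn.
have {}IH := IH (ltnW kn).
set i := (n - k.+1)%N in AS; have iE : (n - k)%N = i.+1 by rewrite /i; lia.
have i_n : (i < n)%N by rewrite /i; lia.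
rewrite {}iE in IH.
apply: hI => // t x px; apply: contrapT => nAx.
have [C [sC AC nCx Cmax]] := zorn_avoid sA nAx.
pose D := sadd C (gen_submodule (phi t x)).
have sD : is_submodule D by apply: sub_sadd => //; exact: gen_sub.
have CD : C `<=` D by apply: sadd_l; exact: gen_sub.
have gD : D (phi t x) by apply: (sadd_r sC); exact: gen_in.
have si := sS i (ltnW i_n); have si1 := sS i.+1 i_n; have [[Sii _] simp] := stepS i i_n.
(* If [phi s y] is outside [C], maximality writes [phi t x] modulo [C] as the image of some [y'] in
   the same term of the series. Simplicity of the factor recovers [y] from [y'] modulo the lower
   term, so [phi s y] is in [D] after all and the induction hypothesis applies to [D]. *)
have DT : D = setT.
  apply: IH => //; first by move=> y /IA/AC/CD.
  move=> s y Sy; have [/CD//|nCy] := pselect (C (phi s y)).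
  have sE := sub_sadd lX sC (gen_sub (phi s y)).
  have [c [z [Cc gz xE]]] : sadd C (gen_submodule (phi s y)) (phi t x).
    apply: contrapT => h; apply: nCy.
    apply: (Cmax _ sE _ h); first by apply: sadd_l; exact: gen_sub.
    by apply: (sadd_r sC); exact: gen_in.
  have [y' Sy' zE] : (phi s @` S i.+1) z.
    by apply: gz; [exact: sub_image|exists y].
  have nSy' : ~ S i y'.
    move=> h; apply: nCx; rewrite xE; apply: subD => //.
    by apply: AC; rewrite -zE; exact: AS.
  have sF := sub_sadd lP si (gen_sub y').
  have [| |e|e] := simp _ sF.
  - by apply: sadd_l; exact: gen_sub.
  - move=> _ [a [b [Sa gb ->]]]; apply: subD => //; first exact: Sii.
    exact: (gb _ si1 Sy').
  - by exfalso; apply: nSy'; rewrite -e; apply: (sadd_r si); exact: gen_in.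
  move: Sy; rewrite -e => -[a [b [Sa gb ->]]].
  rewrite (homD (hphi s)); apply: subD => //; first by apply: CD; apply: AC; exact: AS.
  apply: (gb _ (sub_preimage (hphi s) sD)) => /=; rewrite zE.
  have -> : z = phi t x - c by rewrite xE addrC addKr.
  by apply: (subB sD) => //; exact: CD.
(* Modulo [C], [phi t y0] equals [phi t x'] for some [x'] in the kernel of [p]. Then [y0 - x'] is
   not in that kernel but is sent into [C]; locality sends all of [P] into [C], against the choice
   of [C]. *)
have : D (phi t y0) by rewrite DT.
move=> [c [z [Cc gz yE]]].
have [x' px' zE] : (phi t @` [set y | p y = 0]) z.
  by apply: gz; [exact/sub_image/sub_ker|exists x].
have e := locp _ (sub_preimage (hphi t) sC).
apply: nCx; rewrite -[C _]/([set y | C (phi t y)] x) e //.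
exists (y0 - x'); first by rewrite /= (homB (hphi t)) yE zE addrK.
by rewrite (homB hp) px' subr0 py0.
Qed.

End LocalModules.

(** * Admissible categories, modules locally in them, and their projectives *)

Section Category.
Variables (K : numFieldType) (V : voa_data K) (C : mod_cat V).
Hypothesis hC : admissible_cat C.
Implicit Types M N P W X Y : mod_data V.

Lemma weak_mlin W : weak_module W -> linear_modes W.
Proof. by case=> b _ _ _ v n c x y; have [_ h] := b n; exact: h. Qed.
Lemma adm_weak W : C W -> weak_module W.
Proof. by case: hC => h _ _ _ _ /h[[]]. Qed.
Lemma adm_mlin W : C W -> linear_modes W. Proof. by move=> /adm_weak/weak_mlin. Qed.
Lemma adm_finlen W : C W -> finite_length W.
Proof. by case: hC => _ _ _ _ [_ h] /h. Qed.
Lemma adm_len W : C W -> exists n, len_le W n.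
Proof. by move=> CW; exact: finite_length_len (adm_mlin CW) (adm_finlen CW). Qed.
Lemma adm_end W : C W -> fin_dim (W := W -> W) [set f | is_hom f].
Proof. by case: hC => _ _ _ _ [h _] CW; exact: h. Qed.
Lemma adm_onto M X (f : M -> X) : C M -> is_surj_hom f -> C X.
Proof.
case: hC => _ _ h _ _ CM hf; apply: (h M M X id f CM _ hf).
by split; [exact: hom_id|exact: inj_id].
Qed.
Lemma adm_sub W (S : set W) (hS : is_submodule S) : C W -> C (sub_mod hS).
Proof.
case: hC => _ _ h _ _ CW; apply: (h W _ _ (sub_in : sub_mod hS -> W) id CW).
  exact: sub_in_inj_hom.
by split=> // x; exists x.
Qed.
Lemma adm_quo W (S : set W) (hS : is_submodule S) : C W -> C (quo_mod hS).
Proof.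
move=> CW; apply: (@adm_onto W (quo_mod hS) (quo hS) CW).
by split; [exact: quo_hom (adm_mlin CW)|exact: quo_surj].
Qed.

(** The object [N] is mapped, not embedded, into [W]: this form is visibly stable under sums, by
    biproducts, and under homomorphisms. [loc_generated] returns to embedded submodules. *)
Definition locally_in_at W (x : W) : Prop :=
  exists N (f : N -> W) (n : N), [/\ C N, is_hom f & f n = x].
Definition locally_in W : Prop := forall x : W, locally_in_at x.

Lemma loc_at0 W : linear_modes W -> locally_in_at (0 : W).
Proof.
move=> lW; case: hC => _ _ _ [[Z [CZ _]] _ _ _ _] _.
by exists Z, (fun _ => 0), 0; split=> //; exact: hom_zero.
Qed.
Lemma loc_atD W (x y : W) : linear_modes W -> locally_in_at x -> locally_in_at y -> locally_in_at (x + y).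
Proof.
move=> lW [N' [f' [n' [CN' hf' <-]]]] [N [f [n [CN hf <-]]]].
case: hC => _ _ _ [_ hb _ _ _] _.
have [S [i1 [i2 [p1 [p2 [CS [h1 h2 h3 h4] [e1 e2] [e3 e4] _]]]]]] := hb N' N CN' CN.
exists S, (fun z => f' (p1 z) + f (p2 z)), (i1 n' + i2 n); split=> //.
  exact: hom_add (hom_comp h3 hf') (hom_comp h4 hf).
by rewrite (homD h3) (homD h4) e1 e2 e3 e4 addr0 add0r.
Qed.
Lemma loc_at_sum W (I : Type) (s : seq I) (P : pred I) (f : I -> W) : linear_modes W ->
  (forall i, P i -> locally_in_at (f i)) -> locally_in_at (\sum_(i <- s | P i) f i).
Proof.
move=> lW h; elim/big_ind: _ => //; first exact: loc_at0.
by move=> x y; exact: loc_atD.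
Qed.

(** The submodule generated by [x] is a quotient of its preimage in [N], hence a subquotient of an
    object of [C]. *)
Lemma loc_generated W (x : W) : locally_in_at x -> generated_in C x.
Proof.
move=> [N [f [n [CN hf fn]]]].
have sG := gen_sub x; have sF := sub_preimage hf sG.
exists (sub_mod sG), sub_in; split; last 2 first.
- exact: sub_in_inj_hom.
- apply/seteqP; split=> [_ [y _ <-]|y gy]; first exact: sub_inP.
  by have [z <-] := sub_surj sG y gy; exists z.
have hq := hom_comp (sub_in_hom sF) hf.
have fS (y : sub_mod sF) : gen_submodule x ((f \o sub_in) y) by exact: (sub_inP y).
apply: (adm_onto (f := corestrict sG fS) (adm_sub sF CN)); split.
  exact: corestrict_hom.
move=> y; have [z _ zE] : range f (sub_in y).
  by apply: (sub_inP y); [exact: (sub_range hf)|exists n].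
have Fz : [set z | gen_submodule x (f z)] z by rewrite /= zE; exact: sub_inP.
have [z' z'E] := sub_surj sF z Fz; exists z'; apply: sub_in_inj.
by rewrite corestrictK /= z'E zE.
Qed.

Lemma generated_loc W : (forall x : W, generated_in C x) -> locally_in W.
Proof.
move=> h x; have [N [i [CN [hi _] ri]]] := h x.
have : range i x by rewrite ri; exact: gen_in.
by move=> [n _ nx]; exists N, i, n.
Qed.

(** One point with many maps, for evaluating a homomorphism at several generators at once;
    [loc_common_map] is the dual version with one map and many points. *)
Lemma loc_common_point W (s : seq W) : locally_in W -> exists N (n : N), C N /\
  forall x, x \in s -> exists2 f : N -> W, is_hom f & f n = x.
Proof.
move=> lW; elim: s => [|x s [N [n [CN hN]]]].
  by case: hC => _ _ _ [[Z [CZ _]] _ _ _ _] _; exists Z, 0.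
have [N' [f [n' [CN' hf fn]]]] := lW x.
case: hC => _ _ _ [_ hb _ _ _] _.
have [S [i1 [i2 [p1 [p2 [CS [h1 h2 h3 h4] [e1 e2] [e3 e4] _]]]]]] := hb N' N CN' CN.
exists S, (i1 n' + i2 n); split=> // y; rewrite inE => /orP[/eqP->|/hN[g hg gn]].
  exists (f \o p1); first exact: hom_comp.
  by rewrite /= (homD h3) e1 e3 addr0.
exists (g \o p2); first exact: hom_comp.
by rewrite /= (homD h4) e2 e4 add0r.
Qed.

Lemma loc_common_map W (s : seq W) : linear_modes W -> locally_in W -> exists N (f : N -> W),
  [/\ C N, is_hom f & forall x, x \in s -> exists n, f n = x].
Proof.
move=> lW hW; elim: s => [|x s [N [f [CN hf hN]]]].
  by have [N [f [n [CN hf _]]]] := hW 0; exists N, f.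
have [N' [f' [n' [CN' hf' fn]]]] := hW x.
case: hC => _ _ _ [_ hb _ _ _] _.
have [S [i1 [i2 [p1 [p2 [CS [h1 h2 h3 h4] [e1 e2] [e3 e4] _]]]]]] := hb N' N CN' CN.
exists S, (fun z => f' (p1 z) + f (p2 z)); split=> //.
  exact: hom_add (hom_comp h3 hf') (hom_comp h4 hf).
move=> y; rewrite inE => /orP[/eqP->|/hN[n <-]].
  by exists (i1 n'); rewrite e1 e4 (hom0 hf) addr0.
by exists (i2 n); rewrite e2 e3 (hom0 hf') add0r.
Qed.

Lemma adm_fg P : C P -> exists s : seq P,
  forall A : set P, is_submodule A -> {in s, forall x, A x} -> A = setT.
Proof. by move=> /adm_len[n]; exact: len_fg. Qed.

(** Preimages of the images of finitely many generators of [P] come from one map N -> X with [N] in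
    [C]. So [f] lands in the image of [N] in [Y], a quotient of [N], and the lift is made inside
    [C]. *)
Lemma projective_lift P X Y (g : X -> Y) (f : P -> Y) : projective_in C P ->
  linear_modes X -> linear_modes Y -> locally_in X -> is_surj_hom g -> is_hom f ->
  exists2 f' : P -> X, is_hom f' & forall x, g (f' x) = f x.
Proof.
move=> [CP projP] lX lY hX [hg sg] hf.
have [s hs] := adm_fg CP.
have [t ht] := choice (fun x : P => sg (f x)).
have [N [h [CN hh hN]]] := loc_common_map [seq t x | x <- s] lX hX.
have hgh := hom_comp hh hg; have sR := sub_range hgh.
have fR : [set x | range (g \o h) (f x)] = setT.
  apply: hs; first exact: (sub_preimage hf sR).
  by move=> x xs; have [n nE] := hN _ (map_f t xs); exists n; rewrite //= nE ht.
have fS x : range (g \o h) (f x).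
  by rewrite -[range _ _]/([set x | range (g \o h) (f x)] x) fR.
have gS n : range (g \o h) ((g \o h) n) by exists n.
have sgh : is_surj_hom (corestrict sR gS).
  split; first exact: corestrict_hom.
  move=> y; have [n _ nE] := sub_inP y; exists n; apply: sub_in_inj.
  by rewrite corestrictK.
have CR := adm_onto CN sgh.
have [f' hf' e] := projP _ _ _ _ CN CR sgh (corestrict_hom sR hf fS).
exists (h \o f'); first exact: hom_comp.
by move=> x; have := congr1 (fun k => sub_in (k x)) e.
Qed.

Lemma projective_retract P N (i : N -> P) (r : P -> N) : projective_in C P -> C N ->
  is_hom i -> is_hom r -> (forall x, r (i x) = x) -> projective_in C N.
Proof.
move=> [CP projP] CN hi hr ri; split=> // X Y g f CX CY hg hf.
have [f' hf' e] := projP _ _ _ _ CX CY hg (hom_comp hr hf).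
exists (f' \o i); first exact: hom_comp.
by apply/funext => x; have := congr1 (fun k => k (i x)) e; rewrite /= ri.
Qed.

Section Idempotent.
Variables (P : mod_data V) (e : P -> P).
Hypotheses (he : is_hom e) (ee : forall x, e (e x) = e x) (pP : projective_in C P).
Lemma projective_range : projective_in C (sub_mod (sub_range he)).
Proof.
have fS x : range e (e x) by exists x.
apply: (@projective_retract P (sub_mod (sub_range he)) sub_in
  (corestrict (sub_range he) fS) pP) => //.
- by apply: adm_sub; case: pP.
- exact: corestrict_hom.
move=> x; apply: sub_in_inj; rewrite corestrictK.
by have [y _ <-] := sub_inP x.
Qed.
End Idempotent.

(* Lifting [p] through its restriction to [I] gives an endomorphism of [P] with
   image in [I] over [M], to which Fitting's lemma applies. *)
Lemma projective_idempotent P M (p : P -> M) (I : set P) x :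
  projective_in C P -> C M -> simple_module M -> is_surj_hom p -> is_submodule I ->
  I x -> p x != 0 -> exists e : P -> P,
    [/\ is_hom e, forall y, e (e y) = e y, forall y, I (e y) & surj (p \o e)].
Proof.
move=> [CP projP] CM sM [hp sp] sI Ix px.
have hpi := hom_comp (sub_in_hom sI) hp.
have [x' x'E] := sub_surj sI x Ix.
have si : surj (p \o (sub_in : sub_mod sI -> P)).
  by apply: (simple_onto (x := x') hpi sM); rewrite /= x'E.
have [g0 hg0 g0E] := projP _ _ _ _ (adm_sub sI CP) CM (conj hpi si) hp.
pose g := sub_in \o g0; have hg : is_hom g := hom_comp hg0 (sub_in_hom sI).
have pg y : p (g y) = p y by exact: (congr1 (fun k => k y) g0E).
have pgk k y : p (iter k g y) = p y by elim: k => //= k <-; rewrite pg.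
have [e [r [k [[he hr] ee eg er ek]]]] := fitting (adm_mlin CP) (adm_end CP) hg.
exists e; split=> // [y|m]; first by rewrite eg; exact: sub_inP.
by have [y <-] := sp m; exists (iter k g y); rewrite /= ek pgk.
Qed.

(** The idempotent [e] with image in [I] gives a projective summand still mapping onto [M], and the
    cover property maps this summand onto [P]. Composed with [e] it is a surjective endomorphism,
    hence injective, so [e] is the identity and [I] is everything. *)
Lemma cover_local P M (p : P -> M) : simple_module M -> projective_cover C p -> local_onto p.
Proof.
move=> sM [CM pP hp cov]; split=> // I sI [x Ix px].
have [CP _] := pP; have [e [he ee eI spe]] := projective_idempotent pP CM sM hp sI Ix px.
have [|s [hs ss] _] := cov (sub_mod (sub_range he)) (p \o sub_in) (projective_range he ee pP).
  split; first exact: hom_comp (sub_in_hom _) hp.1.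
  move=> m; have [y <-] := spe m; have ey : range e (e y) by exists y.
  by have [z zE] := sub_surj (sub_range he) _ ey; exists z; rewrite /= zE.
have fS y : range e (e y) by exists y.
have hsc := hom_comp (corestrict_hom (sub_range he) he fS) hs.
have sc : surj (s \o corestrict (sub_range he) fS).
  move=> y; have [z <-] := ss y; have [w _ wE] := sub_inP z.
  by exists w; rewrite /=; congr s; apply: sub_in_inj; rewrite corestrictK.
have inj := surj_endo_inj (adm_mlin CP) (adm_end CP) hsc sc.
apply/seteqP; split=> // y _; rewrite (_ : y = e y) //.
by apply: inj => /=; congr s; apply: sub_in_inj; rewrite !corestrictK ee.
Qed.

Definition local_projective P : Prop :=
  projective_in C P /\ exists M (p : P -> M), C M /\ local_onto p.

(** A nonzero projective that is not local over its chosen simple quotient is split by an idempotent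
    into two strictly shorter projectives. Testing against a submodule [A] records the outcome of
    this induction on length without naming the summands. *)
Lemma projective_local_span n P X (phi : P -> X) (A : set X) : linear_modes X ->
  is_submodule A ->
  (forall P' (f : P' -> X) y, local_projective P' -> is_hom f -> A (f y)) ->
  projective_in C P -> len_le P n -> is_hom phi -> forall y, A (phi y).
Proof.
move=> lX sA hA; elim: n P phi => [|n IH] P phi pP lenP hphi y.
all: have [CP projP] := pP; have lP := adm_mlin CP; have fP := adm_end CP.
all: have [y0|/eqP y0] := pselect (y = 0);
     first by rewrite y0 (hom0 hphi); exact: sub0.
  have [l hl] := lenP; rewrite leqn0 => /eqP l0; exfalso.
  have := hl [set 0] setT (sub_set0 lP) (@sub_setT _ _ P) (@subsetT _ _).
  rewrite l0 ltn0 => h; suff : false by []; apply: h => e.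
  have /eqP : [set (0 : P)] y by rewrite e.
  by rewrite (negbTE y0).
have [B sB [nB maxB]] := maximal_sub lenP (ex_intro _ y y0) lP.
have sM := simple_quo sB lP nB maxB.
have hq := quo_hom sB lP; have CM := adm_quo sB CP.
have [loc|nloc] := pselect (local_onto (quo sB)).
  by apply: hA => //; split=> //; exists (quo_mod sB), (quo sB).
have {nloc}[I [sI [x Ix qx] nI]] : exists I : set P,
    [/\ is_submodule I, exists2 x, I x & (quo sB x : quo_mod sB) != 0 & I <> setT].
  apply: contrapT => no; apply: nloc; split=> //.
    by split=> //; exact: quo_surj.
  by move=> I sI hI; apply: contrapT => nI; apply: no; exists I.
have [e [he ee eI spe]] :=
  projective_idempotent pP CM sM (conj hq (quo_surj sB)) sI Ix qx.
pose e' z := z - e z.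
have he' : is_hom e'.
  have := hom_add lP (@hom_id _ _ P) (hom_scale (- 1) lP he).
  by rewrite (_ : (fun _ => _) = e') //; apply/funext => z; rewrite scaleN1r.
have e'e' z : e' (e' z) = e' z.
  by rewrite /e' (homB he) ee subrr subr0.
have nr : range e <> setT.
  move=> h; apply: nI; apply/seteqP; split=> // z _.
  have : range e z by rewrite h.
  by move=> [w _ <-].
have nr' : range e' <> setT.
  move=> h; have [z zx] := spe (quo sB x).
  have : range e' z by rewrite h.
  move=> [w _ wz]; move: qx; rewrite -zx /= -wz /e' (homB he) ee subrr.
  by rewrite (hom0 hq) eqxx.
have H f : is_hom f -> (forall z, f (f z) = f z) -> range f <> setT -> A (phi (f y)).
  move=> hf ff nf; have pR := projective_range hf ff pP.
  have [l hl ln] := lenP.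
  have lr : len_le (sub_mod (sub_range hf)) n.
    apply: (len_inj (sub_in_inj_hom (sub_range hf)) hl).
    rewrite -ltnS; apply: leq_trans ln; apply: hl => //.
      exact: (sub_range (sub_in_hom _)).
    move=> h; apply: nf; apply/seteqP; split=> // z _.
    have : range (sub_in : sub_mod (sub_range hf) -> P) z by rewrite h.
    by move=> [w _ <-]; exact: sub_inP.
  have fy : range f (f y) by exists y.
  have [w wE] := sub_surj (sub_range hf) _ fy.
  by have := IH _ _ pR lr (hom_comp (sub_in_hom _) hphi) w; rewrite /= wE.
rewrite -[y](subrK (e y)) (homD hphi); apply: subD => //.
  exact: (H e').
exact: (H e).
Qed.

Lemma local_span X (A : set X) : enough_projectives C -> linear_modes X -> locally_in X ->
  is_submodule A ->
  (forall P (f : P -> X) y, local_projective P -> is_hom f -> A (f y)) -> A = setT.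
Proof.
move=> enough lX hX sA hA; apply/seteqP; split=> // x _.
have [N [f [n [CN hf <-]]]] := hX x.
have [P [p [pP [hp sp]]]] := enough N CN.
have [y <-] := sp n; have [CP _] := pP; have [k lk] := adm_len CP.
exact: (projective_local_span lX sA hA pP lk (hom_comp hp hf)).
Qed.

End Category.

(** * The module of homomorphisms *)

Section TensorHom.
Variable K : numFieldType.
Variables U V : voa_data K.
Hypotheses (hU : is_vertex_algebra U) (hV : is_vertex_algebra V).

Lemma res_left_mlin (X : mod_data (tens_voa U V)) : linear_modes X -> linear_modes (res_left X).
Proof. by move=> lX u n; exact: lX. Qed.
Lemma res_right_mlin (X : mod_data (tens_voa U V)) : linear_modes X -> linear_modes (res_right X).
Proof. by move=> lX u n; exact: lX. Qed.
Lemma res_left_hom (X Y : mod_data (tens_voa U V)) (f : X -> Y) :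
  is_hom f -> is_hom (f : res_left X -> res_left Y).
Proof. by case=> lf hf; split=> // u n x; exact: hf. Qed.
Lemma res_right_hom (X Y : mod_data (tens_voa U V)) (f : X -> Y) :
  is_hom f -> is_hom (f : res_right X -> res_right Y).
Proof. by case=> lf hf; split=> // u n x; exact: hf. Qed.
Lemma res_left_sub (X : mod_data (tens_voa U V)) (S : set X) :
  is_submodule S -> is_submodule (W := res_left X) S.
Proof. by case=> h1 h2 h3; split=> // u n x; exact: h3. Qed.
Lemma res_right_sub (X : mod_data (tens_voa U V)) (S : set X) :
  is_submodule S -> is_submodule (W := res_right X) S.
Proof. by case=> h1 h2 h3; split=> // u n x; exact: h3. Qed.

Section HomModule.
Variables (P : mod_data U) (X : mod_data (tens_voa U V)).
Hypothesis wX : weak_module X.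

Let lX : linear_modes X. Proof. exact: weak_mlin. Qed.

(** A pointwise ambient action, inside which the U-homomorphisms form a submodule precisely because
    the two restricted actions on [X] commute. *)
Definition fun_mod : mod_data V := @ModData K V (P -> X)
  (fun v n f p => mod_Y (tpure (voa_vac U) v : tens_voa U V) n (f p)).

Lemma hom_set_sub : is_submodule (W := fun_mod)
  [set f : P -> X | is_hom (f : P -> res_left X)].
Proof.
have lL := res_left_mlin lX; split.
- exact: (@hom_zero _ _ P (res_left X) lL).
- by move=> a f g hf hg; exact: (hom_add lL (hom_scale a lL hf) hg).
move=> v n f [lf hf]; split=> [c x y|u m x] /=.
  by rewrite lf (lX _ _ c).
by rewrite hf /=; apply: esym; exact: lr_comm.
Qed.

Definition hom_mod : mod_data V := sub_mod hom_set_sub.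

Lemma hom_mod_hom (f : hom_mod) : is_hom (sub_in f : P -> res_left X).
Proof. exact: (sub_inP f). Qed.

Lemma fun_mod_mlin : linear_modes fun_mod.
Proof. by move=> v n c f g; apply/funext => p; exact: lX. Qed.
Lemma hom_mod_mlin : linear_modes hom_mod.
Proof. exact: sub_mlin fun_mod_mlin. Qed.

Lemma hom_mod_ext (f g : hom_mod) : (forall p, (sub_in f : P -> X) p = (sub_in g : P -> X) p) -> f = g.
Proof. by move=> h; apply: sub_in_inj; apply/funext. Qed.

Variable CV : mod_cat V.
Hypothesis hCV : admissible_cat CV.

(** A homomorphism is determined by its values on the generators [s], and those of [phi] are the
    images of one point [n0] of an object [N]. Where defined, the rule sending a point of [N] to the
    homomorphism with the corresponding values is V-linear, and its domain is a submodule of [N]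
    containing [n0]. *)
Lemma hom_mod_loc (s : seq P) :
  (forall A : set P, is_submodule A -> {in s, forall x, A x} -> A = setT) ->
  locally_in CV (res_right X) -> locally_in CV hom_mod.
Proof.
move=> hs hX phi.
have [N [n0 [CN hN]]] := @loc_common_point _ _ _ hCV (res_right X)
  [seq (sub_in phi : P -> X) p | p <- s] hX.
have lR := res_right_mlin lX; have lL := res_left_mlin lX.
have /choice[F hF] : forall p : P, exists f : N -> res_right X, is_hom f /\
   (p \in s -> f n0 = (sub_in phi : P -> X) p).
  move=> p; case: (boolP (p \in s)) => [ps|_].
    by have [f hf e] := hN _ (map_f (sub_in phi : P -> X) ps); exists f.
  by exists (fun _ => 0); split=> //; exact: (@hom_zero _ _ N (res_right X)).
pose R (n : N) (psi : hom_mod) := forall p, p \in s -> (sub_in psi : P -> X) p = F p n.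
have Runiq n psi psi' : R n psi -> R n psi' -> psi = psi'.
  move=> h h'; apply: hom_mod_ext => p.
  have hd := hom_add lL (hom_mod_hom psi) (hom_scale (- 1) lL (hom_mod_hom psi')).
  have e := hs _ (sub_ker lL hd).
  have : [set: P] p by [].
  rewrite -e /=; last first.
    by move=> y ys /=; rewrite (h y ys) (h' y ys) scaleN1r subrr.
  by rewrite scaleN1r => /eqP; rewrite subr_eq0 => /eqP.
have RZD c n n' psi psi' : R n psi -> R n' psi' -> R (c *: n + n') (c *: psi + psi').
  move=> h h' p ps; have [_ ] := hF p; have [[lF _] _] := hF p.
  by rewrite lF -(h p ps) -(h' p ps).
have RY v m n psi : R n psi -> R (mod_Y v m n) (mod_Y v m psi).
  move=> h p ps; have [[_ yF] _] := hF p.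
  by rewrite yF -(h p ps).
pose A : set N := [set n | exists psi, R n psi].
have sA : is_submodule A.
  split.
  - exists 0 => p ps; have [h0 _] := hF p; by rewrite (hom0 h0).
  - by move=> c n n' [psi h] [psi' h']; exists (c *: psi + psi'); exact: RZD.
  - by move=> v m n [psi h]; exists (mod_Y v m psi); exact: RY.
have /choice[G hG] : forall n : sub_mod sA, exists psi, R (sub_in n) psi.
  by move=> n; exact: (sub_inP n).
have R0 : R n0 phi by move=> p ps; have [_ ->] := hF p.
have An0 : A n0 by exists phi.
have [n nE] := sub_surj sA n0 An0.
exists (sub_mod sA), G, n; split; first exact: adm_sub hCV _ _ _ CN.
- split=> [c x y|v m x].
    by apply: (Runiq (sub_in (c *: x + y))) => //; exact: RZD.
  by apply: (Runiq (sub_in (mod_Y v m x))) => //; exact: RY.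
by apply: (Runiq n0) => //; rewrite -nE.
Qed.

End HomModule.

Section Adjunction.
Variables (P : mod_data U) (Q : mod_data V) (X : mod_data (tens_voa U V)).
Hypotheses (wP : weak_module P) (wQ : weak_module Q) (wX : weak_module X).

Lemma tens_hom_up (psi : Q -> hom_mod P wX) : is_hom psi ->
  exists2 th : tens_mod P Q -> X, is_hom th &
    forall p q, th (tpure p q) = (sub_in (psi q) : P -> X) p.
Proof.
move=> [lpsi ypsi].
have bf : is_bilinear (fun (p : P) (q : Q) => (sub_in (psi q) : P -> X) p).
  split=> [q|p] c x y /=; last by rewrite lpsi.
  by have [l _] := hom_mod_hom (psi q); exact: l.
exists (tlift (fun p q => (sub_in (psi q) : P -> X) p)); last first.
  by move=> p q; rewrite tlift_tpure.
have lt := tlift_linear bf.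
have lT := tens_mode_bil (weak_truncated wP) (weak_truncated wQ).
have lX := weak_mlin wX.
have wT := tens_weak hU hV wP wQ.
apply: (lr_hom hU hV wT wX lt).
  move=> u n x; elim/tens_ind: x => [|x y IH IH'|p q].
  - by rewrite (bil0r (lT n)) !(linear0P lt) mode0r.
  - by rewrite (bilDr (lT n)) !(linearDP lt) IH IH' (linearDP (lX _ _)).
  rewrite /= tens_mode_left // !tlift_tpure //.
  by have [_ h] := hom_mod_hom (psi q); exact: h.
move=> v n x; elim/tens_ind: x => [|x y IH IH'|p q].
- by rewrite (bil0r (lT n)) !(linear0P lt) mode0r.
- by rewrite (bilDr (lT n)) !(linearDP lt) IH IH' (linearDP (lX _ _)).
by rewrite /= tens_mode_right // !tlift_tpure // ypsi.
Qed.

Lemma tens_hom_down (f : tens_mod P Q -> X) : is_hom f ->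
  exists2 psi : Q -> hom_mod P wX, is_hom psi &
    forall p q, (sub_in (psi q) : P -> X) p = f (tpure p q).
Proof.
move=> [lf yf].
have h q : is_hom ((fun p => f (tpure p q)) : P -> res_left X).
  split=> [c x y|u n x].
    by rewrite tpureDl tpureZl lf.
  by rewrite /= -yf /= tens_mode_left.
exists (fun q => sub_mk (hom_set_sub P wX) (h q)) => //.
split=> [c x y|v n x]; apply: hom_mod_ext => p /=.
  by rewrite tpureDr tpureZr lf.
by rewrite -yf /= tens_mode_right.
Qed.

End Adjunction.

Lemma weak_res_left_pure (M : mod_data U) (W : mod_data V) (w : W) :
  weak_module M -> weak_module W ->
  is_hom ((fun m => tpure m w) : M -> res_left (tens_mod M W)).
Proof.
move=> wM wW; split=> [c x y|u n x]; first by rewrite tpureDl tpureZl.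
by rewrite /= tens_mode_left.
Qed.
Lemma weak_res_right_pure (M : mod_data U) (W : mod_data V) (m : M) :
  weak_module M -> weak_module W ->
  is_hom ((fun w => tpure m w) : W -> res_right (tens_mod M W)).
Proof.
move=> wM wW; split=> [c x y|u n x]; first by rewrite tpureDr tpureZr.
by rewrite /= tens_mode_right.
Qed.

Section TensMap.
Variables (M M' : mod_data U) (W W' : mod_data V) (f : M -> M') (g : W -> W').
Hypotheses (hf : is_hom f) (hg : is_hom g).

Lemma tens_map_bil : is_bilinear (fun m w => tpure (f m) (g w)).
Proof.
have [lf _] := hf; have [lg _] := hg.
by split=> [w|m] c x y /=; rewrite ?lf ?lg ?tpureDl ?tpureZl ?tpureDr ?tpureZr.
Qed.
Lemma tens_map_tpure m w : tens_map f g (tpure m w) = tpure (f m) (g w).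
Proof. by rewrite /tens_map tlift_tpure //; exact: tens_map_bil. Qed.
Lemma tens_map_linear : linear (tens_map f g).
Proof. exact: tlift_linear tens_map_bil. Qed.

Lemma tens_map_surj : surj f -> surj g -> surj (tens_map f g).
Proof.
move=> sf sg y; have l := tens_map_linear; elim/tens_ind: y => [|x y [x' <-] [y' <-]|m w].
- by exists 0; exact: linear0P.
- by exists (x' + y'); rewrite (linearDP l).
have [m' <-] := sf m; have [w' <-] := sg w.
by exists (tpure m' w'); rewrite tens_map_tpure.
Qed.

Hypotheses (wM : weak_module M) (wM' : weak_module M') (wW : weak_module W)
  (wW' : weak_module W').
Lemma tens_map_hom : is_hom (tens_map f g).
Proof.
have l := tens_map_linear.
have wT := tens_weak hU hV wM wW; have wT' := tens_weak hU hV wM' wW'.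
have lT := weak_mlin wT; have lT' := weak_mlin wT'.
apply: (lr_hom hU hV wT wT' l).
  move=> u n x; elim/tens_ind: x => [|x y IH IH'|p q].
  - by rewrite (mode0r _ _ lT) !(linear0P l) mode0r.
  - by rewrite (linearDP (lT _ _)) !(linearDP l) IH IH' (linearDP (lT' _ _)).
  rewrite /= tens_mode_left // !tens_map_tpure tens_mode_left //.
  by have [_ ->] := hf.
move=> v n x; elim/tens_ind: x => [|x y IH IH'|p q].
- by rewrite (mode0r _ _ lT) !(linear0P l) mode0r.
- by rewrite (linearDP (lT _ _)) !(linearDP l) IH IH' (linearDP (lT' _ _)).
rewrite /= tens_mode_right // !tens_map_tpure tens_mode_right //.
by have [_ ->] := hg.
Qed.
End TensMap.

(** Right exactness of the tensor product. Set-theoretic sections of [p] and [q] induce a bilinear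
    map to the quotient by [A], since two lifts differ by elements of [A]; its lift composed with
    [p ⊗ q] is the quotient map. *)
Lemma tens_ker (M M' : mod_data U) (W W' : mod_data V) (p : M -> M') (q : W -> W')
  (A : set (tens M W)) : is_surj_hom p -> is_surj_hom q -> subspace A ->
  (forall m w, p m = 0 -> A (tpure m w)) -> (forall m w, q w = 0 -> A (tpure m w)) ->
  forall x, tens_map p q x = 0 -> A x.
Proof.
move=> [hp sp] [hq sq] /(triv_sub U) sA Ap Aq x pqx.
have lQ := quo_linear sA; pose Z := quo_mod sA.
have [s hs] := choice sp; have [t ht] := choice sq.
have sE m m' w w' : p m = p m' -> q w = q w' ->
    quo sA (tpure m w) = quo sA (tpure m' w').
  move=> e e'; apply/eqP; rewrite -subr_eq0 -(linearBP lQ); apply/eqP/(quo_eq0 sA).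
  have -> : tpure m w - tpure m' w' = tpure (m - m') w + tpure m' (w - w').
    by rewrite tpureDl tpureDr -!scaleN1r tpureZl tpureZr addrA subrK.
  apply: (subD sA); first by apply: Ap; rewrite (homB hp) e subrr.
  by apply: Aq; rewrite (homB hq) e' subrr.
have bb : is_bilinear (fun m w => quo sA (tpure (s m) (t w)) : Z).
  have [[lp _] [lq _]] := (hp, hq).
  split=> [w c m m'|m c w w'] /=; rewrite -lQ.
    by rewrite -tpureZl -tpureDl; apply: sE; rewrite ?lp ?hs.
  by rewrite -tpureZr -tpureDr; apply: sE; rewrite ?lq ?ht.
have lt := tlift_linear bb; have lm := tens_map_linear hp hq.
have E y : tlift (fun m w => quo sA (tpure (s m) (t w)) : Z) (tens_map p q y) = quo sA y.
  elim/tens_ind: y => [|y z IH IH'|m w].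
  - by rewrite (linear0P lm) (linear0P lt) (linear0P lQ).
  - by rewrite (linearDP lm) (linearDP lt) IH IH' (linearDP lQ).
  by rewrite (tens_map_tpure hp hq) tlift_tpure //; apply: sE; rewrite ?hs ?ht.
by have := E x; rewrite pqx (linear0P lt) => /esym/(quo_eq0 sA).
Qed.

End TensorHom.

(** * Tensor products of simple and local modules *)

Section SimpleInduction.
Variables (K : numFieldType) (V : voa_data K) (C : mod_cat V).
Hypothesis hC : admissible_cat C.

Lemma simple_full (M : mod_data V) (S : set M) x : simple_module M ->
  is_submodule S -> S x -> x != 0 -> S = setT.
Proof.
move=> [_ sM] sS Sx x0; have [e|//] := sM S sS.
by move: Sx; rewrite e => /= /eqP; rewrite (negbTE x0).
Qed.

(** Dévissage along a composition series. The clause on surjections serves to pass from the last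
    term of the series, a copy of [W], to [W] itself. *)
Lemma simple_ind (Phi : mod_data V -> Prop) :
  (forall Z, C Z -> (forall x : Z, x = 0) -> Phi Z) ->
  (forall (M X : mod_data V) (f : M -> X), C M -> C X -> is_surj_hom f -> Phi M -> Phi X) ->
  (forall (M X N : mod_data V) (i : M -> X) (q : X -> N), C M -> C X -> C N -> is_hom i ->
     is_surj_hom q -> (forall x, q x = 0 -> exists y, x = i y) ->
     simple_module N -> Phi M -> Phi X) ->
  forall W, C W -> Phi W.
Proof.
move=> Phi0 PhiS PhiE W CW; have lW := adm_mlin hC CW.
have [n [S [S0 Sn sS stepS]]] := adm_finlen hC CW.
have H k (kn : (k <= n)%N) : Phi (sub_mod (sS k kn)).
  elim: k kn => [|k IH] kn.
    apply: Phi0; first exact: adm_sub.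
    have S0' x : S 0%N x -> x = 0 by rewrite S0.
    by move=> x; apply: sub_in_inj; exact: S0' (sub_inP x).
  have [lt simp] := stepS k kn.
  have sk := sS k (ltnW kn); have sk1 := sS k.+1 kn.
  have iS x : S k x -> S k.+1 x by have [h _] := lt; exact: h.
  have iS' (x : sub_mod (sS k (ltnW kn))) : S k.+1 (sub_in x) by apply: iS; exact: sub_inP.
  pose i := corestrict (sS k.+1 kn) iS'.
  have sN := simple_interval (sS k (ltnW kn)) (sS k.+1 kn) lW lt simp.
  set sA := sub_preimage _ _ in sN.
  apply: (@PhiE _ _ _ i (quo sA) _ _ _ _ _ _ sN (IH (ltnW kn))).
  - exact: adm_sub.
  - exact: adm_sub.
  - by apply: adm_quo => //; exact: adm_sub.
  - exact: corestrict_hom.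
  - by split; [apply: quo_hom; exact: sub_mlin|exact: quo_surj].
  move=> x /(quo_eq0 sA) /= hx; have [y yE] := sub_surj (sS k (ltnW kn)) _ hx.
  by exists y; apply: sub_in_inj; rewrite -yE.
have {H} := H n (leqnn n); apply: (PhiS _ _ (sub_in : sub_mod (sS n (leqnn n)) -> W)).
- exact: adm_sub.
- by [].
split => // x; have Sx : S n x by rewrite Sn.
exact: (sub_surj (sS n (leqnn n)) x Sx).
Qed.

Lemma len_surj (M X : mod_data V) (f : M -> X) n : is_surj_hom f -> len_le M n -> len_le X n.
Proof.
move=> [hf sf] [l hl ln]; exists (fun A => l [set x | A (f x)]) => // A B sA sB AB ne.
apply: hl; [exact: (sub_preimage hf sA)|exact: (sub_preimage hf sB)|by move=> x; exact: AB|].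
move=> e; apply: ne; apply/seteqP; split=> // y; have [x <-] := sf y => Bx.
by have : [set x | B (f x)] x by []; rewrite -e.
Qed.

End SimpleInduction.

Section SimpleTensor.
Variable K : numClosedFieldType.
Variables U V : voa_data K.
Hypotheses (hU : is_vertex_algebra U) (hV : is_vertex_algebra V).

Section Contract.
Variables (M : mod_data U) (W : mod_data V).
Hypotheses (wM : weak_module M) (wW : weak_module W).
Variable l : W -> K.
Hypothesis hl : forall c x y, l (c *: x + y) = c * l x + l y.

Definition contract : tens_mod M W -> M := tlift (fun (m : M) (w : W) => l w *: m).

Lemma contract_bil : is_bilinear (fun (m : M) (w : W) => l w *: m).
Proof.
split=> [w|m] c x y /=; first by rewrite scalerDr !scalerA mulrC.
by rewrite hl scalerDl scalerA.
Qed.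
Lemma contract_tpure m w : contract (tpure m w) = l w *: m.
Proof. by rewrite /contract tlift_tpure //; exact: contract_bil. Qed.
Lemma contract_hom : is_hom (contract : res_left (tens_mod M W) -> M).
Proof.
have lt : linear contract := tlift_linear contract_bil.
have lT := weak_mlin (tens_weak hU hV wM wW); have lM := weak_mlin wM.
split=> // u n x.
rewrite -[mod_Y u n x]/(mod_Y (tpure u (voa_vac V) : tens_voa U V) n (x : tens_mod M W)).
elim/tens_ind: x => [|x y IH IH'|m w].
- by rewrite (mode0r _ _ lT) !(linear0P lt) mode0r.
- by rewrite (linearDP (lT _ _)) !(linearDP lt) IH IH' (linearDP (lM _ _)).
by rewrite /= tens_mode_left // !contract_tpure (linearZP (lM _ _)).
Qed.
End Contract.

Variables (M : mod_data U) (W : mod_data V).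
Hypotheses (wM : weak_module M) (wW : weak_module W).
Hypotheses (sM : simple_module M) (sW : simple_module W).
Hypothesis fM : fin_dim (W := M -> M) [set f | is_hom f].

Let wT := tens_weak hU hV wM wW.
Let lT := weak_mlin wT.

(* A nonzero element of [T] of minimal tensor rank is a pure tensor: by
   minimality the coefficients of the other terms are determined by that of the
   first one through endomorphisms of [M], which are scalars by Schur's lemma. *)
Lemma pure_in_submodule (T : set (tens_mod M W)) : is_submodule T -> T <> [set 0] ->
  exists m w, T (tpure m w) /\ tpure m w != 0.
Proof.
move=> sT nT.
pose Q r := `[< exists (x : tens_mod M W) (b : 'I_r -> M) (d : 'I_r -> W),
  [/\ T x, x != 0 & x = \sum_(i < r) tpure (b i) (d i)] >].
have Qex : exists r, Q r.
  have [x [Tx x0]] : exists x, T x /\ x != 0.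
    apply: contrapT => no; apply: nT; apply/seteqP; split=> [x Tx|x ->]; last exact: sub0.
    by apply/eqP; apply: contrapT => /negP x0; apply: no; exists x.
  have [s sE] := tens_sum x; exists (size s); apply/asboolP.
  exists x, (fun i => (tnth (in_tuple s) i).1), (fun i => (tnth (in_tuple s) i).2).
  by split=> //; rewrite [LHS]sE (big_tnth _ _ s).
case: (ex_minnP Qex) => -[|r].
  move=> /asboolP[x [b [d [_ x0 xE]]]] _.
  by move: x0; rewrite xE big_ord0 eqxx.
move=> /asboolP[x [b [d [Tx x0 xE]]]] rmin.
have small (y : tens_mod M W) (b' : 'I_r -> M) (d' : 'I_r -> W) : T y ->
    y = \sum_(i < r) tpure (b' i) (d' i) -> y = 0.
  move=> Ty yE; apply/eqP; apply: contraT => y0.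
  by have := rmin r; rewrite ltnn => /(_ _)->//; apply/asboolP; exists y, b', d'.
(* Functionals dual to the [d i]. They exist because minimality makes the [d i] independent: a
   relation would rewrite [x] with r terms. *)
have /choice[l hl] : forall i : 'I_r.+1, exists l : W -> K,
    [/\ forall c x y, l (c *: x + y) = c * l x + l y,
      forall j, j != i -> l (d j) = 0 & l (d i) = 1].
  move=> i.
  pose A : set W := [set y | exists c : 'I_r -> K, y = \sum_(k < r) c k *: d (lift i k)].
  have sA : subspace A.
    split; first by exists (fun _ => 0); rewrite big1 // => k _; rewrite scale0r.
    move=> a _ _ [c ->] [c' ->]; exists (fun k => a * c k + c' k).
    rewrite scaler_sumr -big_split; apply: eq_bigr => k _ /=.
    by rewrite scalerDl scalerA.
  have nA : ~ A (d i).
    move=> [c ce]; move/negP: x0; apply; apply/eqP.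
    apply: (small x (fun k => b (lift i k) + c k *: b i) (fun k => d (lift i k)) Tx).
    rewrite xE (bigD1_ord i) //= ce (bil_sumr (@tpure_bilinear K M W)) -big_split.
    by apply: eq_bigr => k _ /=; rewrite tpureDl tpureZr tpureZl addrC.
  have [l [l1 l2 l3]] := functional V sA nA; exists l; split=> // j ji; apply: l2.
  case: (unliftP i j) ji => [k ->|->]; last by rewrite eqxx.
  exists (fun k' => (k' == k)%:R) => //; rewrite (bigD1 k) //= eqxx scale1r big1 ?addr0 //.
  by move=> k' /negbTE ->; rewrite scale0r.
pose f i : res_left (tens_mod M W) -> M := contract (l i).
have hf i : is_hom (f i) by apply: contract_hom => //; case: (hl i).
have sG := @gen_sub _ _ (res_left (tens_mod M W)) x.
pose N := sub_mod sG.
have GT (y : N) : T (sub_in y).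
  by apply: (sub_inP y) => //; exact: res_left_sub.
(* The elements recovered from their coefficients along the [d i]. They form a U-submodule, so
   everything generated by [x] over [U] has at most r + 1 terms along the same vectors. *)
pose Rep : set (res_left (tens_mod M W)) := [set y | y = \sum_(i < r.+1) tpure (f i y) (d i)].
have sRep : is_submodule Rep.
  split.
  - by rewrite /Rep /= big1 // => i _; rewrite (hom0 (hf i)) tpure0l.
  - move=> c y z hy hz; rewrite /Rep /= [in LHS]hy [in LHS]hz scaler_sumr -big_split.
    by apply: eq_bigr => i _ /=; have [lf _] := hf i; rewrite lf tpureDl tpureZl.
  - move=> u n y hy.
    have e := linear_sumP (index_enum 'I_r.+1) xpredT (fun i => tpure (f i y) (d i))
      (lT (tpure u (voa_vac V)) n).
    apply: etrans (etrans (congr1 (mod_Y u n) hy) e) _.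
    apply: eq_bigr => i _; rewrite /= tens_mode_left //.
    by have [_ <-] := hf i.
have Rx : Rep x.
  rewrite /Rep /= {1}xE; apply: eq_bigr => i _; congr tpure.
  have [_ l2 l3] := hl i.
  have lf := hom_lin (hf i); rewrite xE (linear_sumP _ _ _ lf) (bigD1 i) //= big1.
    by rewrite addr0 /f contract_tpure ?l3 ?scale1r //; case: (hl i).
  by move=> j ji; rewrite /f contract_tpure ?l2 ?scale0r //; case: (hl i).
have RN (y : N) : (sub_in y : tens_mod M W) = \sum_(i < r.+1) tpure (f i (sub_in y)) (d i).
  exact: (sub_inP y _ sRep Rx).
have inj0 (y : N) : f ord0 (sub_in y) = 0 -> (sub_in y : tens_mod M W) = 0.
  move=> e; apply: (small _ (fun k => f (lift ord0 k) (sub_in y)) (fun k => d (lift ord0 k)) (GT y)).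
  by rewrite [LHS]RN big_ord_recl e tpure0l add0r.
have [y0 y0E] := sub_surj sG x (@gen_in _ _ (res_left (tens_mod M W)) x).
have hq : is_hom ((fun y => f ord0 (sub_in y)) : N -> M).
  exact: hom_comp (sub_in_hom sG) (hf ord0).
have fx0 : f ord0 (sub_in y0) != 0.
  by apply: contra_neq x0 => /inj0; rewrite y0E.
have sq := simple_onto hq sM fx0.
(* A vanishing first coefficient leaves r terms and forces 0 by minimality, so the i-th coefficient
   factors through the first. The first coefficient map is onto [M], and the factor is an
   endomorphism of [M]. *)
have /choice[a ha] : forall i, exists a : K, forall y : N,
    f i (sub_in y) = a *: f ord0 (sub_in y).
  move=> i; have [|g hg gE] := hom_factor (conj hq sq) (hom_comp (sub_in_hom sG) (hf i)).
    by move=> y /inj0 /= ->; rewrite (hom0 (hf i)).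
  have [a ha] := schur (weak_mlin wM) fM sM hg.
  by exists a => y; rewrite -ha gE.
have xP : x = tpure (f ord0 (sub_in y0)) (\sum_(i < r.+1) a i *: d i).
  rewrite -{1}y0E [LHS]RN (bil_sumr (@tpure_bilinear K M W)); apply: eq_bigr => i _.
  by rewrite ha tpureZl tpureZr.
by exists (f ord0 (sub_in y0)), (\sum_(i < r.+1) a i *: d i); rewrite -xP.
Qed.

(** A nonzero pure tensor in a submodule spreads over all of [M] by the action of [U], and then over
    all of [W] by that of [V]. *)
Theorem simple_tens : simple_module (tens_mod M W).
Proof.
have [[m0 m00] _] := sM; have [[w0 w00] _] := sW.
split.
  have sA : subspace [set (0 : W)].
    by split=> // c x y -> ->; rewrite /= scaler0 addr0.
  have nA : ~ [set 0] w0 by move=> /eqP; rewrite (negbTE w00).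
  have [l [l1 _ l3]] := functional V sA nA.
  exists (tpure m0 w0); apply: contra_neq m00 => e.
  have := contract_tpure l1 m0 w0.
  rewrite l3 scale1r e => <-.
  exact: (linear0P (tlift_linear (contract_bil M l1))).
move=> S sS; have [->|nS] := pselect (S = [set 0]); [by left|right].
have [m [w [Smw mw0]]] := pure_in_submodule sS nS.
have m_0 : m != 0 by apply: contra_neq mw0 => ->; rewrite tpure0l.
have w_0 : w != 0 by apply: contra_neq mw0 => ->; rewrite tpure0r.
have h1 := simple_full sM (sub_preimage (weak_res_left_pure w wM wW) (res_left_sub sS)) Smw m_0.
have h m' : S (tpure m' w) by rewrite -[S _]/([set x | S (tpure x w)] m') h1.
apply/seteqP; split=> // x _; elim/tens_ind: x => [|x y|m' w'].
- exact: (sub0 sS).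
- exact: (subD sS).
have h2 := simple_full sW (sub_preimage (weak_res_right_pure m' wM wW) (res_right_sub sS)) (h m') w_0.
by rewrite -[S _]/([set x | S (tpure m' x)] w') h2.
Qed.

End SimpleTensor.

Section TensorCategory.
Variable K : numClosedFieldType.
Variables U V : voa_data K.
Hypotheses (hU : is_vertex_algebra U) (hV : is_vertex_algebra V).
Variables (CU : mod_cat U) (CV : mod_cat V).
Hypotheses (hCU : admissible_cat CU) (hCV : admissible_cat CV).

(** Dévissage in [W], then in [M] for a simple second factor, ending with [simple_tens]. *)
Lemma len_tens (M : mod_data U) (W : mod_data V) : CU M -> CV W ->
  exists n, len_le (tens_mod M W) n.
Proof.
have wt (N : mod_data U) (Z : mod_data V) : CU N -> CV Z -> weak_module (tens_mod N Z).
  by move=> CM CW; apply: tens_weak => //; [exact: adm_weak hCU _ CM|exact: adm_weak hCV _ CW].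
have wU N : CU N -> weak_module N by exact: adm_weak.
have wV N : CV N -> weak_module N by exact: adm_weak.
move=> CM; move: W; apply: (simple_ind hCV).
- move=> Z CZ Z0; exists 0%N; apply: len_zero; first exact: weak_mlin (wt _ _ CM CZ).
  by move=> x; elim/tens_ind: x => [//|x y -> ->|m w]; rewrite ?addr0 // (Z0 w) tpure0r.
- move=> N X f CN CX [hf sf] [n hn]; exists n.
  apply: (@len_surj _ _ (tens_mod M N) (tens_mod M X) (tens_map (fun m : M => m) f) n _ hn).
  split; last by apply: tens_map_surj => // x; exists x.
  by apply: tens_map_hom => //; [exact: wU|exact: wU|exact: wV|exact: wV].
move=> W' X N i q CW' CX CN hi hq ker sN [a ha].
suff [b hb] : exists b, len_le (tens_mod M N) b.
  exists (a + b)%N; apply: (len_ext (i := tens_map (fun m : M => m) i)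
    (q := tens_map (fun m : M => m) q)) => //.
  - by apply: tens_map_hom => //; [exact: wU|exact: wU|exact: wV|exact: wV].
  - by case: hq => hq _; apply: tens_map_hom => //; [exact: wU|exact: wU|exact: wV|exact: wV].
  have lr := tens_map_linear (@hom_id _ _ M) hi.
  apply: (tens_ker (@surj_hom_id _ _ M) hq).
  - split; first by exists 0; rewrite (linear0P lr).
    by move=> c _ _ [x ->] [y ->]; exists (c *: x + y); rewrite lr.
  - by move=> m w ->; exists 0; rewrite (linear0P lr) tpure0l.
  by move=> m w /ker[y ->]; exists (tpure m y); rewrite (tens_map_tpure (@hom_id _ _ M) hi).
move: M CM {ha}; apply: (simple_ind hCU).
- move=> Z CZ Z0; exists 0%N; apply: len_zero; first exact: weak_mlin (wt _ _ CZ CN).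
  by move=> x; elim/tens_ind: x => [//|x y -> ->|m w]; rewrite ?addr0 // (Z0 m) tpure0l.
- move=> M Y f CM CY [hf sf] [n hn]; exists n.
  apply: (@len_surj _ _ (tens_mod M N) (tens_mod Y N) (tens_map f (fun w : N => w)) n _ hn).
  split; last by apply: tens_map_surj => // x; exists x.
  by apply: tens_map_hom => //; [exact: wU|exact: wU|exact: wV|exact: wV].
move=> M Y S j p CM CY CS hj hp kerp sS [c hc].
exists (c + 1)%N; apply: (len_ext (i := tens_map j (fun w : N => w))
    (q := tens_map p (fun w : N => w))) => //.
- by apply: tens_map_hom => //; [exact: wU|exact: wU|exact: wV|exact: wV].
- by case: hp => hp _; apply: tens_map_hom => //; [exact: wU|exact: wU|exact: wV|exact: wV].
- have lr := tens_map_linear hj (@hom_id _ _ N).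
  apply: (tens_ker hp (@surj_hom_id _ _ N)).
  + split; first by exists 0; rewrite (linear0P lr).
    by move=> d _ _ [x ->] [y ->]; exists (d *: x + y); rewrite lr.
  + by move=> m w /kerp[y ->]; exists (tpure y w); rewrite (tens_map_tpure hj (@hom_id _ _ N)).
  by move=> m w ->; exists 0; rewrite (linear0P lr) tpure0r.
apply: len_simple; apply: simple_tens => //; [exact: wU|exact: wV|exact: adm_end hCU _ CS].
Qed.

Lemma finlen_tens (M : mod_data U) (W : mod_data V) : CU M -> CV W ->
  finite_length (tens_mod M W).
Proof.
move=> CM CW; have [n hn] := len_tens CM CW; apply: len_finite_length hn.
by apply: weak_mlin; apply: tens_weak => //; [exact: adm_weak hCU _ CM|exact: adm_weak hCV _ CW].
Qed.

Lemma local_tens (P M : mod_data U) (Q W : mod_data V) (p : P -> M) (q : Q -> W) :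
  CU P -> CU M -> CV Q -> CV W -> local_onto p -> local_onto q ->
  local_onto (tens_map p q : tens_mod P Q -> tens_mod M W).
Proof.
move=> CP CM CQ CW lp lq.
have [[hp sp] sM _] := lp; have [[hq sq] sW _] := lq.
have wP := adm_weak hCU CP; have wM := adm_weak hCU CM.
have wQ := adm_weak hCV CQ; have wW := adm_weak hCV CW.
have ht := tens_map_hom hU hV hp hq wP wM wQ wW.
have sMW := simple_tens hU hV wM wW sM sW (adm_end hCU CM).
split=> //; first by split=> //; exact: tens_map_surj.
move=> I sI [x Ix tx].
have tI := simple_full sMW (sub_image ht sI) (ex_intro2 _ _ x Ix erefl) tx.
have hidq := tens_map_hom hU hV (@hom_id _ _ P) hq wP wP wQ wW.
have hpid := tens_map_hom hU hV hp (@hom_id _ _ W) wP wM wW wW.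
have tE z : tens_map p q z = tens_map p (fun w : W => w) (tens_map (fun m : P => m) q z).
  have l1 := tens_map_linear hp hq; have l2 := tens_map_linear (@hom_id _ _ P) hq.
  have l3 := tens_map_linear hp (@hom_id _ _ W).
  elim/tens_ind: z => [|z z' IH IH'|m w].
  - by rewrite (linear0P l1) (linear0P l2) (linear0P l3).
  - by rewrite (linearDP l1) (linearDP l2) (linearDP l3) IH IH'.
  by rewrite (tens_map_tpure hp hq) (tens_map_tpure (@hom_id _ _ P) hq) (tens_map_tpure hp (@hom_id _ _ W)).
have wPW := tens_weak hU hV wP wW; have wPQ := tens_weak hU hV wP wQ.
pose I1 := tens_map (fun m : P => m) q @` I.
have sI1 : is_submodule (W := tens_mod P W) I1 by exact: sub_image.
have I1T : I1 = setT.
  apply: (@superfluous _ _ W P M p (res_left (tens_mod P W)) (fun w y => tpure y w)) lp _ _ _ _.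
  - exact: weak_mlin.
  - exact: weak_mlin.
  - by apply: res_left_mlin; exact: weak_mlin.
  - exact: adm_finlen hCU _ CP.
  - by move=> w; exact: weak_res_left_pure.
  - move=> A sA hA; apply/seteqP; split=> // z _; elim/tens_ind: z => [|z z'|y w] //.
    + exact: (sub0 sA).
    + exact: (subD sA).
  - exact: res_left_sub.
  move=> A sA IA hA; apply/seteqP; split=> // z _.
  have [y Iy yE] : (tens_map p q @` I) (tens_map p (fun w : W => w) z) by rewrite tI.
  rewrite -[z](subrK (tens_map (fun m : P => m) q y)); apply: (subD sA).
    apply: (tens_ker (conj hp sp) (@surj_hom_id _ _ W)).
    - by split=> [|c a b]; [exact: (sub0 sA)|exact: (subZD sA)].
    - by move=> m w pm; exact: hA.
    - by move=> m w ->; rewrite tpure0r; exact: (sub0 sA).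
    by rewrite (homB hpid) -yE tE subrr.
  by apply: IA; exists y.
apply: (@superfluous _ _ P Q W q (res_right (tens_mod P Q)) (fun y w => tpure y w)) lq _ _ _ _.
- exact: weak_mlin.
- exact: weak_mlin.
- by apply: res_right_mlin; exact: weak_mlin.
- exact: adm_finlen hCV _ CQ.
- by move=> y; exact: weak_res_right_pure.
- move=> A sA hA; apply/seteqP; split=> // z _; elim/tens_ind: z => [|z z'|y w] //.
  + exact: (sub0 sA).
  + exact: (subD sA).
- exact: res_right_sub.
move=> A sA IA hA; apply/seteqP; split=> // z _.
have [y Iy yE] : I1 (tens_map (fun m : P => m) q z) by rewrite I1T.
rewrite -[z](subrK y); apply: (subD sA); last exact: IA.
apply: (tens_ker (@surj_hom_id _ _ P) (conj hq sq)).
- by split=> [|c a b]; [exact: (sub0 sA)|exact: (subZD sA)].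
- by move=> m w ->; rewrite tpure0l; exact: (sub0 sA).
- by move=> m w qw; exact: hA.
by rewrite (homB hidq) -yE subrr.
Qed.

End TensorCategory.

(** * Generalized eigenspaces *)

Section LinearSpan.
Variables (K : fieldType) (W : lmodType K).

(** In this form spanning lists on [M] and [W] combine into one on the tensor product by testing one
    factor at a time. *)
Lemma fin_dimP (S : set W) : fin_dim S <-> exists s : seq W,
  forall x, S x -> forall A, subspace A -> {in s, forall y, A y} -> A x.
Proof.
split=> [[n [e he]]|[s hs]].
  exists [seq e i | i <- enum 'I_n] => x /he[c ->] A hA hs.
  apply: subspace_sum => // i _; apply: subspaceZ => //; apply: hs.
  by apply: map_f; rewrite mem_enum.
exists (size s), (fun i => tnth (in_tuple s) i) => x Sx.
apply: (hs x Sx [set y | exists c : 'I_(size s) -> K, y = \sum_i c i *: tnth (in_tuple s) i]).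
  split; first by exists (fun _ => 0); rewrite big1 // => i _; rewrite scale0r.
  move=> a _ _ [c ->] [c' ->]; exists (fun i => a * c i + c' i).
  rewrite scaler_sumr -big_split; apply: eq_bigr => i _ /=.
  by rewrite scalerDl scalerA.
move=> y /(@tnthP _ _ (in_tuple s))[i ->].
exists (fun j => (j == i)%:R); rewrite (bigD1 i) //= eqxx scale1r big1 ?addr0 //.
by move=> j /negbTE ->; rewrite scale0r.
Qed.

End LinearSpan.

Section GeneralizedEigenspaces.
Variable K : fieldType.

(** For [D] = L(0) this is [gen_wt] by unfolding. *)
Definition geig (W : lmodType K) (D : W -> W) (h : K) : set W :=
  [set w | exists k : nat, iter k (fun x => D x - h *: x) w = 0].

Section One.
Variables (W : lmodType K) (D : W -> W).
Hypothesis lD : linear D.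
Local Notation E h := (fun x => D x - h *: x).

Lemma lE h : linear (E h).
Proof.
move=> c x y; rewrite lD scalerDr scalerA mulrC -scalerA scalerBr opprD.
by rewrite addrACA.
Qed.
Lemma lEk k h : linear (iter k (E h)).
Proof. by elim: k => [|k IH] c x y //; rewrite !iterS IH; exact: lE. Qed.

Lemma geig_le k j h x : iter k (E h) x = 0 -> (k <= j)%N -> iter j (E h) x = 0.
Proof. by move=> e /subnK <-; rewrite iterD e (linear0P (lEk _ _)). Qed.

Lemma geig_sub h : subspace (geig D h).
Proof.
split; first by exists 0%N.
move=> c x y [k hx] [j hy]; exists (maxn k j).
by rewrite lEk (geig_le hx (leq_maxl _ _)) (geig_le hy (leq_maxr _ _)) scaler0 addr0.
Qed.

Lemma E_comm a h k x : iter k (E h) (E a x) = E a (iter k (E h) x).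
Proof.
elim: k => //= k ->; move: (iter k _ x) => y.
rewrite (linearBP lD) (linearZP lD) (linearBP lD) (linearZP lD) !scalerBr.
rewrite !scalerA [a * h]mulrC !opprB addrACA [RHS]addrACA.
by congr (_ + _); exact: addrC.
Qed.

Lemma geig_E a h x : geig D h x -> geig D h (E a x).
Proof. by move=> [k e]; exists k; rewrite E_comm e (linear0P (lE a)). Qed.

Lemma geig_inj a h x : a != h -> geig D h x -> E a x = 0 -> x = 0.
Proof.
move=> ah [k e] /eqP; rewrite subr_eq0 => /eqP ax.
have Ek j : iter j (E h) x = (a - h) ^+ j *: x.
  elim: j => [|j IH]; first by rewrite scale1r.
  rewrite iterS IH (linearZP lD) ax !scalerA [h * _]mulrC -scalerBl.
  by rewrite -mulrBr exprSr.
move: e; rewrite Ek => /eqP; rewrite scaler_eq0 expf_eq0 subr_eq0 (negbTE ah) andbF.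
by move/eqP.
Qed.

Lemma geig_inj_iter a h x k : a != h -> geig D h x -> iter k (E a) x = 0 -> x = 0.
Proof.
move=> ah; elim: k x => //= k IH x hx e; apply: (IH _ hx).
apply: (geig_inj ah _ e); elim: k {IH e} => //= k; exact: geig_E.
Qed.

(** A power of D - a kills the summand of eigenvalue [a] and is injective on the other generalized
    eigenspaces. *)
Lemma geig_indep (s : seq K) (f : K -> W) : uniq s -> (forall h, geig D h (f h)) ->
  \sum_(h <- s) f h = 0 -> forall h, h \in s -> f h = 0.
Proof.
elim: s f => //= a s IH f /andP[nas us] hf.
rewrite big_cons => e.
have [k ek] := hf a.
have e' : \sum_(h <- s) iter k (E a) (f h) = 0.
  have := congr1 (iter k (E a)) e.
  by rewrite (linearDP (lEk k a)) ek add0r (linear_sumP _ _ _ (lEk k a)) (linear0P (lEk k a)).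
have fs0 h : h \in s -> f h = 0.
  move=> hs; have ah : a != h by apply: contraNneq nas => ->.
  apply: (geig_inj_iter ah (hf h)).
  apply: (IH (fun h => iter k (E a) (f h)) us _ e') => // h'.
  by elim: k {ek e'} => //= j; exact: geig_E.
move=> h; rewrite inE => /orP[/eqP->|/fs0//].
by move: e; rewrite big_seq big1 ?addr0.
Qed.

(** Repeated weights and zero vectors are allowed in the list, which makes sums a mere
    concatenation; [geig_component] collects the terms of one weight. *)
Definition wspan (p : K -> Prop) (x : W) : Prop :=
  exists2 s : seq (K * W), (forall y, y \in s -> p y.1 /\ geig D y.1 y.2) &
    x = \sum_(y <- s) y.2.

Lemma wspan0 p : wspan p 0. Proof. by exists [::]; rewrite ?big_nil. Qed.
Lemma wspanD p x y : wspan p x -> wspan p y -> wspan p (x + y).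
Proof.
move=> [s hs ->] [t ht ->]; exists (s ++ t); last by rewrite big_cat.
by move=> z; rewrite mem_cat => /orP[/hs|/ht].
Qed.
Lemma wspan_geig (p : K -> Prop) h x : p h -> geig D h x -> wspan p x.
Proof.
move=> ph hx; exists [:: (h, x)]; last by rewrite big_seq1.
by move=> y; rewrite inE => /eqP ->.
Qed.
Lemma wspan_sum p (I : Type) (s : seq I) (P : pred I) (f : I -> W) :
  (forall i, P i -> wspan p (f i)) -> wspan p (\sum_(i <- s | P i) f i).
Proof. by move=> h; elim/big_ind: _ => //; [exact: wspan0|exact: wspanD]. Qed.
Lemma wspanZ p c x : wspan p x -> wspan p (c *: x).
Proof.
move=> [s hs ->]; rewrite scaler_sumr big_seq; apply: wspan_sum => y /hs[py gy].
exact: wspan_geig py (subspaceZ _ (geig_sub _) gy).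
Qed.

Lemma geig_component (s : seq (K * W)) h x :
  (forall y, y \in s -> geig D y.1 y.2) -> geig D h x ->
  x = \sum_(y <- s) y.2 -> x = \sum_(y <- s | y.1 == h) y.2.
Proof.
move=> hs hx xE.
pose t := undup (h :: [seq y.1 | y <- s]).
pose f a := \sum_(y <- s | y.1 == a) y.2 - (if a == h then x else 0).
have ut : uniq t := undup_uniq _.
have hf a : geig D a (f a).
  rewrite /f -[X in geig D a X]addr0 -addrA; apply: subspaceD; first exact: geig_sub.
    rewrite big_seq_cond; apply: subspace_sum; first exact: geig_sub.
    by move=> y /andP[/hs hy /eqP <-].
  rewrite addr0 -scaleN1r; apply: subspaceZ; first exact: geig_sub.
  by case: eqP => [->//|_]; exists 0%N.
have ht : h \in t by rewrite mem_undup mem_head.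
have e0 : \sum_(a <- t) f a = 0.
  rewrite sumrB; apply/eqP; rewrite subr_eq0; apply/eqP.
  rewrite [RHS](bigD1_seq h) //= eqxx [X in _ = _ + X]big1 ?addr0; last first.
    by move=> a /negbTE ->.
  rewrite [RHS]xE; under eq_bigr do rewrite big_mkcond.
  rewrite exchange_big /= big_seq [RHS]big_seq; apply: eq_bigr => y ys.
  have yt : y.1 \in t by rewrite mem_undup inE map_f ?orbT.
  rewrite (bigD1_seq y.1) //= eqxx big1 ?addr0 // => a.
  by rewrite eq_sym => /negbTE ->.
have := geig_indep ut hf e0 ht.
by rewrite /f eqxx => /eqP; rewrite subr_eq0 => /eqP/esym.
Qed.

Lemma wspan_weight p h x : wspan p x -> geig D h x -> x != 0 -> p h.
Proof.
move=> [s hs xE] hx x0; apply: contrapT => nph; move/negP: x0; apply; apply/eqP.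
rewrite (geig_component _ hx xE); last by move=> y /hs[].
rewrite big_seq_cond big1 // => y /andP[/hs[py _] /eqP e].
by exfalso; apply: nph; rewrite -e.
Qed.

Lemma direct_sum_geig : (forall x, wspan (fun _ => True) x) -> direct_sum_of (geig D).
Proof.
move=> hs w; have [s hw wE] := hs w.
pose f a := \sum_(y <- s | y.1 == a) y.2.
have fsup : fsupp f.
  exists [seq y.1 | y <- s] => a; apply: contraR => na.
  rewrite /f big_seq_cond big1 // => y /andP[ys /eqP e].
  by move: na; rewrite -e map_f.
have fin (g : K -> W) : fsupp g <-> finite_set [set i | g i != 0].
  split=> [[t ht]|/finite_seqP[t ht]].
    by apply: (sub_finite_set _ (finite_seq t)) => i /= /ht.
  by exists t => i gi; have : [set i | g i != 0] i by []; rewrite ht.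
exists f; split.
  split; [|exact/fin|].
    move=> a; rewrite /f big_seq_cond; apply: subspace_sum; first exact: geig_sub.
    by move=> y /andP[/hw[_ hy] /eqP <-].
  rewrite -/(fs f) (@fsE _ _ _ (undup [seq y.1 | y <- s])) ?undup_uniq //.
    under eq_bigr do rewrite /f big_mkcond.
    rewrite exchange_big /= wE big_seq [RHS]big_seq; apply: eq_bigr => y ys.
    have yt : y.1 \in undup [seq y.1 | y <- s] by rewrite mem_undup map_f.
    rewrite (bigD1_seq y.1) ?undup_uniq //= eqxx big1 ?addr0 // => a.
    by rewrite eq_sym => /negbTE ->.
  move=> a; rewrite mem_undup; apply: contraR => na.
  rewrite /f big_seq_cond big1 // => y /andP[ys /eqP e].
  by move: na; rewrite -e map_f.
move=> g [gG /fin gfin gE].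
have gsp : exists2 t, uniq t & forall i, g i != 0 -> i \in t by exact: fsupp_uniq.
have [t ut ht] := gsp.
rewrite -/(fs g) (fsE ut ht) in gE.
apply/funext => a.
have sE : w = \sum_(y <- [seq (h, g h) | h <- t]) y.2 by rewrite big_map.
have ga : g a = \sum_(h <- t | h == a) g h.
  case: (boolP (a \in t)) => hat.
    rewrite -big_filter (_ : filter _ t = [:: a]) ?big_seq1 //.
    by rewrite filter_pred1_uniq.
  rewrite big_seq_cond big1.
    by apply/eqP; apply: contraR hat => /ht.
  by move=> h /andP[hh /eqP e]; move: hat; rewrite -e hh.
have d0 : \sum_(y <- s ++ [seq (h, - g h) | h <- t]) y.2 = 0.
  by rewrite big_cat big_map /= sumrN -wE -gE subrr.
have := geig_component _ _ (esym d0).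
move=> /(_ a) c0.
have : 0 = \sum_(y <- s ++ [seq (h, - g h) | h <- t] | y.1 == a) y.2.
  apply: c0; last by exists 0%N.
  move=> y; rewrite mem_cat => /orP[/hw[]//|/mapP[h _ ->]] /=.
  by rewrite -scaleN1r; exact: subspaceZ (geig_sub _) (gG h).
rewrite big_cat big_map /= sumrN -ga => /eqP; rewrite eq_sym subr_eq0 => /eqP.
by [].
Qed.

Lemma direct_sum_wspan x : direct_sum_of (geig D) -> wspan (fun _ => True) x.
Proof.
move=> /(_ x)[f [[fG ffin xE] _]].
have [t ht] : fsupp f.
  by move/finite_seqP: ffin => [t ht]; exists t => i gi; have : [set i | f i != 0] i by []; rewrite ht.
rewrite -/(fs f) (@fsE _ _ _ (undup t)) ?undup_uniq // in xE; last first.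
  by move=> i /ht; rewrite mem_undup.
rewrite xE; apply: wspan_sum => i _; exact: wspan_geig (fG i).
Qed.

End One.

Lemma geig_map (A B : lmodType K) (DA : A -> A) (DB : B -> B) (f : A -> B) a b :
  linear DB -> linear f -> (forall x, f (DA x - a *: x) = DB (f x) - b *: f x) ->
  forall x, geig DA a x -> geig DB b (f x).
Proof.
move=> lDB lf h x [k e]; exists k.
suff -> : iter k (fun x => DB x - b *: x) (f x) = f (iter k (fun x => DA x - a *: x) x).
  by rewrite e (linear0P lf).
by elim: k {e} => //= k ->; rewrite h.
Qed.

End GeneralizedEigenspaces.

(** * Gradings of tensor products *)

Section Grading.
Variables (K : numFieldType) (V : voa_data K).
Hypothesis hV : is_voa V.

Lemma binz_nn i : binz K i%:Z i = 1.
Proof.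
have h := @binz_neg K 0 i; rewrite oppr0 !add0r binzN1 in h.
by rewrite -[LHS](signrMK i) -h -expr2 sqrr_sign.
Qed.

Lemma binzN2 i : binz K (-2) i = (-1) ^+ i * i.+1%:R.
Proof.
rewrite (_ : (-2 : int) = - 1 - 1) // binz_neg; congr (_ * _).
have := binz_absorb K 0 i; rewrite !add0r mul1r binz_nn mulr1 => h.
by rewrite (_ : 1 + i%:Z = i.+1%:Z) ?h //; lia.
Qed.

Section OnModule.
Variables (W : mod_data V).
Hypothesis wW : weak_module W.

(** The L(-1)-derivative property on a module, where it is not an axiom: the Jacobi identity at (-2,
    0, n) for [v] and the vacuum. Here v_{-2} 1 = L(-1) v by [Lm1]. *)
Lemma translation (v : V) n (w : W) :
  mod_Y (voa_Y v (-2) (voa_vac V)) n w = - (n%:~R *: mod_Y v (n - 1) w).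
Proof.
have [b t vac J] := wW; have lW := weak_mlin wW.
have := J v (voa_vac V) w (-2) 0 n.
rewrite -/(fs _) -/(fs _) (@fs_single _ _ _ 0%N); last first.
  by move=> [//|i] _; rewrite binz0S scale0r.
rewrite binz0 scale1r -[0%N%:Z]/(0 : int) !(addr0, add0r, subr0) => ->.
have e2 : (-1) ^ (-2) = 1 :> K by rewrite -invr_expz -exprnP sqrrN expr1n invr1.
under eq_fs do rewrite binzN2 signrMK !vac e2 scale1r.
(* Only mode -1 of the vacuum acts, so at most one term survives: i = -1 - n in the first product if
   n < 0, i = n - 1 in the second if n > 0, and none if n = 0. *)
have [n0|n0] := ltP n 0.
  rewrite (@fs_single _ _ _ `|(- 1 - n)%R|%N); last first.
    move=> i hi; rewrite [_ == _]negbTE ?[X in _ - X]ifF ?(mode0r _ _ lW) ?subr0 ?scaler0 //; lia.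
  rewrite ifT; last by lia.
  rewrite ifF ?subr0; last by lia.
  rewrite -scaleNr -intrN -[_%:R]/(_%:Z%:~R); congr (_%:~R *: mod_Y _ _ _); lia.
have [n1|n1] := eqVneq n 0.
  rewrite n1 scale0r oppr0; apply: fs0 => i.
  by rewrite !ifF ?(mode0r _ _ lW) ?subr0 ?scaler0 //; lia.
rewrite (@fs_single _ _ _ `|(n - 1)%R|%N); last first.
  by move=> i hi; rewrite !ifF ?(mode0r _ _ lW) ?subr0 ?scaler0 //; lia.
rewrite ifF; last by lia.
rewrite ifT; last by lia.
rewrite (mode0r _ _ lW) sub0r scalerN; congr (- _).
rewrite -[_%:R]/(_%:Z%:~R); congr (_%:~R *: mod_Y _ _ _); lia.
Qed.

Lemma Lm1 (v : V) : Lop (W := adjoint V) (-1) v = voa_Y v (-2) (voa_vac V).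
Proof.
have [[_ cr] _ der _ _] := hV.
have := der v (voa_vac V) (-1); have [-> _] := cr (Lop (W := adjoint V) (-1) v).
by move=> ->; rewrite -scaleNr -intrN opprK scale1r.
Qed.

Lemma Lop_lin (n : int) : linear (@Lop _ V W n).
Proof. exact: weak_mlin wW _ _. Qed.

(** The commutator of ω_1 with v_n is (L(-1)v)_{n+1} + (L(0)v)_n, and the two terms contribute -(n +
    1) and k. *)
Lemma Lop_comm (v : V) k n (w : W) : voa_wt k v ->
  Lop 0 (mod_Y v n w) = mod_Y v n (Lop 0 w) + (k - n - 1)%:~R *: mod_Y v n w.
Proof.
move=> vk; have [b t vac J] := wW.
have := J (voa_conf V) v w 0 1 n.
rewrite -/(fs _) -/(fs _) [X in _ = X](@fs_single _ _ _ 0%N); last first.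
  by move=> [//|i] _; rewrite binz0S mulr0 scale0r.
rewrite binz0 expr0 mulr1 scale1r expr0z scale1r -[0%N%:Z]/(0 : int).
rewrite !(addr0, subr0) (@fs_nat _ _ 2); last first.
  by move=> [|[|i]] // _; rewrite binz1S scale0r.
rewrite 2!big_ord_recl big_ord0 addr0 /= binz0 binz11 !scale1r -[0%N%:Z]/(0 : int).
rewrite !(add0r, addr0, subr0) => e.
have e1 : mod_Y (voa_conf V) 1 (mod_Y v n w) = Lop 0 (mod_Y v n w) by [].
have e2 : mod_Y (voa_conf V) 1 w = Lop 0 w by [].
rewrite e1 e2 in e.
have -> : Lop 0 (mod_Y v n w) = mod_Y v n (Lop 0 w) +
   (Lop 0 (mod_Y v n w) - mod_Y v n (Lop 0 w)) by rewrite addrC subrK.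
congr (_ + _); rewrite -e.
have -> : voa_Y (voa_conf V) 0 v = Lop (W := adjoint V) (-1) v by [].
have -> : voa_Y (voa_conf V) (bump 0 0) v = Lop (W := adjoint V) 0 v by [].
rewrite vk Lm1 translation (bilZl (b _)).
rewrite -scaleNr -intrN (_ : 1 + n - 1 = n); last by lia.
by rewrite -scalerDl -intrD; congr (_%:~R *: _); lia.
Qed.

Lemma gen_wt_mode (v : V) k n h (w : W) : voa_wt k v -> gen_wt (W := W) h w ->
  gen_wt (W := W) (h + (k - n - 1)%:~R) (mod_Y v n w).
Proof.
move=> vk; have lW := weak_mlin wW.
apply: (geig_map (DA := Lop 0) (DB := Lop 0) (f := @mod_Y _ _ W v n)).
- exact: Lop_lin.
- exact: lW.
move=> x; rewrite (linearBP (lW v n)) (linearZP (lW v n)) (Lop_comm _ _ vk).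
by rewrite scalerDl opprD addrACA subrr addr0.
Qed.

End OnModule.

Lemma hom_gen_wt (M N : mod_data V) (f : M -> N) h x : weak_module N -> is_hom f ->
  gen_wt (W := M) h x -> gen_wt (W := N) h (f x).
Proof.
move=> wN hf; apply: (geig_map (DA := Lop 0) (DB := Lop 0)).
- exact: Lop_lin.
- by case: hf.
by move=> y; rewrite (homB hf) (homZ _ hf); case: hf => _ ->.
Qed.

Section Weights.
Variables (C : mod_cat V) (W : mod_data V).
Hypotheses (hC : admissible_cat C) (CW : C W).

Lemma adm_gen : generalized_module W /\ grading_restricted W.
Proof. by case: hC => h _ _ _ _; exact: h. Qed.
Let wW : weak_module W := adm_weak hC CW.
Let lD : linear (@Lop _ V W 0) := Lop_lin wW 0.

(** Modes of homogeneous vectors shift weights by integers, so the vectors with weights in the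
    cosets of the generators' weights form a submodule; it contains the generators. *)
Lemma weights_finite_cosets : exists cs : seq K, forall x : W,
  wspan (@Lop _ V W 0) (fun h => exists2 c, c \in cs & exists z : int, h = c + z%:~R) x.
Proof.
have [[_ dW] _] := adm_gen.
have [s hs] := adm_fg hC CW.
have sp x : wspan (@Lop _ V W 0) (fun _ => True) x by exact: direct_sum_wspan.
have /choice[t ht] : forall x : W, exists t : seq (K * W),
   (forall y, y \in t -> gen_wt (W := W) y.1 y.2) /\ x = \sum_(y <- t) y.2.
  by move=> x; have [t h e] := sp x; exists t; split=> // y /h[].
pose cs := flatten [seq [seq y.1 | y <- t x] | x <- s].
exists cs => x.
pose p h := exists2 c, c \in cs & exists z : int, h = c + z%:~R.
pose A : set W := wspan (@Lop _ V W 0) p.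
have sA : is_submodule A.
  split; first exact: wspan0.
    by move=> c y z hy hz; apply: wspanD => //; exact: wspanZ.
  move=> v n y [r hr ->].
  have lY := weak_mlin wW v n.
  rewrite (linear_sumP _ _ _ lY) big_seq; apply: wspan_sum => z /hr[[c ccs [i zE]] gz].
  have [_ _ _ dV _] := hV; have [f [[fG ffin vE] _]] := dV v.
  have [q hq] : fsupp f.
    move/finite_seqP: ffin => [q hq]; exists q => j fj.
    by have : [set j | f j != 0] j by []; rewrite hq.
  rewrite -/(fs f) (@fsE _ _ _ (undup q)) ?undup_uniq // in vE; last first.
    by move=> j /hq; rewrite mem_undup.
  have [b _ _ _] := wW.
  rewrite vE (bil_suml (b n)); apply: wspan_sum => j _.
  apply: (wspan_geig (h := z.1 + (j - n - 1)%:~R)).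
    exists c => //; exists (i + (j - n - 1)); rewrite zE -addrA; congr (_ + _).
    by rewrite [RHS]intrD.
  exact: (gen_wt_mode wW n (fG j) gz).
rewrite -[wspan _ _ x]/(A x) (hs A sA) // => y ys.
have [h1 ->] := ht y; rewrite /A big_seq; apply: wspan_sum => z zt.
apply: (wspan_geig (h := z.1)); last exact: h1.
exists z.1; last by exists 0; rewrite addr0.
apply/flattenP; exists [seq y.1 | y <- t y]; first exact: map_f.
exact: map_f.
Qed.

Lemma weights_bounded : exists cs : seq K, forall x : W,
  wspan (@Lop _ V W 0) (fun h => exists2 c, c \in cs & exists n : nat, h = c + n%:R) x.
Proof.
have [cs hcs] := weights_finite_cosets; have [_ gr] := adm_gen.
have /choice[N hN] := fun c => (gr c).2.
exists [seq c + (N c)%:~R | c <- cs] => x.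
have [s hs ->] := hcs x; rewrite big_seq; apply: wspan_sum => y /hs[[c ccs [z yE]] gy].
(* The zero vector belongs to every weight space, so its label may lie below the bound and must be
   discarded first. *)
have [y0|y0] := eqVneq y.2 0; first by rewrite y0; exact: wspan0.
apply: (wspan_geig (h := y.1)) => //.
have Nz : N c <= z.
  rewrite leNgt; apply: contraNN y0 => h; have := hN c z h; rewrite -yE => e.
  by have : gen_wt (W := W) y.1 y.2 by []; rewrite e => /= ->.
exists (c + (N c)%:~R); first exact: (map_f (fun c => c + (N c)%:~R)).
exists `|(z - N c)%R|%N; rewrite yE -addrA -[_%:R]/(_%:Z%:~R) -intrD.
by congr (_ + _%:~R); lia.
Qed.

End Weights.
End Grading.

Section TensorGrading.
Variable K : numFieldType.
Variables U V : voa_data K.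
Hypotheses (hU : is_voa U) (hV : is_voa V).
Variables (CU : mod_cat U) (CV : mod_cat V).
Hypotheses (hCU : admissible_cat CU) (hCV : admissible_cat CV).
Variables (M : mod_data U) (W : mod_data V).
Hypotheses (CM : CU M) (CW : CV W).

Let vU : is_vertex_algebra U. Proof. by case: hU. Qed.
Let vV : is_vertex_algebra V. Proof. by case: hV. Qed.
Let wM := adm_weak hCU CM.
Let wW := adm_weak hCV CW.
Let wT := tens_weak vU vV wM wW.
Local Notation T := (tens_mod M W).

Lemma Lop_tens (m : M) (w : W) :
  Lop (W := T) 0 (tpure m w) = tpure (Lop 0 m) w + tpure m (Lop 0 w).
Proof.
rewrite /Lop /=.
have b := tens_mode_bil (weak_truncated wM) (weak_truncated wW) (0 + 1).
have := bilDl b (tpure (voa_conf U) (voa_vac V)) (tpure (voa_vac U) (voa_conf V)) (tpure m w).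
by rewrite /= tens_mode_left // tens_mode_right.
Qed.

(** L(0) - a - b is the sum of L(0) - a on the first factor and L(0) - b on the second; induction on
    k + j replaces the binomial formula for its powers. *)
Lemma gen_wt_tpure a b (m : M) (w : W) : gen_wt (W := M) a m -> gen_wt (W := W) b w ->
  gen_wt (W := T) (a + b) (tpure m w).
Proof.
have lM := Lop_lin wM 0; have lW := Lop_lin wW 0; have lT := Lop_lin wT 0.
move=> [k hk] [j hj]; exists (k + j)%N.
have step (x : M) (y : W) : Lop (W := T) 0 (tpure x y) - (a + b) *: (tpure x y : T) =
   tpure (Lop 0 x - a *: x) y + tpure x (Lop 0 y - b *: y).
  rewrite Lop_tens tpureDl tpureDr -!scaleN1r !tpureZl !tpureZr !scaleN1r.
  by rewrite scalerDl opprD addrACA.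
move: hk hj; move e : (k + j)%N => n; elim: n k j e m w => [|n IH] k j e m w hk hj.
  have k0 : k = 0%N by lia.
  by move: hk; rewrite k0 /= => ->; rewrite tpure0l.
rewrite iterSr step (linearDP (lEk lT n (a + b))).
case: k hk e => [/= -> _|k hk e].
  by rewrite (linear0P lM) scaler0 subr0 !tpure0l (linear0P (lEk lT n (a + b))) addr0.
case: j hj e => [/= -> _|j hj e].
  by rewrite (linear0P lW) scaler0 subr0 !tpure0r (linear0P (lEk lT n (a + b))) addr0.
rewrite (IH k j.+1) ?add0r; [|lia|by rewrite iterSr in hk|by []].
by apply: (IH k.+1 j); [lia|by []|by rewrite iterSr in hj].
Qed.

Lemma tens_weight_list : exists csU csV : seq K, forall x : T,
  exists2 s : seq ((K * M) * (K * W)),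
    forall y, y \in s -> [/\ gen_wt (W := M) y.1.1 y.1.2, gen_wt (W := W) y.2.1 y.2.2,
      exists2 c, c \in csU & exists n : nat, y.1.1 = c + n%:R &
      exists2 c, c \in csV & exists n : nat, y.2.1 = c + n%:R] &
    x = \sum_(y <- s) tpure y.1.2 y.2.2.
Proof.
have [csU hcU] := weights_bounded hU hCU CM; have [csV hcV] := weights_bounded hV hCV CW.
exists csU, csV => x; elim/tens_ind: x => [|x x' [s hs ->] [s' hs' ->]|m w].
- by exists [::]; rewrite ?big_nil.
- exists (s ++ s'); last by rewrite big_cat.
  by move=> y; rewrite mem_cat => /orP[/hs|/hs'].
have [s hs ->] := hcU m; have [t ht ->] := hcV w.
exists [seq (y, z) | y <- s, z <- t].
  by move=> _ /allpairsP[[y z] [/= /hs[h1 h2] /ht[h3 h4] ->]].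
rewrite big_allpairs_dep (bil_suml (@tpure_bilinear K M W)); apply: eq_bigr => y _.
by rewrite (bil_sumr (@tpure_bilinear K M W)).
Qed.

Lemma tens_generalized : generalized_module T.
Proof.
split=> //; apply: direct_sum_geig; first exact: Lop_lin.
have [csU [csV h]] := tens_weight_list.
move=> x; have [s hs ->] := h x; rewrite big_seq; apply: wspan_sum => y /hs[h1 h2 _ _].
by apply: (wspan_geig (h := y.1.1 + y.2.1)) => //; exact: gen_wt_tpure.
Qed.

Lemma tens_grading : grading_restricted T.
Proof.
have lT := Lop_lin wT 0.
have [csU [csV hT]] := tens_weight_list => h.
have [_ grU] := adm_gen hCU CM; have [_ grV] := adm_gen hCV CW.
split.
  (* In characteristic 0 at most one [N] satisfies h = c + c' + N. It bounds the height above [c] of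
     the first weight, so finitely many pairs of weights add up to [h]. *)
  have /choice[B hB] : forall cc : K * K, exists B : nat, forall N : nat,
      h = cc.1 + cc.2 + N%:R -> (N <= B)%N.
    move=> cc; have [[N0 e]|no] := pselect (exists N : nat, h = cc.1 + cc.2 + N%:R).
      exists N0 => N e'; have /eqP := etrans (esym e) e'.
      by rewrite (inj_eq (addrI _)) eqr_nat => /eqP ->.
    by exists 0%N => N e; exfalso; apply: no; exists N.
  pose As := [seq cc.1 + n%:R | cc <- [seq (c, c') | c <- csU, c' <- csV], n <- iota 0 (B cc).+1].
  have /choice[EU hEU] : forall a, exists s : seq M, forall x, gen_wt (W := M) a x ->
      forall A, subspace A -> {in s, forall y, A y} -> A x.
    by move=> a; apply/fin_dimP; case: (grU a).
  have /choice[EV hEV] : forall a, exists s : seq W, forall x, gen_wt (W := W) a x ->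
      forall A, subspace A -> {in s, forall y, A y} -> A x.
    by move=> a; apply/fin_dimP; case: (grV a).
  apply/fin_dimP.
  exists (flatten [seq [seq (tpure e f : T) | e <- EU a, f <- EV (h - a)] | a <- As]).
  move=> x hx A sA hA.
  have [s hs xE] := hT x.
  have xE' := geig_component (s := [seq (y.1.1 + y.2.1, (tpure y.1.2 y.2.2 : T)) | y <- s]) lT _ hx.
  rewrite !big_map in xE'; rewrite (xE' _ xE); last first.
    by move=> _ /mapP[y /hs[h1 h2 _ _] ->]; exact: gen_wt_tpure.
  rewrite big_seq_cond; apply: subspace_sum => // y /andP[/hs[g1 g2 [c cc [n cE]] [c' cc' [n' cE']]] /= /eqP e].
  have aAs : y.1.1 \in As.
    rewrite cE; apply: (allpairs_f_dep (fun cc n => cc.1 + n%:R) (x := (c, c')) (y := n)).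
      exact: allpairs_f.
    rewrite mem_iota /= add0n ltnS; apply: leq_trans (leq_addr n' n) _.
    by apply: hB; rewrite /= -e cE cE' natrD addrACA.
  have hb : h - y.1.1 = y.2.1 by rewrite -e addrC addKr.
  apply: (hEU _ _ g1 (fun m => A (tpure m y.2.2))).
    split; first by rewrite tpure0l; case: sA.
    by move=> d m m' h1 h2; rewrite tpureDl tpureZl; case: sA => _; apply.
  move=> m mE; apply: (hEV _ _ g2 (fun w => A (tpure m w))).
    split; first by rewrite tpure0r; case: sA.
    by move=> d w w' h1 h2; rewrite tpureDr tpureZr; case: sA => _; apply.
  move=> w wE; apply: hA; apply/flattenP.
  exists [seq (tpure e f : T) | e <- EU y.1.1, f <- EV (h - y.1.1)].
    exact: (map_f (fun a => [seq (tpure e f : T) | e <- EU a, f <- EV (h - a)])).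
  by apply: (allpairs_f (fun e f => (tpure e f : T))) => //; rewrite hb.
have /choice[z hz] : forall cc : K * K, exists z : int, forall k : nat, forall n : int,
    h + n%:~R = cc.1 + cc.2 + k%:R -> z <= n.
  move=> cc; have [[z0 e]|no] := pselect (exists z : int, h + z%:~R = cc.1 + cc.2).
    exists z0 => k n; rewrite -e -[k%:R]/(k%:Z%:~R) -addrA -intrD => /addrI/intr_inj ->.
    lia.
  exists 0 => k n e; exfalso; apply: no; exists (n - k%:Z).
  by rewrite intrB addrA e addrK.
have [b hb] := seq_bound [seq (c, c') | c <- csU, c' <- csV] (fun cc => - z cc).
exists (- b) => n nb; apply/seteqP; split=> [x hx|x ->]; last first.
  by exists 0%N.
apply/eqP; apply: contraT => x0.
have ws : wspan (@Lop _ _ T 0) (fun a => exists2 cc, cc \in [seq (c, c') | c <- csU, c' <- csV] &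
    exists k : nat, a = cc.1 + cc.2 + k%:R) x.
  have [s hs ->] := hT x; rewrite big_seq; apply: wspan_sum => y.
  move=> /hs[g1 g2 [c cc [i cE]] [c' cc' [i' cE']]].
  apply: (wspan_geig (h := y.1.1 + y.2.1)); last exact: gen_wt_tpure.
  exists (c, c'); first exact: allpairs_f.
  by exists (i + i')%N; rewrite cE cE' natrD addrACA.
have [cc ccs [k e]] := wspan_weight lT ws hx x0.
by have := hz cc k n e; have := hb cc ccs; lia.
Qed.

End TensorGrading.

Section TensorInD.
Variable K : numClosedFieldType.
Variables U V : voa_data K.
Hypotheses (hU : is_voa U) (hV : is_voa V).
Variables (CU : mod_cat U) (CV : mod_cat V).
Hypotheses (hCU : admissible_cat CU) (hCV : admissible_cat CV).

Theorem tens_in_D (M : mod_data U) (W : mod_data V) : CU M -> CV W ->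
  Dcat CU CV (tens_mod M W).
Proof.
have [vU _ _ _ _] := hU; have [vV _ _ _ _] := hV.
move=> CM CW; have wM := adm_weak hCU CM; have wW := adm_weak hCV CW.
have wT := tens_weak vU vV wM wW; have lT := weak_mlin wT.
split.
- exact: (tens_generalized hU hV hCU hCV CM CW).
- exact: (tens_grading hU hV hCU hCV CM CW).
- exact: (finlen_tens vU vV hCU hCV CM CW).
- move=> x; apply: (loc_generated hCU (W := res_left (tens_mod M W))).
  have [s ->] := tens_sum x; apply: (loc_at_sum hCU (W := res_left (tens_mod M W))).
    exact: res_left_mlin.
  move=> p _; exists M, (fun m => tpure m p.2), p.1; split=> //.
  exact: weak_res_left_pure.
- move=> x; apply: (loc_generated hCV (W := res_right (tens_mod M W))).
  have [s ->] := tens_sum x; apply: (loc_at_sum hCV (W := res_right (tens_mod M W))).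
    exact: res_right_mlin.
  move=> p _; exists W, (fun w => tpure p.1 w), p.2; split=> //.
  exact: weak_res_right_pure.
Qed.

End TensorInD.

(** * Projective objects of the category D(U, V) *)

Section FiniteProducts.
Variables (K : numFieldType) (T : voa_data K) (n : nat) (Z : 'I_n -> mod_data T).

(** Families as dependent functions, the same form in which [finite_direct_sum] states unique
    decomposition. *)
Definition dprod : Type := forall i, Z i.
HB.instance Definition _ := gen_eqMixin dprod.
HB.instance Definition _ := gen_choiceMixin dprod.

Let pzero : dprod := fun i => 0.
Let padd (x y : dprod) : dprod := fun i => x i + y i.
Let popp (x : dprod) : dprod := fun i => - x i.
Let pscale (c : K) (x : dprod) : dprod := fun i => c *: x i.
Let pext (x y : dprod) : (forall i, x i = y i) -> x = y.
Proof. exact: functional_extensionality_dep. Qed.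
Let paA : associative padd. Proof. by move=> x y z; apply: pext => i; exact: addrA. Qed.
Let paC : commutative padd. Proof. by move=> x y; apply: pext => i; exact: addrC. Qed.
Let pa0 : left_id pzero padd. Proof. by move=> x; apply: pext => i; exact: add0r. Qed.
Let paN : left_inverse pzero popp padd. Proof. by move=> x; apply: pext => i; exact: addNr. Qed.
HB.instance Definition _ := GRing.isZmodule.Build dprod paA paC pa0 paN.
Let psA a b v : pscale a (pscale b v) = pscale (a * b) v.
Proof. by apply: pext => i; exact: scalerA. Qed.
Let ps1 : left_id 1 pscale. Proof. by move=> v; apply: pext => i; exact: scale1r. Qed.
Let psDr : right_distributive pscale +%R.
Proof. by move=> c x y; apply: pext => i; exact: scalerDr. Qed.
Let psDl v : {morph pscale^~ v : a b / a + b}.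
Proof. by move=> a b; apply: pext => i; exact: scalerDl. Qed.
HB.instance Definition _ := GRing.Zmodule_isLmodule.Build K dprod psA ps1 psDr psDl.

Definition prod_mod : mod_data T :=
  @ModData K T dprod (fun v k x => (fun i => mod_Y v k (x i)) : dprod).

Lemma prod_ext (x y : prod_mod) : (forall i, x i = y i) -> x = y.
Proof. exact: pext. Qed.

Definition prj k (x : prod_mod) : Z k := x k.
Lemma prj_hom k : is_hom (prj k). Proof. by []. Qed.
Definition inj k (z : Z k) : prod_mod := dfwith (fun i => (0 : Z i)) z.
Lemma prj_inj k z : prj k (inj z) = z. Proof. exact: dfwith_in. Qed.
Lemma prj_inj0 k l z : k != l -> prj l (inj (k := k) z) = 0.
Proof. exact: dfwith_out. Qed.

Hypothesis wZ : forall i, weak_module (Z i).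

Lemma inj_hom k : is_hom (inj (k := k)).
Proof.
split=> [c x y|v m x]; apply: prod_ext => i.
  have [<-|ki] := eqVneq k i.
    by rewrite -![LHS]/(prj k _) -![RHS]/(c *: prj k _ + prj k _) !prj_inj.
  rewrite -![LHS]/(prj i _) -![RHS]/(c *: prj i _ + prj i _) !prj_inj0 //.
  by rewrite scaler0 addr0.
have [<-|ki] := eqVneq k i.
  by rewrite -![LHS]/(prj k _) -![RHS]/(mod_Y v m (prj k _)) !prj_inj.
rewrite -![LHS]/(prj i _) -![RHS]/(mod_Y v m (prj i _)) !prj_inj0 //.
by rewrite mode0r //; exact: weak_mlin.
Qed.

Lemma sum_inj_prj (x : prod_mod) : \sum_(k < n) inj (prj k x) = x.
Proof.
apply: prod_ext => i; rewrite -[LHS]/(prj i _) (hom_sum _ _ _ (prj_hom i)).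
rewrite (bigD1 i) //= prj_inj big1 ?addr0 // => k ki.
by rewrite prj_inj0.
Qed.

Hypothesis tT : truncated (adjoint T).

Lemma prod_weak : weak_module prod_mod.
Proof.
have tr : truncated prod_mod.
  split.
    move=> m; split=> [x c v v'|v c x y] /=; apply: prod_ext => i.
      by have [b _ _ _] := wZ i; have [h _] := b m; exact: h.
    by have [b _ _ _] := wZ i; have [_ h] := b m; exact: h.
  move=> v x; have /choice[N hN] : forall i, exists N : int, forall m, N <= m -> mod_Y v m (x i) = 0.
    by move=> i; have [_ t _ _] := wZ i; exact: t.
  have [b hb] := seq_bound (enum 'I_n) N.
  exists b => m bm; apply: prod_ext => i; apply: hN.
  by apply: le_trans bm; apply: hb; rewrite mem_enum.
split; [by case: tr|by case: tr| |].
  move=> m x; apply: prod_ext => i /=; have [_ _ h _] := wZ i.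
  by rewrite h; case: ifP.
apply/(jacobiP tr) => u v x l m k; apply: prod_ext => i.
have ev s p q r (a : int -> int -> prod_mod) : good a ->
    prj i (expand s p q r a) = expand s p q r (fun p q => prj i (a p q)).
  move=> ga; rewrite /expand /shift_op (linear_fsP (f := prj i)) //.
  exact: (good_fsupp _ _ (fun j => s ^+ j * binz K p j) ga).
have g1 := good_comp_modes u v x tr; have g2 := good_comp_modes v u x tr.
have g3 := good_iter_modes u v x tT tr.
rewrite -[LHS]/(prj i _) -[RHS]/(prj i _) (homB (prj_hom i)) (homZ _ (prj_hom i)) !ev //.
by have [_ _ _ J] := wZ i; exact: ((jacobiP (weak_truncated (wZ i))).1 J u v (x i) l m k).
Qed.

End FiniteProducts.
Arguments prj {K T n Z} k x.
Arguments inj {K T n Z} k z.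

Lemma len_cover (K : fieldType) (T : voa_data K) (n : nat) (X : mod_data T)
  (Z : 'I_n -> mod_data T) (f : forall k, Z k -> X) : linear_modes X ->
  (forall k, is_hom (f k)) -> (forall k, exists m, len_le (Z k) m) ->
  (forall A : set X, is_submodule A -> (forall k z, A (f k z)) -> A = setT) ->
  exists m, len_le X m.
Proof.
elim: n X Z f => [|n IH] X Z f lX hf hl cov.
  exists 0%N; apply: len_zero => // x.
  have e : [set 0] = [set: X] by apply: cov => [|[]]; first exact: sub_set0.
  by have : [set: X] x by []; rewrite -e.
have sR := sub_range (hf ord0).
have hq := quo_hom sR lX.
have [||k|A sA hA|b hb] := IH (quo_mod sR) (fun k => Z (lift ord0 k))
  (fun k => quo sR \o f (lift ord0 k)).
- exact: quo_mlin.
- by move=> k; exact: hom_comp (hf _) hq.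
- exact: hl.
- have e : [set x | A (quo sR x)] = setT.
    apply: cov; first exact: (sub_preimage hq sA).
    move=> k; have [j ->|->] := unliftP ord0 k => z /=; first exact: (hA j z).
    by rewrite ((quo_eq0 sR _).2 _); [exact: (sub0 sA)|exists z].
  apply/seteqP; split=> // y _; have [x <-] := quo_surj sR y.
  by rewrite -[A _]/([set x | A (quo sR x)] x) e.
have [a ha] := hl ord0; exists (a + b)%N.
apply: (len_ext (hf ord0) hq) ha hb => x /(quo_eq0 sR)[y _ <-].
by exists y.
Qed.

Section DCategory.
Variable K : numClosedFieldType.
Variables U V : voa_data K.
Hypotheses (hU : is_voa U) (hV : is_voa V).
Variables (CU : mod_cat U) (CV : mod_cat V).
Hypotheses (hCU : admissible_cat CU) (hCV : admissible_cat CV).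
Local Notation D := (Dcat CU CV).

Let vU : is_vertex_algebra U. Proof. by case: hU. Qed.
Let vV : is_vertex_algebra V. Proof. by case: hV. Qed.

Lemma D_weak X : D X -> weak_module X. Proof. by case=> [[]]. Qed.
Lemma D_mlin X : D X -> linear_modes X. Proof. by move/D_weak; exact: weak_mlin. Qed.
Lemma D_loc_left X : D X -> locally_in CU (res_left X).
Proof. by case=> _ _ _ h _; exact: generated_loc. Qed.
Lemma D_loc_right X : D X -> locally_in CV (res_right X).
Proof. by case=> _ _ _ _ h; exact: generated_loc. Qed.
Lemma D_len X : D X -> exists m, len_le X m.
Proof. by move=> DX; apply: finite_length_len; [exact: D_mlin|case: DX]. Qed.

Lemma D_sum n (Z : 'I_n -> mod_data (tens_voa U V)) (S : mod_data (tens_voa U V))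
  (i : forall k, Z k -> S) (p : forall k, S -> Z k) :
  (forall k, D (Z k)) -> weak_module S -> (forall k, is_hom (i k)) -> (forall k, is_hom (p k)) ->
  (forall x, \sum_(k < n) i k (p k x) = x) -> D S.
Proof.
move=> DZ wS hi hp ip; have lS := weak_mlin wS.
split.
- split=> //; apply: direct_sum_geig; first exact: Lop_lin.
  move=> x; rewrite -[x]ip; apply: wspan_sum => k _.
  have [[_ dk] _ _ _ _] := DZ k.
  have [s hs e] := direct_sum_wspan (p k x) dk.
  rewrite e (hom_sum _ _ _ (hi k)) big_seq; apply: wspan_sum => y /hs[_ gy].
  by apply: (wspan_geig (h := y.1)) => //; exact: (hom_gen_wt wS (hi k) gy).
- move=> h; have gr k : _ := let: And5 _ g _ _ _ := DZ k in g h.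
  split.
    have Es k := cid ((fin_dimP _).1 (gr k).1).
    pose E k := sval (Es k); have hE k := svalP (Es k).
    apply/fin_dimP; exists (flatten [seq [seq i k e | e <- E k] | k <- enum 'I_n]).
    move=> x gx A sA hA; rewrite -[x]ip; apply: subspace_sum => // k _.
    apply: (hE k (p k x) _ (fun y => A (i k y))).
    + exact: (hom_gen_wt (D_weak (DZ k)) (hp k) gx).
    + split; first by rewrite (hom0 (hi k)); case: sA.
      by move=> c y z hy hz; have [li _] := hi k; rewrite li; case: sA => _; apply.
    move=> e ek; apply: hA; apply/flattenP; exists [seq i k e | e <- E k].
      by apply: (map_f (fun k => [seq i k e | e <- E k])); rewrite mem_enum.
    exact: map_f.
  have /choice[N hN] := fun k => (gr k).2.
  have [b hb] := seq_bound (enum 'I_n) (fun k => - N k).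
  exists (- b) => m mb; apply/seteqP; split=> [x gx|x ->]; last by exists 0%N.
  rewrite /= -[x]ip big1 // => k _.
  have : gen_wt (W := Z k) (h + m%:~R) (p k x).
    exact: (hom_gen_wt (D_weak (DZ k)) (hp k) gx).
  rewrite hN; first by move=> ->; rewrite (hom0 (hi k)).
  by have := hb k; rewrite mem_enum => /(_ isT); lia.
- have [|m hm] := len_cover lS hi (fun k => D_len (DZ k)).
    move=> A sA hA; apply/seteqP; split=> // x _; rewrite -[x]ip.
    exact: (sub_sum sA).
  exact: len_finite_length hm.
- move=> x; apply: (loc_generated hCU (W := res_left S)).
  rewrite -[x]ip; apply: (loc_at_sum hCU (W := res_left S)); first exact: res_left_mlin.
  move=> k _; have [N [f [z [CN hf <-]]]] := D_loc_left (DZ k) (p k x).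
  exists N, (i k \o f), z; split=> //.
  exact: (hom_comp hf (res_left_hom (hi k))).
- move=> x; apply: (loc_generated hCV (W := res_right S)).
  rewrite -[x]ip; apply: (loc_at_sum hCV (W := res_right S)); first exact: res_right_mlin.
  move=> k _; have [N [f [z [CN hf <-]]]] := D_loc_right (DZ k) (p k x).
  exists N, (i k \o f), z; split=> //.
  exact: (hom_comp hf (res_right_hom (hi k))).
Qed.

Lemma prod_in_D n (Z : 'I_n -> mod_data (tens_voa U V)) : (forall k, D (Z k)) -> D (prod_mod Z).
Proof.
move=> DZ; have wZ k := D_weak (DZ k).
apply: (D_sum (i := inj) (p := prj) DZ).
- exact: prod_weak wZ (tens_voa_truncated vU vV).
- by move=> k; exact: inj_hom.
- by move=> k; exact: prj_hom.
- exact: sum_inj_prj.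
Qed.

Lemma prod_projective n (Z : 'I_n -> mod_data (tens_voa U V)) :
  (forall k, projective_in D (Z k)) -> projective_in D (prod_mod Z).
Proof.
move=> pZ; split; first by apply: prod_in_D => k; case: (pZ k).
have wZ k : weak_module (Z k) by case: (pZ k) => /D_weak.
move=> X Y g f DX DY hg hf.
have h k : {h : Z k -> X | is_hom h /\ forall z, g (h z) = f (inj k z)}.
  apply: cid; have [_ pr] := pZ k.
  have [h hh e] := pr _ _ g (f \o inj k) DX DY hg (hom_comp (inj_hom wZ k) hf).
  by exists h; split=> // z; exact: (congr1 (fun F => F z) e).
exists (fun x => \sum_(k < n) sval (h k) (prj k x)).
  apply: hom_bigsum; first exact: D_mlin.
  by move=> k; have [hh _] := svalP (h k); exact: (@hom_comp _ _ (prod_mod Z) (Z k) X (prj k) (sval (h k)) (prj_hom Z k) hh).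
apply/funext => x /=; rewrite (hom_sum _ _ _ hg.1).
rewrite -[in RHS](sum_inj_prj x) (hom_sum _ _ _ hf); apply: eq_bigr => k _.
by have [_ ->] := svalP (h k).
Qed.

Lemma tens_projective (P : mod_data U) (Q : mod_data V) :
  projective_in CU P -> projective_in CV Q -> projective_in D (tens_mod P Q).
Proof.
move=> pP pQ; have [CP _] := pP; have [CQ _] := pQ.
split; first exact: (tens_in_D hU hV hCU hCV CP CQ).
move=> X Y g f DX DY [hg sg] hf.
have wX := D_weak DX; have wY := D_weak DY.
have wP := adm_weak hCU CP; have wQ := adm_weak hCV CQ.
have [psi hpsi psiE] := tens_hom_down vU vV wP wQ wY hf.
have hgl := res_left_hom hg.
have gS (h : hom_mod vU vV P wX) : is_hom ((fun p => g ((sub_in h : P -> X) p)) : P -> res_left Y).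
  exact: (hom_comp (hom_mod_hom h) hgl).
pose G h : hom_mod vU vV P wY := sub_mk (hom_set_sub vU vV P wY) (gS h).
have GE h p : (sub_in (G h) : P -> Y) p = g ((sub_in h : P -> X) p) by [].
have hG : is_hom G.
  have [lg yg] := hg.
  split=> [c x y|v n x]; apply: hom_mod_ext => p; rewrite GE; first exact: lg.
  exact: yg.
(* Surjectivity of composition with [g] is the projectivity of [P], applied to U-modules that lie
   only locally in [CU]. *)
have sG : surj G.
  move=> h; have [k hk kE] := projective_lift hCU pP (res_left_mlin (D_mlin DX))
    (res_left_mlin (D_mlin DY)) (D_loc_left DX) (conj hgl sg) (hom_mod_hom h).
  by exists (sub_mk (hom_set_sub vU vV P wX) hk); apply: hom_mod_ext => p; rewrite GE -kE.
have [s hs] := adm_fg hCU CP.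
have [phi hphi phiE] := projective_lift hCV pQ (@hom_mod_mlin _ _ _ vU vV P X wX)
   (@hom_mod_mlin _ _ _ vU vV P Y wY) (hom_mod_loc (hU := vU) (hV := vV) (wX := wX) hCV hs (D_loc_right DX)) (conj hG sG) hpsi.
have [th hth thE] := tens_hom_up wP wQ hphi.
exists th => //; have [lg _] := hg; have [lth _] := hth; have [lf _] := hf.
apply: tlift_unique => //; first exact: linear_comp.
by move=> p q /=; rewrite thE -GE phiE psiE.
Qed.

(** * Finite coverings by tensor products of local projectives *)

Section Arrows.
Variable X : mod_data (tens_voa U V).

Record arrow := Arrow {
  arr_P : mod_data U;
  arr_Q : mod_data V;
  arr_map : tens_mod arr_P arr_Q -> X;
  arr_Pl : local_projective CU arr_P;
  arr_Ql : local_projective CV arr_Q;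
  arr_hom : is_hom arr_map }.

Arguments arr_map : clear implicits.

Definition covered n (a : 'I_n -> arrow) (x : X) : Prop :=
  forall A : set X, is_submodule A -> (forall k z, A (arr_map (a k) z)) -> A x.

Lemma covered_sub n (a : 'I_n -> arrow) : is_submodule (covered a).
Proof.
split.
- by move=> A sA _; exact: sub0.
- by move=> c x y hx hy A sA hA; apply: (subZD sA); [exact: hx|exact: hy].
- by move=> v m x hx A sA hA; apply: (subY sA); exact: hx.
Qed.

Lemma covered_cat n m (a : 'I_n -> arrow) (b : 'I_m -> arrow) :
  exists c : 'I_(n + m) -> arrow, covered a `<=` covered c /\ covered b `<=` covered c.
Proof.
exists (fun i => match fintype.split i with inl j => a j | inr k => b k end).
split=> x hx A sA hA; apply: hx => // k z.
  have := hA (lshift m k).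
  by rewrite (_ : fintype.split (lshift m k) = inl k) //; exact: (unsplitK (inl k)).
have := hA (rshift n k).
by rewrite (_ : fintype.split (rshift n k) = inr k) //; exact: (unsplitK (inr k)).
Qed.

(** [local_span] is applied twice: over [U] it suffices to reach the images of maps P -> X, and over
    [V], inside the module of such maps, the images of maps from a local projective [Q]; these are
    arrows by adjunction. Finite generation of [X] leaves finitely many arrows. *)
Lemma exists_cover : D X -> enough_projectives CU -> enough_projectives CV ->
  exists n (a : 'I_n -> arrow), covered a = setT.
Proof.
move=> DX eU eV; have lX := D_mlin DX; have wX := D_weak DX.
pose B : set X := fun x => exists n (a : 'I_n -> arrow), covered a x.
have sB : is_submodule B.
  split.
  - have a0 : 'I_0 -> arrow by case.
    by exists 0%N, a0; exact: (sub0 (covered_sub a0)).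
  - move=> c x y [n [a hx]] [m [b hy]]; have [d [h1 h2]] := covered_cat a b.
    by exists (n + m)%N, d; apply: (subZD (covered_sub d)); [exact: h1|exact: h2].
  - by move=> v k x [n [a hx]]; exists n, a; exact: (subY (covered_sub a)).
have BT : B = setT.
  apply: (local_span hCU eU (res_left_mlin lX) (D_loc_left DX) (res_left_sub sB)).
  move=> P f p Pl hf; have [[CP _] _] := Pl; have wP := adm_weak hCU CP.
  have [s hs] := adm_fg hCU CP.
  pose A : set (hom_mod vU vV P wX) := fun h : hom_mod vU vV P wX => forall p, B ((sub_in h : P -> X) p).
  have sA : is_submodule A.
    split.
    - by move=> q; exact: (sub0 sB).
    - by move=> c x y hx hy q; exact: (subZD sB).
    - by move=> v k x hx q; exact: (subY sB).
  have AT : A = setT.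
    apply: (local_span hCV eV (@hom_mod_mlin _ _ _ vU vV P X wX)
      (hom_mod_loc (hU := vU) (hV := vV) (wX := wX) hCV hs (D_loc_right DX)) sA).
    move=> Q psi q Ql hpsi p'; have [[CQ _] _] := Ql; have wQ := adm_weak hCV CQ.
    have [th hth <-] := tens_hom_up wP wQ hpsi.
    exists 1%N, (fun _ => Arrow Pl Ql hth) => A' sA' hA'.
    exact: (hA' ord0).
  have : [set: hom_mod vU vV P wX] (sub_mk (hom_set_sub vU vV P wX) hf) by [].
  by rewrite -AT => /(_ p).
have [m hm] := D_len DX; have [s hs] := len_fg hm.
have [n [a ha]] : exists n (a : 'I_n -> arrow), {in s, forall x, covered a x}.
  elim: s {hs} => [|x s [n [a ha]]].
    have a0 : 'I_0 -> arrow by case.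
    by exists 0%N, a0.
  have [k [b hb]] : B x by rewrite BT.
  have [d [h1 h2]] := covered_cat b a; exists (k + n)%N, d => y.
  by rewrite inE => /orP[/eqP->|/ha/h2//]; exact: h1.
exists n, a; apply: (hs _ (covered_sub a)) ha.
Qed.

Section Cover.
Variables (n : nat) (a : 'I_n -> arrow).
Hypotheses (DX : D X) (ca : covered a = setT).
Let Z k := tens_mod (arr_P (a k)) (arr_Q (a k)).
Definition cover_map (x : prod_mod Z) : X := \sum_(k < n) arr_map (a k) (prj k x).

Lemma arr_projective k : projective_in D (Z k).
Proof. by apply: tens_projective; [case: (arr_Pl (a k))|case: (arr_Ql (a k))]. Qed.

Lemma cover_projective : projective_in D (prod_mod Z).
Proof. by apply: prod_projective => k; exact: arr_projective. Qed.

Let wZ k : weak_module (Z k). Proof. by apply: D_weak; case: (arr_projective k). Qed.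

Lemma cover_hom : is_hom cover_map.
Proof.
apply: hom_bigsum; first exact: D_mlin.
move=> k.
exact: (@hom_comp _ _ (prod_mod Z) (Z k) X (prj k) (arr_map (a k)) (prj_hom Z k) (arr_hom (a k))).
Qed.

Lemma cover_surj : surj cover_map.
Proof.
move=> x; have : covered a x by rewrite ca.
move=> /(_ _ (sub_range cover_hom)) [|y _ <-]; last by exists y.
move=> k z; exists (inj k z) => //.
rewrite /cover_map (bigD1 k) //= prj_inj big1 ?addr0 // => l lk.
by rewrite prj_inj0 1?eq_sym // (hom0 (arr_hom (a l))).
Qed.

Lemma arr_local k : exists (T : mod_data (tens_voa U V)) (q : Z k -> T),
  linear_modes T /\ local_onto q.
Proof.
have [[CP _] [M [p [CM lp]]]] := arr_Pl (a k).
have [[CQ _] [W [q [CW lq]]]] := arr_Ql (a k).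
exists (tens_mod M W), (tens_map p q); split.
  apply: weak_mlin; apply: (tens_weak vU vV); [exact: adm_weak hCU _ CM|exact: adm_weak hCV _ CW].
exact: (local_tens vU vV hCU hCV CP CM CQ CW lp lq).
Qed.

End Cover.
End Arrows.

(** Nakayama's lemma for a product of local modules, whose radical consists of the vectors killed by
    all [q k]. *)
Lemma prod_nakayama n (Z T : 'I_n -> mod_data (tens_voa U V))
  (q : forall k, Z k -> T k) (A : set (prod_mod Z)) :
  (forall k, weak_module (Z k)) -> (forall k, linear_modes (T k)) ->
  (forall k, local_onto (q k)) -> is_submodule A ->
  (forall x, exists a r, [/\ A a, forall k, q k (prj k r) = 0 & x = a + r]) ->
  A = setT.
Proof.
move=> wZ lT lq sA hA.
have lP : linear_modes (prod_mod Z) by exact: weak_mlin (prod_weak wZ (tens_voa_truncated vU vV)).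
have hq k : is_hom (q k) by case: (lq k) => [[]].
(* Radical vectors with zero coordinates from [m] on. They let the radical be removed one coordinate
   at a time, from [n] down to 0. *)
pose R (m : nat) : set (prod_mod Z) :=
  fun r => forall k : 'I_n, q k (prj k r) = 0 /\ ((m <= k)%N -> prj k r = 0).
have sR m : is_submodule (R m).
  split.
  - move=> k; split=> //; exact: (hom0 (hom_comp (prj_hom Z k) (hq k))).
  - move=> c x y hx hy k; have [x1 x2] := hx k; have [y1 y2] := hy k.
    have [lp _] := prj_hom Z k; have [lqk _] := hq k.
    split; first by rewrite lp lqk x1 y1 scaler0 addr0.
    by move=> mk; rewrite lp x2 // y2 // scaler0 addr0.
  - move=> v j x hx k; have [x1 x2] := hx k.
    have [_ yp] := prj_hom Z k; have [_ yq] := hq k.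
    split; first by rewrite yp yq x1 mode0r.
    by move=> mk; rewrite yp x2 // mode0r //; exact: weak_mlin.
have H m : (m <= n)%N -> sadd A (R m) = setT -> A = setT.
  elim: m => [|m IH] mn e.
    apply/seteqP; split=> // x _; have : sadd A (R 0%N) x by rewrite e.
    move=> [a [r [Aa Rr ->]]]; rewrite (_ : r = 0) ?addr0 //.
    by apply: prod_ext => k; have [_ h] := Rr k; exact: h.
  apply: (IH (ltnW mn)); pose k0 := Ordinal mn.
  have sA' := sub_sadd lP sA (sR m).
  have ex (x : prod_mod Z) : exists r : prod_mod Z, q k0 (prj k0 r) = 0 /\
      sadd A (R m) (x - inj k0 (prj k0 r)).
    have : sadd A (R m.+1) x by rewrite e.
    move=> [a [r [Aa Rr ->]]]; exists r; split; first by case: (Rr k0).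
    rewrite -addrA; exists a, (r - inj k0 (prj k0 r)); split=> // k.
    have [r1 r2] := Rr k.
    have [<-|kk] := eqVneq k0 k.
      by rewrite (homB (prj_hom Z k0)) prj_inj subrr (hom0 (hq _)).
    rewrite (homB (prj_hom Z k)) prj_inj0 // subr0 r1; split=> // mk; apply: r2.
    rewrite ltn_neqAle mk andbT; apply: contraNneq kk => mk'.
    by apply/eqP/val_inj.
  (* Any [z] outside the kernel of [q k0] differs from an element of this set by a vector of that
     kernel, so the set is not contained in the kernel and locality fills the summand. *)
  have E1 : [set z | sadd A (R m) (inj k0 z)] = setT.
    have [[_ sq] [[t t0] _] locq] := lq k0.
    apply: locq; first exact: (sub_preimage (inj_hom wZ k0) sA').
    have [z zt] := sq t; have [r [qr h]] := ex (inj k0 z).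
    exists (z - prj k0 r); first by rewrite /= (homB (inj_hom wZ k0)).
    by rewrite (homB (hq k0)) qr subr0 zt.
  apply/seteqP; split=> // x _; have [r [_ h]] := ex x.
  rewrite -[x](subrK (inj k0 (prj k0 r))); apply: (subD sA') => //.
  by rewrite -[sadd _ _ _]/([set z | sadd A (R m) (inj k0 z)] (prj k0 r)) E1.
apply: (H n (leqnn n)); apply/seteqP; split=> // x _.
have [a [r [Aa qr ->]]] := hA x; exists a, r; split=> // k; split; first exact: qr.
by rewrite leqNgt ltn_ord.
Qed.

Lemma D_enough : enough_projectives CU -> enough_projectives CV -> enough_projectives D.
Proof.
move=> eU eV X DX; have [n [a ca]] := exists_cover DX eU eV.
exists (prod_mod (fun k => tens_mod (arr_P (a k)) (arr_Q (a k)))), (cover_map (a := a)).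
split; first exact: cover_projective.
by split; [exact: cover_hom|exact: cover_surj].
Qed.

(** A kernel vector with k-th coordinate [z] expresses the image of [z] through the other terms, so
    the k-th arrow is redundant. *)
Lemma cover_drop X n (a : 'I_n -> arrow X) k : covered a = setT ->
  (forall z, exists2 y, cover_map (a := a) y = 0 & prj k y = z) ->
  exists m (b : 'I_m -> arrow X), (m < n)%N /\ covered b = setT.
Proof.
case: n a k => [|n] a k ca hk; first by case: k {hk}.
exists n, (fun j => a (lift k j)); split=> //.
apply/seteqP; split=> // x _ A sA hA; have : covered a x by rewrite ca.
apply=> // l; have [j ->|->] := unliftP k l => z; first exact: hA.
have [y y0 <-] := hk z.
move: y0; rewrite /cover_map (bigD1_ord k) //= => /eqP; rewrite addr_eq0 => /eqP ->.
by apply: (subN sA); apply: (sub_sum sA) => j; exact: hA.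
Qed.

(* In a covering of [X] with the least number of terms the kernel of the
   covering map projects onto no summand, hence lies in the radical. *)
Lemma D_projective_sum X : enough_projectives CU -> enough_projectives CV ->
  projective_in D X ->
  exists (n : nat) (P : 'I_n -> mod_data U) (Q : 'I_n -> mod_data V),
    [/\ forall i, projective_in CU (P i), forall i, projective_in CV (Q i)
      & finite_direct_sum (fun i => tens_mod (P i) (Q i)) X].
Proof.
move=> eU eV [DX prX].
pose N n := `[< exists a : 'I_n -> arrow X, covered a = setT >].
have exN : exists n, N n.
  by have [n [a ca]] := exists_cover DX eU eV; exists n; apply/asboolP; exists a.
case: (ex_minnP exN) => n /asboolP[a ca] nmin.
exists n, (fun k => arr_P (a k)), (fun k => arr_Q (a k)); split.
- by move=> k; case: (arr_Pl (a k)).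
- by move=> k; case: (arr_Ql (a k)).
pose Z k := tens_mod (arr_P (a k)) (arr_Q (a k)).
have wZ k : weak_module (Z k) by apply: D_weak; case: (arr_projective a k).
have hpi := cover_hom a DX; have spi := cover_surj DX ca.
have DZ : D (prod_mod Z) by case: (cover_projective a).
have lP := D_mlin DZ; have lX := D_mlin DX.
have [s hs sE] := prX _ _ _ (fun x : X => x) DZ DX (conj hpi spi) (@hom_id _ _ X).
have {}sE x : cover_map (s x) = x by exact: (congr1 (fun f => f x) sE).
have nk k : ~ forall z : Z k, exists2 y : prod_mod Z, cover_map y = 0 & prj k y = z.
  move=> hk; have [m [b [mn cb]]] := cover_drop ca hk.
  have : N m by apply/asboolP; exists b.
  by move/nmin; rewrite leqNgt mn.
have Tq k := cid (arr_local a k); pose T k := sval (Tq k).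
have Qq k : {q : Z k -> T k | linear_modes (T k) /\ local_onto q} := cid (svalP (Tq k)).
pose q k := sval (Qq k).
have lT k : linear_modes (T k) by case: (svalP (Qq k)).
have lq k : local_onto (q k) by case: (svalP (Qq k)).
(* Projectivity of [X] gives the section [s]. Every vector is in its range up to a kernel vector,
   hence up to the radical, and [prod_nakayama] makes [s] onto; the covering map is then
   bijective. *)
have sT : range s = setT.
  apply: (prod_nakayama wZ lT lq (sub_range hs)) => x.
  exists (s (cover_map x)), (x - s (cover_map x)); split.
  - by exists (cover_map x).
  - move=> k; apply: contrapT => /eqP qk; apply: (nk k) => z.
    have [_ _ loc] := lq k.
    have e : (prj k) @` [set y : prod_mod Z | cover_map y = 0] = setT.
      apply: loc; first exact: (sub_image (prj_hom Z k) (sub_ker lX hpi)).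
      exists (prj k (x - s (cover_map x))) => //.
      by exists (x - s (cover_map x)) => //=; rewrite (homB hpi) sE subrr.
    have : [set: Z k] z by [].
    by rewrite -e => -[y ? ?]; exists y.
  - by rewrite addrC subrK.
exists (fun k => @arr_map X (a k)); split; first by move=> k; exact: arr_hom.
move=> w; have [x xw] := spi w; exists x; split; first by rewrite -xw.
move=> y yw; have : range s x by rewrite sT.
move=> [u _ us]; have : range s (y : prod_mod Z) by rewrite sT.
move=> [u' _ us']; rewrite -us -us'; congr s.
by rewrite -[u]sE -[u']sE us us' xw yw.
Qed.

Lemma D_projective_cover (M PM : mod_data U) (W PW : mod_data V)
    (pM : PM -> M) (pW : PW -> W) :
  CU M -> simple_module M -> projective_cover CU pM ->
  CV W -> simple_module W -> projective_cover CV pW ->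
  projective_cover D (tens_map pM pW).
Proof.
move=> CM sM cM CW sW cW.
have [_ prM [hM suM] _] := cM; have [_ prW [hW suW] _] := cW.
have [CPM _] := prM; have [CPW _] := prW.
have loc := local_tens vU vV hCU hCV CPM CM CPW CW
  (cover_local hCU sM cM) (cover_local hCV sW cW).
have [[ht st] [[t0 t0n] _] locI] := loc.
have prT := tens_projective prM prW; have DMW := tens_in_D hU hV hCU hCV CM CW.
split=> // P' p' [DP' prP'] [hp' sp'].
have [DT _] := prT.
have [f hf fE] := prP' _ _ _ p' DT DMW (conj ht st) hp'.
exists f => //; split=> // y.
have [x px] := sp' t0.
have fx : tens_map pM pW (f x) = t0.
  by rewrite -px; exact: (congr1 (fun g => g x) fE).
have e : range f = setT.
  apply: locI; first exact: sub_range hf.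
  by exists (f x); [exists x|rewrite fx].
by have : [set: tens_mod PM PW] y by []; rewrite -e => -[z _ <-]; exists z.
Qed.

End DCategory.

Theorem theorem3p11 (R : realType) (U V : voa_data R[i])
    (CU : mod_cat U) (CV : mod_cat V)
    (hU : is_voa U) (hV : is_voa V)
    (hCU : admissible_cat CU) (hCV : admissible_cat CV) :
  (forall (M PM : mod_data U) (W PW : mod_data V)
          (pM : PM -> M) (pW : PW -> W),
      CU M -> simple_module M -> projective_cover CU pM ->
      CV W -> simple_module W -> projective_cover CV pW ->
      projective_cover (Dcat CU CV) (tens_map pM pW)) /\
  (enough_projectives CU -> enough_projectives CV ->
   enough_projectives (Dcat CU CV) /\
   forall X : mod_data (tens_voa U V), projective_in (Dcat CU CV) X ->
     exists (n : nat) (P : 'I_n -> mod_data U) (Q : 'I_n -> mod_data V),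
       [/\ forall i, projective_in CU (P i),
           forall i, projective_in CV (Q i)
         & finite_direct_sum (fun i => tens_mod (P i) (Q i)) X]).
Proof.
split=> [M PM W PW pM pW|eU eV]; first exact: D_projective_cover.
split; first exact: D_enough.
by move=> X; exact: D_projective_sum.
Qed.
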